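(* Let $1<p<\infty$ and let $$\lambda^1_\ell=\min_{v\in W^{1,p}_0(\Omega_\ell),\,v\ne0}\frac{\int_{\Omega_\ell}H^p(\nabla v)\,dx}{\int_{\Omega_\ell}|v|^p\,dx},\qquad \mu_\infty=\min_{w\in W^{1,p}_0(\omega_2),\,w\neq0}\frac{\int_{\omega_2}H^p(\nabla_2w)\,dX_2}{\int_{\omega_2}|w|^p\,dX_2}.$$ Then there exists a constant $C=C(p,\mu_\infty)$, independent of $\ell$, such that for all $\ell$ sufficiently large $$\mu_\infty\le\lambda^1_\ell\le\mu_\infty+\frac{C}{\ell}.$$
   Context: Let $1\le m<n$, let $\omega_1\subset\mathbb{R}^m$ be open, bounded and convex with $0\in\omega_1$, and let $\omega_2\subset\mathbb{R}^{n-m}$ be open and bounded. For $\ell>0$ set $\Omega_\ell=\ell\omega_1\times\omega_2\subset\mathbb{R}^n$. Points are written $x=(X_1,X_2)$ with $X_1\in\mathbb{R}^m$, $X_2\in\mathbb{R}^{n-m}$, and $\nabla_2:=(0,\dots,0,\partial_{x_{m+1}},\dots,\partial_{x_n})\in\mathbb{R}^n$. $H:\mathbb{R}^n\to[0,+\infty)$ satisfies: $H(x)>0$ for $x\neq0$; $H$ is convex; $H(tx)=|t|H(x)$ for all $t\in\mathbb{R}$, $x\in\mathbb{R}^n$; $H\in C^1(\mathbb{R}^n\setminus\{0\})$. The field $H^{p-1}(z)\nabla H(z)$ is understood to be $0$ at $z=0$. Standing assumptions: there are constants $c_1,c_2,c_3>0$ such that for all $z_1,z_2\in\mathbb{R}^n$: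 (i) if $p\ge2$, $\langle H^{p-1}(z_1)\nabla H(z_1)-H^{p-1}(z_2)\nabla H(z_2),\,z_1-z_2\rangle\ge c_1|z_1-z_2|^p$; (ii) if $1<p<2$, $\langle H^{p-1}(z_1)\nabla H(z_1)-H^{p-1}(z_2)\nabla H(z_2),\,z_1-z_2\rangle\ge c_2|z_1-z_2|^2(|z_1|+|z_2|)^{p-2}$; (iii) if $1<p<2$, $|H^{p-1}(z_1)\nabla H(z_1)-H^{p-1}(z_2)\nabla H(z_2)|\le c_3|z_1-z_2|(|z_1|+|z_2|)^{p-2}$ (in (ii) and (iii) the right-hand side is read as $0$ when $z_1=z_2=0$). *)

(* Defs.v *)
From HB Require Import structures.
From mathcomp Require Import all_boot all_order all_algebra.
From mathcomp Require Import all_classical all_reals all_analysis.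

Set Implicit Arguments.
Unset Strict Implicit.
Unset Printing Implicit Defensive.

Import Order.TTheory GRing.Theory Num.Theory.
Import numFieldNormedType.Exports.

Local Open Scope classical_set_scope.
Local Open Scope ring_scope.

Definition rV_display : measure_display.
Proof. exact: default_measure_display. Qed.

(** The sigma-algebra generated by the coordinate maps; as [n] is finite, it is
    the Borel sigma-algebra of ['rV[R]_n]. *)
Section rV_measurable.
Variables (R : realType) (n : nat).

Let coors (i : 'I_n) (x : 'rV[R]_n) : R := x ord0 i.

Let rV_set0 : g_sigma_preimage coors set0.
Proof. exact: sigma_algebra0. Qed.

Let rV_setC A : g_sigma_preimage coors A -> g_sigma_preimage coors (~` A).
Proof. exact: sigma_algebraC. Qed.

Let rV_bigcup (F : (set 'rV[R]_n)^nat) :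
  (forall i, g_sigma_preimage coors (F i)) ->
  g_sigma_preimage coors (\bigcup_i (F i)).
Proof. exact: sigma_algebra_bigcup. Qed.

HB.instance Definition _ := @isMeasurable.Build rV_display
  'rV[R]_n (g_sigma_preimage coors) rV_set0 rV_setC rV_bigcup.

End rV_measurable.

Section lebesgue_rV.
Variable R : realType.

Definition rV_cons n (z : R * 'rV[R]_n) : 'rV[R]_n.+1 :=
  \row_i oapp (z.2 ord0) z.1 (unlift ord0 i).

Definition rV_uncons n (x : 'rV[R]_n.+1) : R * 'rV[R]_n :=
  (x ord0 ord0, \row_j x ord0 (lift ord0 j)).

Lemma rV_consK n : cancel (@rV_cons n) (@rV_uncons n).
Proof.
move=> [a v]; rewrite /rV_uncons !mxE unlift_none /=; congr pair.
by apply/rowP => j; rewrite !mxE liftK.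
Qed.

Lemma rV_unconsK n : cancel (@rV_uncons n) (@rV_cons n).
Proof.
move=> x; apply/rowP => i; rewrite mxE.
by case: unliftP => [j ->|->] //=; rewrite mxE.
Qed.

Lemma measurable_coord n (i : 'I_n) :
  measurable_fun [set: 'rV[R]_n] (fun x => x ord0 i).
Proof.
move=> _ Y mY; rewrite setTI; apply: sub_sigma_algebra => /=.
rewrite -bigcup_seq/=; exists i => /=; first by rewrite mem_index_enum.
by exists Y => //; rewrite setTI.
Qed.

Lemma measurable_fun_rV d (T : measurableType d) n (f : T -> 'rV[R]_n) :
  (forall i, measurable_fun setT (fun t => f t ord0 i)) ->
  measurable_fun [set: T] f.
Proof.
move=> mf; apply: (@measurability _ _ _ _ setT f
  (\big[setU/set0]_(i < n) preimage_set_system setT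
     (fun x : 'rV[R]_n => x ord0 i) measurable)).
  by [].
move=> _ [B + <-]; rewrite -bigcup_seq => -[i _ [C mC <-]].
by rewrite !setTI; have := mf i measurableT C mC; rewrite setTI.
Qed.

Lemma measurable_rV_cons n : measurable_fun setT (@rV_cons n).
Proof.
apply: measurable_fun_rV => i.
case: (unliftP ord0 i) => [j ->|->].
  rewrite [X in measurable_fun _ X](_ : _ = (fun x : 'rV[R]_n => x ord0 j) \o snd).
    by apply: measurableT_comp => //; exact: measurable_coord.
  by apply/funext => z /=; rewrite mxE liftK.
rewrite [X in measurable_fun _ X](_ : _ = fst)//.
by apply/funext => z; rewrite mxE unlift_none.
Qed.

Lemma measurable_rV_uncons n : measurable_fun setT (@rV_uncons n).
Proof.
apply/measurable_fun_pairP; split; first exact: measurable_coord.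
apply: measurable_fun_rV => i.
rewrite [X in measurable_fun _ X](_ : _ = (fun x : 'rV[R]_n.+1 => x ord0 (lift ord0 i))).
  exact: measurable_coord.
by apply/funext => x /=; rewrite mxE.
Qed.

Section step.
Variables (n : nat) (mu : {sigma_finite_measure set 'rV[R]_n -> \bar R}).

Definition lebesgue_rV_step : set 'rV[R]_n.+1 -> \bar R :=
  pushforward (lebesgue_measure \x mu)%E (@rV_cons n).

Let mcons := @measurable_rV_cons n.

Let step0 : lebesgue_rV_step set0 = 0%E.
Proof. exact: (measure0 (pushforward _ _)). Qed.

Let step_ge0 A : (0 <= lebesgue_rV_step A)%E.
Proof. exact: (measure_ge0 (pushforward _ _)). Qed.

Let step_sigma_additive : semi_sigma_additive lebesgue_rV_step.
Proof. exact: (@measure_semi_sigma_additive _ _ _ (pushforward _ _)). Qed.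

HB.instance Definition _ := isMeasure.Build _ _ _ lebesgue_rV_step
  step0 step_ge0 step_sigma_additive.

Let step_sigma_finite : sigma_finite setT lebesgue_rV_step.
Proof.
have /sigma_finiteP[F [TF ndF Foo]] :=
  sigma_finiteT (@lebesgue_measure R : {sigma_finite_measure set _ -> \bar R}).
have /sigma_finiteP[G [TG ndG Goo]] := sigma_finiteT mu.
exists (fun k => @rV_uncons n @^-1` (F k `*` G k)).
  rewrite -preimage_bigcup -[LHS](preimage_setT (@rV_uncons n)); congr preimage.
  apply/seteqP; split => // -[x y] _.
  have [i _ Fix] : (\bigcup_k F k) x by rewrite -TF.
  have [j _ Gjy] : (\bigcup_k G k) y by rewrite -TG.
  exists (maxn i j) => //; split => /=.
    by move: x Fix; exact/subsetPset/ndF/leq_maxl.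
  by move: y Gjy; exact/subsetPset/ndG/leq_maxr.
move=> k; have [mF Fk] := Foo k; have [mG Gk] := Goo k; split.
  rewrite -[X in measurable X]setTI; apply: measurable_rV_uncons => //.
  exact: measurableX.
rewrite /lebesgue_rV_step /pushforward (_ : _ @^-1` _ = F k `*` G k); last first.
  by apply/seteqP; split => z; rewrite /preimage /mkset rV_consK.
by rewrite product_measure1E// lte_mul_pinfty// ge0_fin_numE.
Qed.

HB.instance Definition _ := Measure_isSigmaFinite.Build _ _ _ lebesgue_rV_step
  step_sigma_finite.

End step.

Fixpoint lebesgue_rV n : {sigma_finite_measure set 'rV[R]_n -> \bar R} :=
  match n with
  | 0%N => \d_(0 : 'rV[R]_0)
  | n'.+1 => lebesgue_rV_step (lebesgue_rV n')
  end.

End lebesgue_rV.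

Section calculus.
Variables (R : realType) (n : nat).
Implicit Types (f : 'rV[R]_n -> R) (U : set 'rV[R]_n).

(** The norm of the library on ['rV[R]_n] is the maximum norm; it is only used
    through its topology, and [enorm] is the Euclidean norm. *)
Definition dotr (x y : 'rV[R]_n) : R := \sum_i x ord0 i * y ord0 i.

Definition enorm (x : 'rV[R]_n) : R := Num.sqrt (dotr x x).

Definition partial (i : 'I_n) f : 'rV[R]_n -> R :=
  fun x => 'D_(delta_mx ord0 i) f x.

Definition grad f (x : 'rV[R]_n) : 'rV[R]_n := \row_i partial i f x.

Definition C1_on U f : Prop :=
  forall x, U x -> differentiable f x /\ {for x, continuous (grad f)}.

Definition smooth f : Prop :=
  forall s : seq 'I_n,
    continuous (foldr partial f s) /\
    forall i x, derivable (foldr partial f s) x (delta_mx ord0 i).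

Definition fsupport f : set 'rV[R]_n := closure [set x | f x != 0].

(** [C_c^oo(U)], as functions on the whole space vanishing outside [U] *)
Definition test_fun U f : Prop :=
  [/\ smooth f, compact (fsupport f) & fsupport f `<=` U].

End calculus.

Section sobolev.
Variables (R : realType) (n : nat).
Implicit Types (U : set 'rV[R]_n) (p : R).
Implicit Types (v : 'rV[R]_n -> R) (g : 'rV[R]_n -> 'rV[R]_n).

Local Notation mu := (lebesgue_rV R n).

Definition Lp p U v : Prop := v \_ U \in Lfun mu p%:E.

Definition Lp_norm p U v : \bar R := 'N[mu]_(p%:E)[EFin \o (v \_ U)]%E.

Definition weak_grad U v g : Prop :=
  forall (i : 'I_n) (phi : 'rV[R]_n -> R), test_fun U phi ->
    \int[mu]_(x in U) (v x * partial i phi x) =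
    - \int[mu]_(x in U) (g x ord0 i * phi x).

(** [v] belongs to [W^{1,p}(U)] and [g] is its weak gradient. *)
Definition W1p p U v g : Prop :=
  [/\ Lp p U v, (forall i, Lp p U (fun x => g x ord0 i)) & weak_grad U v g].

(** [v] belongs to the closure of [C_c^oo(U)] in [W^{1,p}(U)] and [g] is its
    weak gradient. *)
Definition W1p0 p U v g : Prop :=
  W1p p U v g /\
  exists phi : nat -> 'rV[R]_n -> R,
    [/\ forall k, test_fun U (phi k),
        Lp_norm p U (fun x => phi k x - v x) @[k --> \oo] --> 0%E
      & forall i : 'I_n,
        Lp_norm p U (fun x => partial i (phi k) x - g x ord0 i) @[k --> \oo]
          --> 0%E].

(** The values of the quotient
    [\int_U F^p(grad v) / \int_U |v|^p], [v] in [W^{1,p}_0(U)], [v != 0]. *)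
Definition rayleigh p U (F : 'rV[R]_n -> R) : set R :=
  [set r | exists v g,
    [/\ W1p0 p U v g, ~ {ae mu, forall x, U x -> v x = 0}
      & r = \int[mu]_(x in U) (F (g x) `^ p) /
            \int[mu]_(x in U) (`|v x| `^ p)]].

Definition eigen1 p U (F : 'rV[R]_n -> R) : R := inf (rayleigh p U F).

(** [eigen1] is defined as an infimum to be total; it is the minimum whenever
    the minimum is attained. *)
Lemma eigen1_min p U F r :
  rayleigh p U F r -> lbound (rayleigh p U F) r -> eigen1 p U F = r.
Proof.
move=> Sr lr; apply/eqP; rewrite eq_le; apply/andP; split.
  by apply: ge_inf => //; exists r.
by apply: lb_le_inf => //; exists r.
Qed.

End sobolev.

Section setting.
Variable R : realType.

Definition C1_norm n (H : 'rV[R]_n -> R) : Prop :=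
  [/\ (forall x, 0 <= H x) /\ (forall x, x != 0 -> 0 < H x),
      convex_function setT H,
      forall t x, H (t *: x) = `|t| * H x
    & C1_on [set x | x != 0] H].

Definition flux p n (H : 'rV[R]_n -> R) (z : 'rV[R]_n) : 'rV[R]_n :=
  if z == 0 then 0 else H z `^ (p - 1) *: grad H z.

(** For [p < 2] and [z1 = z2 = 0] the right-hand sides below vanish, since
    [0 `^ a = 0] for [a != 0]. *)
Definition flux_bounds p n (H : 'rV[R]_n -> R) : Prop :=
  exists c1 c2 c3 : R, [/\ 0 < c1, 0 < c2, 0 < c3 &
    forall z1 z2 : 'rV[R]_n,
    [/\ 2 <= p ->
          c1 * enorm (z1 - z2) `^ p
          <= dotr (flux p H z1 - flux p H z2) (z1 - z2),
        1 < p < 2 ->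
          c2 * enorm (z1 - z2) ^+ 2 * (enorm z1 + enorm z2) `^ (p - 2)
          <= dotr (flux p H z1 - flux p H z2) (z1 - z2)
      & 1 < p < 2 ->
          enorm (flux p H z1 - flux p H z2)
          <= c3 * enorm (z1 - z2) * (enorm z1 + enorm z2) `^ (p - 2)]].

Definition cylinder m k (w1 : set 'rV[R]_m) (w2 : set 'rV[R]_k) (l : R) :
    set 'rV[R]_(m + k) :=
  [set x | ( *:%R l @` w1) (lsubmx x) /\ w2 (rsubmx x)].

Definition lambda1 p m k (H : 'rV[R]_(m + k) -> R) (w1 : set 'rV[R]_m)
    (w2 : set 'rV[R]_k) (l : R) : R :=
  eigen1 p (cylinder w1 w2 l) H.

(** [row_mx 0 (grad w)] is the vector [(0, ..., 0, d_1 w, ..., d_k w)]. *)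
Definition mu_oo p m k (H : 'rV[R]_(m + k) -> R) (w2 : set 'rV[R]_k) : R :=
  eigen1 p w2 (fun z => H (row_mx 0 z)).

End setting.

(* Main.v *)
Require Import Defs.
From mathcomp Require Import all_boot all_order all_algebra.
From mathcomp Require Import all_classical all_reals all_analysis.
From mathcomp Require Import measurable_realfun ring lra.

Set Implicit Arguments.
Unset Strict Implicit.
Unset Printing Implicit Defensive.

Import Order.TTheory GRing.Theory Num.Theory.
Import numFieldNormedType.Exports.

Local Open Scope classical_set_scope.
Local Open Scope ring_scope.

(** Both Rayleigh quotients may be minimized over test functions only, so no minimizer is needed.

    Lower bound: for a test function [v] on the cylinder, let [u y] be the [L^p] norm of the slice
    [v (., y)]. By convexity of [H^p], [H (0, grad u)^p] is at most the integral of [H (grad v)^p]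
    along the slice, while [u] and [v] have the same [L^p] norm. As [u] need not be smooth, [|v|] is
    replaced by [sqrt (v^2 + s^2)] and [s] tends to [0].

    Upper bound: test with [phi (x / l) w y] and with [phi (- x / l) w y]. By 1-homogeneity, averaging
    the two energies makes a symmetric second difference of [H^p] appear, in which the terms linear in
    [1 / l] cancel up to an arbitrarily small factor because [H] is [C^1] away from [0]. Hence the error
    is [o (1 / l)] and the constant [1] works. *)

(** * Row vectors *)

(** The slice estimate rests on a cancellation. As [v] vanishes where the first variable is large,
    each derivative of the regularised [|v|^p] in the first block has integral zero over a slice.
    The weighted slice average of [grad v] is therefore exactly a positive multiple of
    [(0, grad u)]; pairing it with [grad H] taken at that average, and then Jensen's inequality for
    [t^p], give the bound.

    The regularisation is not compactly supported, so slices are integrated over a fixed box, and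
    the value of the root on a zero slice is subtracted. This keeps [u] a test function without
    touching its gradient, and costs an amount of mass proportional to [s], with a factor free of
    [s].

    In the upper bound the bump [phi] is fixed once and for all. The factor of the terms linear in
    [1 / l] is then chosen from [phi] and [mu_oo], and the remaining term is of order [l^(-p)] with
    [p > 1]. All these choices enter the threshold for [l], none the constant.

    As the infimum of the empty set is [0], both bounds also need that the two sets of Rayleigh
    quotients are empty together. *)

Definition box (R : realType) n (M : R) : set 'rV[R]_n := [set x | `|x| <= M].
Arguments box {R} n M _ /.

Section rV_topology.
Context {R : realType}.

Lemma rV_normE n (x : 'rV[R]_n) :
  `|x| = \big[Num.max/0]_(ij : 'I_1 * 'I_n) `|x ij.1 ij.2|.
Proof. exact: mx_normrE. Qed.

Lemma rV_norm_leP n (x : 'rV[R]_n) (M : R) : 0 <= M ->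
  `|x| <= M <-> forall i, `|x ord0 i| <= M.
Proof.
move=> M0; rewrite rV_normE; split=> [+ i|xM].
  by apply: le_trans; apply/bigmax_geP; right => /=; exists (ord0, i).
by apply/bigmax_leP; split=> // -[a i] _ /=; rewrite (ord1 a).
Qed.

Lemma rV_norm_ltP n (x : 'rV[R]_n) (M : R) : 0 < M ->
  `|x| < M <-> forall i, `|x ord0 i| < M.
Proof.
move=> M0; rewrite rV_normE; split=> [/bigmax_ltP[_ +] i|xM].
  by move=> /(_ (ord0, i)); exact.
by apply/bigmax_ltP; split=> // -[a i] _ /=; rewrite (ord1 a).
Qed.

Lemma coord_le_norm n (x : 'rV[R]_n) i : `|x ord0 i| <= `|x|.
Proof. by move: i; apply/rV_norm_leP. Qed.

Lemma rV_cvg (T : Type) (F : set_system T) {FF : Filter F} n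
    (f : T -> 'rV[R]_n) (x : 'rV[R]_n) :
  (forall i, (fun t => f t ord0 i) @ F --> x ord0 i) -> f @ F --> x.
Proof.
move=> cf; apply/cvgrPdist_lt => e e0.
near=> s; apply/(rV_norm_ltP _ e0); near: s.
apply: filter_forall => i.
have /cvgrPdist_lt /(_ _ e0) := cf i.
by apply: filterS => s; rewrite !mxE.
Unshelve. all: by end_near. Qed.

Lemma rV_continuousP (T : topologicalType) n (f : T -> 'rV[R]_n) :
  (forall i, continuous (fun t => f t ord0 i)) -> continuous f.
Proof. by move=> cf t; apply: rV_cvg => i; exact: cf. Qed.

Lemma continuous_row_mx (T : topologicalType) m k
    (f : T -> 'rV[R]_m) (g : T -> 'rV[R]_k) :
  continuous f -> continuous g -> continuous (fun t => row_mx (f t) (g t)).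
Proof.
move=> cf cg; apply: rV_continuousP => i.
under eq_fun do rewrite mxE.
case: (fintype.split i) => j t.
  by apply: (@continuous_comp _ _ _ f (fun x : 'rV_m => x ord0 j)); [exact: cf|exact: coord_continuous].
by apply: (@continuous_comp _ _ _ g (fun x : 'rV_k => x ord0 j)); [exact: cg|exact: coord_continuous].
Qed.

Lemma continuous_lsubmx m k : continuous (@lsubmx R 1 m k).
Proof.
apply: rV_continuousP => i.
under eq_fun do rewrite mxE.
exact: coord_continuous.
Qed.

Lemma continuous_rsubmx m k : continuous (@rsubmx R 1 m k).
Proof.
apply: rV_continuousP => i.
under eq_fun do rewrite mxE.
exact: coord_continuous.
Qed.

Lemma compact_box n (M : R) : compact (box n M).
Proof.
apply: bounded_closed_compact.
  by exists M; split; [exact: num_real|move=> y My x /= /le_trans; apply; exact: ltW].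
rewrite (_ : box n M = (fun x => `|x|) @^-1` [set y | y <= M])//.
by apply: closed_comp => [x _|]; [exact: norm_continuous|exact: closed_le].
Qed.

End rV_topology.

Section rV_measurability.
Context {R : realType}.

(** Cubes with rational centre and radius [1 / (N + 1)] are measurable through the coordinate maps,
    there are countably many of them, and those contained in [U] cover it. *)
Lemma open_measurable_rV n (U : set 'rV[R]_n) : open U -> measurable U.
Proof.
move=> oU.
pose B (c : 'rV[rat]_n * nat) : set 'rV[R]_n :=
  [set x | forall i, `|x ord0 i - ratr (c.1 ord0 i)| < c.2.+1%:R^-1].
have mB c : measurable (B c).
  rewrite (_ : B c = \bigcap_(i in [set: 'I_n])
      (fun x => x ord0 i) @^-1` (ball (ratr (c.1 ord0 i) : R) c.2.+1%:R^-1)).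
    apply: fin_bigcap_measurable => // i _.
    rewrite -[X in measurable X]setTI; apply: measurable_coord => //.
    exact: measurable_ball.
  apply/seteqP; split=> x /=.
    by move=> Bx i _ /=; rewrite -ball_normE /= distrC; exact: Bx.
  by move=> Bx i; have := Bx i I; rewrite /= -ball_normE /= distrC.
(* The union runs over all indices, with the empty set for the cubes that leave [U], so that it is
   indexed by a whole countable type. *)
rewrite (_ : U = \bigcup_(c in [set: 'rV[rat]_n * nat]) (if `[< B c `<=` U >] then B c else set0)).
  apply: countable_bigcupT_measurable; first exact: countableP.
  by move=> c; case: ifP.
apply/seteqP; split=> x; last first.
  by case=> c _; case: ifPn => // /asboolP; exact.
move=> Ux.
have /nbhs_ballP[e e0 xe] : nbhs x U by exact: open_nbhs_nbhs.
(* The factor [2] is the triangle inequality through the centre: two points of one cube differ by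
   less than twice its radius in each coordinate. *)
have [N N2e] : exists N : nat, 2 * N.+1%:R^-1 < e.
  have [N _] := near_infty_natSinv_lt (PosNum (divr_gt0 e0 (@ltr0Sn R 1))).
  by move=> /(_ N (leqnn _)) /= H; exists N; rewrite mulrC -ltr_pdivlMr.
have N0 : 0 < N.+1%:R^-1 :> R by rewrite invr_gt0.
have /choice[q qP] (i : 'I_n) : exists q : rat, `|x ord0 i - ratr q| < N.+1%:R^-1.
  have [|q] := @rat_in_itvoo R (x ord0 i - N.+1%:R^-1) (x ord0 i + N.+1%:R^-1).
    by rewrite ltrBlDr -addrA ltrDl addr_gt0.
  by rewrite in_itv/= => /andP[q1 q2]; exists q; rewrite distrC ltr_distl q1 q2.
exists (\row_i q i, N) => //; case: ifPn; last first.
  move=> /asboolPn; apply: contra_notP => _ y /= By; apply: xe.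
  rewrite mx_norm_ball /ball_/=; apply/rV_norm_ltP => // i; rewrite !mxE.
  have := By i; have := qP i; rewrite /= mxE => h1 h2.
  rewrite (_ : _ - _ = (x ord0 i - ratr (q i)) - (y ord0 i - ratr (q i))); last by ring.
  by rewrite (le_lt_trans (ler_normB _ _))// (lt_trans _ N2e)// mulr_natl mulr2n ltrD.
by move=> _ i /=; rewrite mxE.
Qed.

Lemma continuous_measurable_rV n (f : 'rV[R]_n -> R) :
  continuous f -> measurable_fun setT f.
Proof.
move=> cf; apply: (measurability _ (RGenOpens.measurableE R)).
move=> _ [_ [a [b ->] <-]]; rewrite setTI; apply: open_measurable_rV.
by apply: open_comp => [x _|]; [exact: cf|exact: interval_open].
Qed.

Lemma measurable_box n (M : R) : measurable (box n M).
Proof.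
rewrite -[box n M]setCK; apply: measurableC; apply: open_measurable_rV.
apply: closed_openC; apply: compact_closed; first exact: norm_hausdorff.
exact: compact_box.
Qed.

Lemma box_fin n (M : R) : (lebesgue_rV R n (box n M) < +oo)%E.
Proof.
have [M0|M0] := ltP M 0.
  rewrite (_ : box n M = set0) ?measure0//.
  by apply/seteqP; split=> // x; rewrite /box/= leNgt (lt_le_trans M0).
elim: n => [|n IH]; first by rewrite /= diracE; case: (_ \in _); rewrite ltry.
rewrite /= /lebesgue_rV_step /pushforward.
rewrite (_ : _ @^-1` _ = `[- M, M]%classic `*` box n M).
  rewrite product_measure1E; [|exact: measurable_itv|exact: measurable_box].
  rewrite lte_mul_pinfty//.
  suff: (@lebesgue_measure R `[- M, M] \is a fin_num) by [].
  by rewrite lebesgue_measure_itv; case: ifP.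
apply/seteqP; split=> -[t x]; rewrite /box /=.
  move=> /(rV_norm_leP _ M0) tx; split.
    by have := tx ord0; rewrite mxE unlift_none /= in_itv/= ler_norml.
  by apply/(rV_norm_leP _ M0) => i; have := tx (lift ord0 i); rewrite mxE liftK.
move=> [tM /(rV_norm_leP _ M0) xM]; apply/(rV_norm_leP _ M0) => i; rewrite mxE.
by case: unliftP => [j _|_] //=; rewrite ler_norml; rewrite in_itv/= in tM.
Qed.

End rV_measurability.

Arguments compact_box {R} n M.
Arguments measurable_box {R} n M.
Arguments box_fin {R} n M.

(** * Integration over row vectors *)

(** This drives the inductions on [m]: the measure is built by adding coordinates in front, and
    [m.+1 + k] is convertible to [(m + k).+1], so both sides have the same type. *)
Lemma row_mx_cons (R : realType) m k (t : R) (x : 'rV[R]_m) (y : 'rV[R]_k) :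
  row_mx (rV_cons (t, x)) y = rV_cons (t, row_mx x y) :> 'rV[R]_(m.+1 + k).
Proof.
apply/rowP => i; rewrite [RHS]mxE /=; case: unliftP => [j ->|->] /=.
  have -> : lift ord0 j = (if fintype.split j is inl a then lshift k (lift ord0 a) else
       if fintype.split j is inr b then rshift m.+1 b else lshift k ord0) :> 'I_(m.+1 + k).
    by apply/val_inj; rewrite /= /bump leq0n; case: fintype.splitP => a ->.
  rewrite [RHS]mxE; case: fintype.splitP => a aE.
    by rewrite row_mxEl mxE liftK.
  by rewrite row_mxEr.
have -> : ord0 = lshift k (ord0 : 'I_m.+1) :> 'I_(m.+1 + k) by apply/val_inj.
by rewrite row_mxEl mxE unlift_none.
Qed.

Lemma Rintegral_sum (R : realType) (I : Type) (t : seq I) d (T : measurableType d)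
    (mu : {measure set T -> \bar R}) D (f : I -> T -> R) : measurable D ->
  (forall i, mu.-integrable D (EFin \o f i)) ->
  mu.-integrable D (EFin \o (fun x => \sum_(i <- t) f i x)) /\
  \int[mu]_(x in D) (\sum_(i <- t) f i x) = \sum_(i <- t) \int[mu]_(x in D) f i x.
Proof.
move=> mD intf; elim: t => [|i t [IH1 IH2]].
  rewrite big_nil; under eq_Rintegral do rewrite big_nil.
  rewrite (_ : EFin \o _ = cst 0%E); last by apply/funext => x; rewrite /= big_nil.
  by split; [exact: integrable0|rewrite Rintegral_cst// mul0r].
rewrite big_cons -IH2 -RintegralD//.
rewrite (_ : (fun x => \sum_(j <- i :: t) f j x) = (fun x => f i x + \sum_(j <- t) f j x)); last first.
  by apply/funext => x; rewrite big_cons.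
split=> //; rewrite (_ : EFin \o _ =
  (fun x => (f i x)%:E + (\sum_(j <- t) f j x)%R%:E)%E)//.
by apply: integrableD => //; exact: intf.
Qed.

Section rV_integration.
Context {R : realType}.
Local Open Scope ereal_scope.

Lemma measurable_row_mx m k :
  measurable_fun setT (fun z : 'rV[R]_m * 'rV[R]_k => row_mx z.1 z.2).
Proof.
apply: measurable_fun_rV => i.
under eq_fun do rewrite mxE.
case: (fintype.split i) => j.
  exact: measurableT_comp (@measurable_coord R m j) measurable_fst.
exact: measurableT_comp (@measurable_coord R k j) measurable_snd.
Qed.

Lemma ge0_integral_rV_cons n (f : 'rV[R]_n.+1 -> \bar R) :
  measurable_fun setT f -> (forall x, 0 <= f x) ->
  \int[lebesgue_rV R n.+1]_x f x =
  \int[lebesgue_measure]_t \int[lebesgue_rV R n]_x f (rV_cons (t, x)).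
Proof.
move=> mf f0.
transitivity (\int[(lebesgue_measure \x lebesgue_rV R n)]_z (f \o @rV_cons R n) z).
  have f0' : {in [set: 'rV[R]_n.+1], forall y, 0 <= f y} by move=> y _; exact: f0.
  have mc : @measurable_fun _ _ (measurableTypeR R * 'rV[R]_n)%type 'rV[R]_n.+1 setT
    (@rV_cons R n) := @measurable_rV_cons R n.
  pose m : {measure set (measurableTypeR R * 'rV[R]_n)%type -> \bar R} :=
    (lebesgue_measure \x lebesgue_rV R n).
  have := ge0_integral_pushforward mc m measurableT mf f0'.
  rewrite preimage_setT => <-; exact: eq_measure_integral.
rewrite (@fubini_tonelli1 _ _ _ _ R lebesgue_measure (lebesgue_rV R n) (f \o @rV_cons R n))//.
  by apply: measurableT_comp => //; exact: measurable_rV_cons.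
by move=> x; exact: f0.
Qed.

(** Tonelli's theorem for the two blocks, by peeling off the coordinates of the first block. In the
    base case the outer measure is the Dirac mass at the only point of the zero-dimensional
    space. *)
Lemma ge0_integral_row_mx m k (f : 'rV[R]_(m + k) -> \bar R) :
  measurable_fun setT f -> (forall x, 0 <= f x) ->
  \int[lebesgue_rV R (m + k)]_x f x =
  \int[lebesgue_rV R m]_x \int[lebesgue_rV R k]_y f (row_mx x y).
Proof.
elim: m f => [|m IH] f mf f0.
  rewrite integral_dirac//; last first.
    have mg : measurable_fun setT (fun z : 'rV[R]_0 * 'rV[R]_k => f (row_mx z.1 z.2)).
      by apply: measurableT_comp => //; exact: measurable_row_mx.
    exact: (measurable_fun_fubini_tonelli_F _ mg).
  rewrite diracT mul1e; apply: eq_integral => y _; congr f.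
  by apply/rowP => i; rewrite mxE; case: fintype.splitP => [[]//|j ij]; congr (y _ _); exact/val_inj.
rewrite [LHS]ge0_integral_rV_cons// [RHS]ge0_integral_rV_cons//; last 2 first.
- have mg : measurable_fun setT (fun z : 'rV[R]_m.+1 * 'rV[R]_k => f (row_mx z.1 z.2)).
    by apply: measurableT_comp => //; exact: measurable_row_mx.
  exact: (measurable_fun_fubini_tonelli_F _ mg).
- by move=> x; exact: integral_ge0.
apply: eq_integral => t _; rewrite IH//; last first.
  apply: measurableT_comp => //.
  exact: measurableT_comp (@measurable_rV_cons R _) (measurable_pair1 _).
by apply: eq_integral => x _; apply: eq_integral => y _; rewrite row_mx_cons.
Qed.

Lemma ge0_integral_row_mx_swap m k (f : 'rV[R]_(m + k) -> \bar R) :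
  measurable_fun setT f -> (forall x, 0 <= f x) ->
  \int[lebesgue_rV R (m + k)]_x f x =
  \int[lebesgue_rV R k]_y \int[lebesgue_rV R m]_x f (row_mx x y).
Proof.
move=> mf f0; rewrite ge0_integral_row_mx//.
have mg : measurable_fun setT (fun z : 'rV[R]_m * 'rV[R]_k => f (row_mx z.1 z.2)).
  by apply: measurableT_comp => //; exact: measurable_row_mx.
exact: (@fubini_tonelli _ _ _ _ R (lebesgue_rV R m) (lebesgue_rV R k) _ mg).
Qed.

(** By uniqueness of Lebesgue measure: [|s|] times the image of the measure under multiplication by
    [s] gives every half-open interval its length. *)
Lemma ge0_integral_scale1 (s : R) (f : R -> \bar R) : s != 0%R ->
  measurable_fun setT f -> (forall x, 0 <= f x) ->
  \int[lebesgue_measure]_t f (s * t)%R = (`|s|^-1)%:E * \int[lebesgue_measure]_t f t.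
Proof.
move=> s0 mf f0.
have ms : @measurable_fun _ _ (measurableTypeR R) (measurableTypeR R) setT ( *%R s).
  exact: measurable_funM.
have ns : (0 <= `|s|)%R by [].
have nuE A : measurable A ->
    lebesgue_measure A = `|s|%:E * lebesgue_measure ( *%R s @^-1` A).
  have := @lebesgue_measure_unique R
    (mscale (NngNum ns) (@pushforward _ _ (measurableTypeR R) (measurableTypeR R) R lebesgue_measure ( *%R s))).
  apply => // X [[a b]]/= ab <-.
  rewrite /mscale /= /pushforward.
  have [sp|sn] := ltP 0%R s.
    rewrite (_ : _ @^-1` _ = `](a / s)%R, (b / s)%R]%classic); last first.
      apply/seteqP; split=> t /=; rewrite !in_itv/= ltr_pdivrMr// ler_pdivlMr// (mulrC t)//.
    rewrite !lebesgue_measure_itv /= !lte_fin ltr_pM2r ?invr_gt0//.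
    case: ifP => _; last by rewrite mule0.
    by rewrite !EFinN -!EFinD -EFinM gtr0_norm//; congr EFin; field.
  have {}sn : (s < 0)%R by rewrite lt_neqAle s0.
  (* Division by a negative [s] exchanges the endpoints and the closed end; the length is the
     same. *)
  rewrite (_ : _ @^-1` _ = `[(b / s)%R, (a / s)%R[%classic); last first.
    by apply/seteqP; split=> t /=; rewrite !in_itv/= ler_ndivrMr// ltr_ndivlMr// (mulrC t) andbC.
  rewrite !lebesgue_measure_itv /= !lte_fin ltr_nM2r ?invr_lt0//.
  case: ifP => _; last by rewrite mule0.
  by rewrite !EFinN -!EFinD -EFinM ltr0_norm//; congr EFin; field.
transitivity (\int[@pushforward _ _ (measurableTypeR R) (measurableTypeR R) R lebesgue_measure ( *%R s)]_x f x).
  by rewrite ge0_integral_pushforward.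
rewrite (@eq_measure_integral _ _ R setT (mscale (NngNum (normr_ge0 s^-1%R)) lebesgue_measure)).
  by rewrite ge0_integral_mscale//= normfV.
move=> A mA _; suff : lebesgue_measure ( *%R s @^-1` A) = `|s^-1|%:E * lebesgue_measure A by [].
by rewrite (nuE A mA) muleA -EFinM -normrM mulVf// normr1 mul1e.
Qed.

Lemma ge0_integral_scale n (s : R) (f : 'rV[R]_n -> \bar R) : s != 0%R ->
  measurable_fun setT f -> (forall x, 0 <= f x) ->
  \int[lebesgue_rV R n]_x f (s *: x)%R = (`|s|^-1 ^+ n)%:E * \int[lebesgue_rV R n]_x f x.
Proof.
move=> s0; elim: n f => [|n IH] f mf f0.
  rewrite expr0 mul1e; apply: eq_integral => x _; congr f.
  by apply/rowP => -[].
have msc p : measurable_fun setT (fun x : 'rV[R]_p => s *: x)%R.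
  apply: measurable_fun_rV => i; under eq_fun do rewrite mxE.
  by apply: measurable_funM => //; exact: measurable_coord.
rewrite ge0_integral_rV_cons//; last exact: measurableT_comp mf (msc _).
rewrite ge0_integral_rV_cons//.
have mc t : measurable_fun setT (fun x => f (rV_cons (t, x))).
  apply: measurableT_comp => //.
  exact: measurableT_comp (@measurable_rV_cons R _) (measurable_pair1 _).
pose g t := \int[lebesgue_rV R n]_x f (rV_cons (t, x)).
have mg : measurable_fun setT g.
  have mh : measurable_fun setT (f \o @rV_cons R n).
    exact: measurableT_comp mf (@measurable_rV_cons R n).
  by have := @measurable_fun_fubini_tonelli_F _ _ _ _ R (lebesgue_rV R n) _ mh; apply => x; exact: f0.
have g0 t : 0 <= g t by exact: integral_ge0.
transitivity (\int[lebesgue_measure]_t ((`|s|^-1 ^+ n)%:E * g (s * t)%R)).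
  apply: eq_integral => t _; rewrite -IH//; apply: eq_integral => x _; congr f.
  apply/rowP => i; rewrite !mxE.
  by case: unliftP => [j _|_] //=; rewrite mxE.
rewrite ge0_integralZl//; last exact: measurableT_comp mg (measurable_funM _ _).
by rewrite ge0_integral_scale1// muleA -EFinM exprSr.
Qed.

End rV_integration.

(** The two difference quotients are the same function of [h]. It is enough that [phi] turns steps
    along [w] into steps along [v], so one lemma serves lines, slices, scalings and block
    projections. *)
Lemma is_derive_affine {R : numFieldType} {U V W : normedModType R} (f : V -> W)
    (phi : U -> V) u w v d :
  (forall h, phi (h *: w + u) = h *: v + phi u) ->
  is_derive (phi u) v f d <-> is_derive u w (f \o phi) d.
Proof.
move=> phiE.
have E : (fun h => h^-1 *: ((f \o shift (phi u)) (h *: v) - f (phi u))) =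
         (fun h => h^-1 *: (((f \o phi) \o shift u) (h *: w) - (f \o phi) u)).
  by apply/funext => h /=; rewrite phiE.
by split=> -[d1 d2]; apply: DeriveDef;
  rewrite /derivable /derive ?E -?E //; move: d1 d2; rewrite /derivable /derive ?E.
Qed.

(** Reduces directional derivatives to derivatives in one real variable, for which the chain rule
    and differentiation under the integral are stated. *)
Lemma is_derive_line {R : numFieldType} {V W : normedModType R} (f : V -> W) x v d :
  is_derive x v f d <-> is_derive (0 : R) (1 : R) (fun t : R => f (t *: v + x)) d.
Proof.
rewrite -{1}(_ : 0 *: v + x = x); last by rewrite scale0r add0r.
apply: (@is_derive_affine _ R V W f (fun t : R => t *: v + x)) => h.
by rewrite scale0r add0r addr0 [h *: 1]mulr1.
Qed.

Lemma near_norm_gt {R : realType} {V : normedModType R} (M : R) (x : V) :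
  M < `|x| -> \forall y \near x, M < `|y|.
Proof.
by move=> Mx; have /cvgr_gt := @norm_continuous _ V x; exact.
Qed.

(** * Compactly supported continuous functions and integrals of their derivatives *)

Section compactly_supported.
Context {R : realType}.

(** Compact support is encoded by an explicit radius, which is what the boxes used for integrability
    take as argument. *)
Definition Cc n (f : 'rV[R]_n -> R) :=
  continuous f /\ exists M, forall x, M < `|x| -> f x = 0.

Lemma sub_Cc n (f g : 'rV[R]_n -> R) :
  continuous g -> Cc f -> (forall x, f x = 0 -> g x = 0) -> Cc g.
Proof. by move=> cg [_ [M fM]] fg; split=> //; exists M => x /fM/fg. Qed.

Lemma continuous_bounded_box n (f : 'rV[R]_n -> R) (M : R) : continuous f ->
  exists B, forall x, `|x| <= M -> `|f x| <= B.
Proof.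
move=> cf; have : compact (f @` box n M).
  by apply: continuous_compact; [exact: continuous_subspaceT|exact: compact_box].
move=> /compact_bounded[B [_ fB]]; exists (B + 1) => x xM.
by apply: (fB (B + 1)); rewrite ?ltrDl//; exists x.
Qed.

Lemma Cc_bounded n (f : 'rV[R]_n -> R) : Cc f -> exists B, forall x, `|f x| <= B.
Proof.
move=> [cf [M fM]]; have [B fB] := continuous_bounded_box M cf.
exists (Num.max B 0) => x; rewrite le_max.
by have [/fB ->//|/fM ->] := leP `|x| M; rewrite normr0 lexx orbT.
Qed.

Lemma continuous_integrable_box n (f : 'rV[R]_n -> R) (M : R) : continuous f ->
  (lebesgue_rV R n).-integrable (box n M) (EFin \o f).
Proof.
move=> cf; apply: measurable_bounded_integrable.
- exact: measurable_box.
- exact: box_fin.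
- by apply: measurable_funTS; exact: continuous_measurable_rV.
- have [B fB] := continuous_bounded_box M cf.
  exists B; split; first exact: num_real.
  by move=> C BC x /= /fB/le_trans; apply; exact: ltW.
Qed.

Lemma Cc_box n (f : 'rV[R]_n -> R) (M : R) : (forall x, M < `|x| -> f x = 0) ->
  f \_ (box n M) = f.
Proof.
move=> fM; apply/funext => x; rewrite patchE; case: ifPn => //.
by rewrite notin_setE /= => /negP; rewrite -ltNge => /fM ->.
Qed.

Lemma Cc_integrable n (f : 'rV[R]_n -> R) : Cc f ->
  (lebesgue_rV R n).-integrable setT (EFin \o f).
Proof.
move=> [cf [M fM]]; rewrite -(Cc_box fM).
rewrite -restrict_EFin; apply/(integrable_mkcond _ (measurable_box n M)).
exact: continuous_integrable_box.
Qed.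

(** Fubini for a signed integrand; integrability on the product comes from Tonelli applied to [|f|].
    Both orders are recorded because the coordinate being differentiated has to be integrated
    inside. *)
Lemma integral_rV_cons n (f : 'rV[R]_n.+1 -> R) : Cc f ->
  (\int[lebesgue_rV R n.+1]_x (f x)%:E =
   \int[lebesgue_measure]_t \int[lebesgue_rV R n]_x (f (rV_cons (t, x)))%:E)%E /\
  (\int[lebesgue_rV R n.+1]_x (f x)%:E =
   \int[lebesgue_rV R n]_x \int[lebesgue_measure]_t (f (rV_cons (t, x)))%:E)%E.
Proof.
move=> Cf; have intf := Cc_integrable Cf.
have mf : measurable_fun setT (EFin \o f) by exact: measurable_int intf.
have mc : @measurable_fun _ _ (measurableTypeR R * 'rV[R]_n)%type 'rV[R]_n.+1 setT
    (@rV_cons R n) := @measurable_rV_cons R n.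
pose m : {measure set (measurableTypeR R * 'rV[R]_n)%type -> \bar R} :=
    (lebesgue_measure \x lebesgue_rV R n)%E.
have intg : m.-integrable setT ((EFin \o f) \o @rV_cons R n).
  apply/(@integrable12ltyP _ _ _ _ R lebesgue_measure (lebesgue_rV R n)).
    exact: measurableT_comp mf mc.
  rewrite -(@ge0_integral_rV_cons R n (fun x => `|(f x)%:E|)%E)//.
    by case/integrableP: intf.
  exact: measurableT_comp.
have E : (\int[lebesgue_rV R n.+1]_x (f x)%:E = \int[m]_z ((EFin \o f) \o @rV_cons R n) z)%E.
  have := integral_pushforward mc mf intg measurableT.
  by rewrite preimage_setT => <-; exact: eq_measure_integral.
rewrite E; split.
  by rewrite -(@integral12_prod_meas1 _ _ _ _ R lebesgue_measure (lebesgue_rV R n)).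
by rewrite -(@integral21_prod_meas1 _ _ _ _ R lebesgue_measure (lebesgue_rV R n)).
Qed.

(** The fundamental theorem of calculus on [[- N, N]]. The [1] in [N = |M| + 1] puts both endpoints
    strictly beyond [M], where [f] vanishes. *)
Lemma integral_derive1_cc (f g : R -> R) : (forall t, is_derive t (1 : R) f (g t)) ->
  continuous g -> (exists M, forall t, M < `|t| -> f t = 0) ->
  (\int[lebesgue_measure]_t (g t)%:E = 0)%E.
Proof.
move=> fg cg [M fM].
have cf : continuous f.
  by move=> t; apply: differentiable_continuous; apply/derivable1_diffP; case: (fg t).
have gM t : M < `|t| -> g t = 0.
  move=> Mt; have [_ <-] := fg t.
  rewrite (@near_eq_derive _ _ _ f (cst 0)) ?derive_cst//.
  by near=> s; apply: fM; near: s; exact: (@near_norm_gt R R^o).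
have N0 : 0 < `|M| + 1 by rewrite ltr_pwDr.
set N := `|M| + 1 in N0.
have MN t : N <= `|t| -> M < `|t|.
  by apply: lt_le_trans; rewrite /N (le_lt_trans (ler_norm M))// ltrDl.
rewrite (_ : (fun t => (g t)%:E) = (EFin \o g) \_ `[- N, N]); last first.
  apply/funext => t; rewrite patchE; case: ifPn => //.
  rewrite notin_setE /= in_itv/= -ler_norml => /negP; rewrite -ltNge => Nt.
  by rewrite gM// MN// ltW.
rewrite -integral_mkcond (@continuous_FTC2 _ _ f)//.
- by rewrite !fM ?subee// MN// ?normrN ger0_norm// ltW.
- by rewrite -subr_gt0 opprK addr_gt0.
- exact: continuous_subspaceT.
- split; first by move=> t _; case: (fg t).
    by apply: cvg_at_right_filter; exact: cf.
  by apply: cvg_at_left_filter; exact: cf.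
- by move=> t _; rewrite derive1E; case: (fg t).
Unshelve. all: by end_near. Qed.

Lemma Cc_partial n i (f : 'rV[R]_n -> R) :
  Cc f -> continuous (partial i f) -> Cc (partial i f).
Proof.
move=> [_ [M fM]] cf; split=> //; exists M => x Mx; rewrite /partial.
rewrite (@near_eq_derive _ _ _ f (cst 0)) ?derive_cst//.
by near=> s; apply: fM; near: s; exact: (@near_norm_gt R 'rV[R]_n).
Unshelve. all: by end_near. Qed.

Lemma continuous_rV_cons (T : topologicalType) n (f : T -> R) (g : T -> 'rV[R]_n) :
  continuous f -> continuous g -> continuous (fun s => rV_cons (f s, g s)).
Proof.
move=> cf cg; apply: rV_continuousP => i; rewrite /rV_cons.
under eq_fun do rewrite mxE.
case: (unliftP ord0 i) => [j _|_] s /=; last exact: cf.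
apply: (@continuous_comp _ _ _ g (fun x : 'rV[R]_n => x ord0 j)); first exact: cg.
exact: coord_continuous.
Qed.

Lemma Cc_rV_cons n (f : 'rV[R]_n.+1 -> R) t : Cc f -> Cc (fun x => f (rV_cons (t, x))).
Proof.
move=> [cf [M fM]]; split.
  move=> x; apply: (@continuous_comp _ _ _ (fun x => rV_cons (t, x)) f); last exact: cf.
  apply: (@continuous_rV_cons 'rV[R]_n n (fun=> t) id).
    exact: (@cst_continuous 'rV[R]_n R t).
  by move=> y; exact: cvg_id.
exists `|M| => x Mx; apply: fM; apply: (le_lt_trans (ler_norm M)).
apply: (lt_le_trans Mx); apply/rV_norm_leP => // i.
have := coord_le_norm (rV_cons (t, x)) (lift ord0 i).
by rewrite mxE liftK.
Qed.

Lemma rV_cons_shift0 n h t (x : 'rV[R]_n) :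
  rV_cons (h + t, x) = h *: delta_mx ord0 ord0 + rV_cons (t, x).
Proof.
apply/rowP => i; rewrite !mxE eqxx /=.
by case: (unliftP ord0 i) => [j ->|->] /=; rewrite ?mulr1// mulr0 add0r.
Qed.

Lemma rV_cons_shift n h t (x : 'rV[R]_n) j :
  rV_cons (t, h *: delta_mx ord0 j + x) =
  h *: delta_mx ord0 (lift ord0 j) + rV_cons (t, x).
Proof.
apply/rowP => i; rewrite !mxE eqxx /=.
case: (unliftP ord0 i) => [l ->|->] /=; last by rewrite mulr0 add0r.
by rewrite !mxE eqxx /= (inj_eq lift_inj).
Qed.

(** Induction on the dimension: a derivative along a later coordinate has zero inner integral by the
    induction hypothesis, and one along the first coordinate is the one-dimensional case after
    exchanging the integrals. *)
Lemma integral_partial_Cc n i (f : 'rV[R]_n -> R) : Cc f ->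
  (forall x, derivable f x (delta_mx ord0 i)) -> continuous (partial i f) ->
  (\int[lebesgue_rV R n]_x (partial i f x)%:E = 0)%E.
Proof.
elim: n i f => [[]//|n IH] i f Cf df cf.
have [E1 E2] := integral_rV_cons (Cc_partial Cf cf).
case: (unliftP ord0 i) => [j|] ij; subst i.
  rewrite E1; apply: integral0_eq => t _.
  have D x : is_derive x (delta_mx ord0 j) (fun x => f (rV_cons (t, x)))
      (partial (lift ord0 j) f (rV_cons (t, x))).
    apply/(@is_derive_affine _ _ _ _ f (fun x => rV_cons (t, x))) => [h|].
      exact: rV_cons_shift.
    by apply: DeriveDef; first exact: df.
  have E : partial j (fun x => f (rV_cons (t, x))) =
      fun x => partial (lift ord0 j) f (rV_cons (t, x)).
    by apply/funext => x; case: (D x).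
  apply: etrans (IH j (fun x => f (rV_cons (t, x))) _ _ _).
  - by apply: eq_integral => x _; rewrite E.
  - exact: Cc_rV_cons.
  - by move=> x; case: (D x).
  - by rewrite E; have [] := Cc_rV_cons t (Cc_partial Cf cf).
rewrite E2; apply: integral0_eq => x _.
have ct : continuous (fun t => partial ord0 f (rV_cons (t, x))).
  move=> t; apply: (@continuous_comp _ _ _ (fun t => rV_cons (t, x)) (partial ord0 f)); last exact: cf.
  apply: (@continuous_rV_cons R n id (fun=> x)).
    by move=> y; exact: cvg_id.
  exact: (@cst_continuous R 'rV[R]_n x).
apply: (@integral_derive1_cc (fun t => f (rV_cons (t, x)))) => //.
- move=> t; apply/(@is_derive_affine _ _ _ _ f (fun t => rV_cons (t, x))) => [h|].
    by rewrite [h *: 1]mulr1 rV_cons_shift0.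
  by apply: DeriveDef; first exact: df.
- have [_ [M fM]] := Cf; exists M => t Mt; apply: fM.
  apply: (lt_le_trans Mt).
  by have := coord_le_norm (rV_cons (t, x)) ord0; rewrite mxE unlift_none.
Qed.

End compactly_supported.

(** * Smooth functions *)

Section smooth_calculus.
Context {R : realType} {n : nat}.
Implicit Types f g h : 'rV[R]_n -> R.

Local Notation e := (@delta_mx R 1 n ord0).

(** [smooth] speaks of all iterated partial derivatives. Any class of continuous, partially
    derivable functions that is stable under [partial] consists of smooth functions, which replaces
    inductions on lists of indices. *)
Lemma smooth_coind (P : ('rV[R]_n -> R) -> Prop) :
  (forall f, P f -> continuous f /\
    forall i, (forall x, derivable f x (e i)) /\ P (partial i f)) ->
  forall f, P f -> smooth f.
Proof.
move=> HP f Pf s; suff /HP[cf df] : P (foldr (@partial R n) f s).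
  by split=> // i x; case: (df i) => + _; exact.
by elim: s => //= i s /HP[_ /(_ i)[]].
Qed.

Lemma smoothE f : smooth f -> continuous f /\
  forall i, (forall x, derivable f x (e i)) /\ smooth (partial i f).
Proof.
move=> sf; have [cf df] := sf [::]; split=> // i; split=> [x|s]; first exact: df.
by rewrite -foldr_rcons; exact: sf.
Qed.

Lemma smooth_continuous f : smooth f -> continuous f.
Proof. by case/smoothE. Qed.

Lemma smooth_derivable f i x : smooth f -> derivable f x (e i).
Proof. by case/smoothE => _ /(_ i)[]. Qed.

Lemma smooth_partial f i : smooth f -> smooth (partial i f).
Proof. by case/smoothE => _ /(_ i)[]. Qed.

Lemma smooth_is_derive f i x : smooth f -> is_derive x (e i) f (partial i f x).
Proof. by move=> sf; apply: DeriveDef => //; exact: smooth_derivable. Qed.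

(** The product rule leaves the class of products, so a class stable under [partial] has to contain
    sums of products. *)
Inductive alg_closure (B : ('rV[R]_n -> R) -> Prop) : ('rV[R]_n -> R) -> Prop :=
| alg_base f : B f -> alg_closure B f
| alg_add f g : alg_closure B f -> alg_closure B g ->
    alg_closure B (fun x => f x + g x)
| alg_mul f g : alg_closure B f -> alg_closure B g ->
    alg_closure B (fun x => f x * g x).

(** Sums and products are differentiated by the Leibniz rule inside the algebra. Derivatives of
    generators need only lie in the algebra, which leaves room for the factors of the chain rule. *)
Lemma smooth_alg_closure B :
  (forall f, B f -> continuous f /\
    forall i, exists2 g, alg_closure B g & forall x, is_derive x (e i) f (g x)) ->
  forall f, alg_closure B f -> smooth f.
Proof.
move=> HB; apply: smooth_coind => f; elim=> {f} [f|f g Af [cf df] Ag [cg dg]|f g Af [cf df] Ag [cg dg]].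
- move=> /HB[cf df]; split=> // i; have [g Ag dg] := df i; split.
    by move=> x; case: (dg x).
  by rewrite (_ : partial i f = g)//; apply/funext => x; case: (dg x).
- split=> [x|i]; first by apply: continuousD; [exact: cf|exact: cg].
  have [dfi Afi] := df i; have [dgi Agi] := dg i; split=> [x|].
    exact: derivableD.
  rewrite (_ : partial i _ = fun x => partial i f x + partial i g x); first exact: alg_add.
  by apply/funext => x; rewrite /partial -deriveD.
- split=> [x|i]; first by apply: continuousM; [exact: cf|exact: cg].
  have [dfi Afi] := df i; have [dgi Agi] := dg i; split=> [x|].
    exact: derivableM.
  rewrite (_ : partial i _ = fun x => f x * partial i g x + g x * partial i f x).
    by apply: alg_add; apply: alg_mul.
  by apply/funext => x; rewrite /partial -deriveM.
Qed.

Lemma smooth_base f : smooth f -> continuous f /\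
  forall i, exists2 g, alg_closure (@smooth R n) g & forall x, is_derive x (e i) f (g x).
Proof.
move=> sf; split=> [|i]; first exact: smooth_continuous.
exists (partial i f); first by apply: alg_base; exact: smooth_partial.
by move=> x; exact: smooth_is_derive.
Qed.

Lemma smoothD f g : smooth f -> smooth g -> smooth (fun x => f x + g x).
Proof.
move=> sf sg; apply: (smooth_alg_closure smooth_base).
by apply: alg_add; exact: alg_base.
Qed.

Lemma smoothM f g : smooth f -> smooth g -> smooth (fun x => f x * g x).
Proof.
move=> sf sg; apply: (smooth_alg_closure smooth_base).
by apply: alg_mul; exact: alg_base.
Qed.

Lemma smooth_cst (c : R) : smooth (fun _ : 'rV[R]_n => c).
Proof.
apply: (@smooth_coind (fun f => exists c, f = cst c)); last by exists c.
move=> _ [{}c ->]; split=> [|i]; first by move=> x; exact: cst_continuous.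
split=> [x|]; first exact: derivable_cst.
by exists 0; apply/funext => x; rewrite /partial derive_cst.
Qed.

Lemma smooth_coord j : smooth (fun x : 'rV[R]_n => x ord0 j).
Proof.
apply: (smooth_alg_closure (B := fun f => smooth f \/ f = fun x => x ord0 j)); last first.
  by apply: alg_base; right.
move=> f [/smooth_base[cf df]|->].
  split=> // i; have [g Ag dg] := df i; exists g => //; elim: Ag => *.
  - by apply: alg_base; left.
  - exact: alg_add.
  - exact: alg_mul.
split=> [|i]; first exact: coord_continuous.
exists (cst ((j == i)%:R)); first by apply: alg_base; left; exact: smooth_cst.
move=> x; apply/is_derive_line.
rewrite (_ : (fun t => _) = fun t : R => (j == i)%:R * t + x ord0 j); last first.
  by apply/funext => t; rewrite !mxE eqxx /= mulrC.
by apply: is_derive_eq; rewrite addr0 [_ *: _]mulr1.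
Qed.

Lemma smooth_sum (I : finType) (F : I -> 'rV[R]_n -> R) :
  (forall i, smooth (F i)) -> smooth (fun x => \sum_i F i x).
Proof.
move=> sF; suff : forall s : seq I, smooth (fun x => \sum_(i <- s) F i x) by exact.
elim=> [|i s IH]; first by under eq_fun do rewrite big_nil; exact: smooth_cst.
by under eq_fun do rewrite big_cons; exact: smoothD.
Qed.

Lemma is_derive_scale (f : 'rV[R]_n -> R) x v d (s : R) :
  is_derive x v f d -> is_derive x (s *: v) f (s * d).
Proof.
move=> /is_derive_line H; apply/is_derive_line.
rewrite (_ : (fun t => _) = (fun t : R => f (t *: v + x)) \o (fun t => s * t)); last first.
  by apply/funext => t /=; rewrite scalerA mulrC.
rewrite -{1}(mulr0 s) in H.
have H2 : is_derive (0 : R) (1 : R) (fun t : R => s * t) s.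
  by apply: is_derive_eq; rewrite [_ *: _]mulr1.
by have := is_derive1_comp H H2; rewrite mulrC.
Qed.

Lemma is_derive_comp1 (phi : R -> R) (f : 'rV[R]_n -> R) x v a b :
  is_derive x v f b -> is_derive (f x) (1 : R) phi a ->
  is_derive x v (phi \o f) (a * b).
Proof.
move=> /is_derive_line H1 H2; apply/is_derive_line.
apply: (@is_derive1_comp _ phi (fun t => f (t *: v + x))) => //.
by rewrite scale0r add0r.
Qed.

(** The stable class needs a free constant in front, because each derivative brings out a factor
    [s]. *)
Lemma smooth_scale (s : R) f : smooth f -> smooth (fun x => f (s *: x)).
Proof.
move=> sf; apply: (@smooth_coind (fun g => exists c f, smooth f /\ g = fun x => c * f (s *: x))); last first.
  by exists 1, f; split=> //; apply/funext => x; rewrite mul1r.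
move=> _ [c [{sf}f [sf ->]]]; split=> [x|i].
  have cfs : continuous (fun x : 'rV[R]_n => f (s *: x)).
    move=> y; apply: (@continuous_comp _ _ _ (fun x : 'rV[R]_n => s *: x) f).
      exact: scaler_continuous.
    exact: smooth_continuous.
  by apply: (@continuousM _ _ (cst c)); [exact: cst_continuous|exact: cfs].
have D x : is_derive x (e i) (fun x => c * f (s *: x)) ((c * s) * partial i f (s *: x)).
  rewrite -mulrA; apply: is_deriveZ.
  apply/(@is_derive_affine _ _ _ _ f (fun x => s *: x) x (e i) (s *: e i)) => [h|].
    by rewrite scalerDr !scalerA mulrC.
  by apply: is_derive_scale; exact: smooth_is_derive.
split=> [x|]; first by case: (D x).
exists (c * s), (partial i f); split; first exact: smooth_partial.
by apply/funext => x; case: (D x).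
Qed.

(** The generators are smooth functions together with the members of [G] composed with [h]. [G] is
    closed under derivation up to combinations of two members, the shape of the derivative of
    [flat]; powers take [c2 = 0], with the half-line as [D]. *)
Lemma smooth_comp (D : set R) (G : (R -> R) -> Prop) (phi : R -> R) h :
  (forall g : R -> R, G g -> exists (c1 c2 : R) (g1 g2 : R -> R), [/\ G g1, G g2 &
     forall t, D t -> is_derive t (1 : R) g (c1 * g1 t + c2 * g2 t)]) ->
  smooth h -> (forall x, D (h x)) -> G phi -> smooth (fun x => phi (h x)).
Proof.
move=> HG sh Dh Gphi.
apply: (smooth_alg_closure (B := fun f => smooth f \/ exists2 g : R -> R, G g & f = g \o h)); last first.
  by apply: alg_base; right; exists phi.
move=> f [/smooth_base[cf df]|[g Gg ->]].
  split=> // i; have [g Ag dg] := df i; exists g => //; elim: Ag => *.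
  - by apply: alg_base; left.
  - exact: alg_add.
  - exact: alg_mul.
have [c1 [c2 [g1 [g2 [Gg1 Gg2 dg]]]]] := HG _ Gg.
split=> [x|i].
  apply: continuous_comp; first exact: smooth_continuous.
  by apply: differentiable_continuous; apply/derivable1_diffP; case: (dg _ (Dh x)).
exists (fun x => (c1 * (g1 \o h) x + c2 * (g2 \o h) x) * partial i h x); last first.
  by move=> x; apply: is_derive_comp1; [exact: smooth_is_derive|exact: dg].
apply: alg_mul; last by apply: alg_base; left; exact: smooth_partial.
by apply: alg_add; apply: alg_mul; apply: alg_base;
  [left; exact: smooth_cst|right; exists g1|left; exact: smooth_cst|right; exists g2].
Qed.

Lemma smooth_powR h (a : R) : smooth h -> (forall x, 0 < h x) ->
  smooth (fun x => h x `^ a).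
Proof.
move=> sh h0.
apply: (@smooth_comp [set t | 0 < t] (fun g : R -> R => exists a, g = fun t => t `^ a)
  (fun t => t `^ a)) => //; last by exists a.
move=> _ [b ->]; exists b, 0, (fun t => t `^ (b - 1)), (fun t => t `^ b).
by split=> [||t t0]; [exists (b - 1)|exists b|rewrite mul0r addr0; exact: is_derive1_powR].
Qed.

Lemma partial_powR h (a : R) i x : smooth h -> 0 < h x ->
  partial i (fun x => h x `^ a) x = a * h x `^ (a - 1) * partial i h x.
Proof.
move=> sh h0; have [_ <-//] := is_derive_comp1 (smooth_is_derive i x sh) (is_derive1_powR a h0).
Qed.

End smooth_calculus.

(** * Smooth bump functions *)

Section bump.
Context {R : realType}.

(* The derivative of [flat k] is a combination of [flat k.+1] and [flat k.+2], so
   the whole family is needed to see that [flat 0] is smooth. *)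
Definition flat (k : nat) (t : R) : R :=
  if 0 < t then t^-1 ^+ k * expR (- t^-1) else 0.

Lemma flat_ge0 k t : 0 <= flat k t.
Proof. by rewrite /flat; case: ifPn => // /ltW t0; rewrite mulr_ge0 ?expR_ge0// exprn_ge0// invr_ge0. Qed.

(** At [u = 1 / t] the exponential is at least [u^(k+1) / (k+1)!], which beats the factor [u^k] with
    one power of [t] to spare. *)
Lemma flat_le k t : flat k t <= k.+1`!%:R * `|t|.
Proof.
rewrite /flat; case: ifPn => [t0|_]; last by rewrite mulr_ge0.
rewrite gtr0_norm// expRN -[leRHS]divr1 -ler_pdivlMr ?invr_gt0 ?expR_gt0//.
rewrite invrK divr1 -ler_pdivrMl; last by rewrite mulr_gt0// ltr0n fact_gt0.
have := expR_ge1Dxn k (ltW (_ : 0 < t^-1)); rewrite invr_gt0 => /(_ t0).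
apply: le_trans; rewrite -[leLHS]add0r lerD//.
by rewrite invfM -mulrA -exprS mulrC.
Qed.

Lemma is_derive_flat k t :
  is_derive t (1 : R) (flat k) (1 * flat k.+2 t + (- k%:R) * flat k.+1 t).
Proof.
have [t0|t0|->] := ltgtP t 0.
- rewrite /flat ltNge (ltW t0) /= !mulr0 addr0.
  apply: (@near_eq_is_derive _ _ _ (cst 0)).
  near=> s; rewrite /flat ltNge ltW//; near: s; exact: lt_nbhsl.
- rewrite /flat t0.
  apply: (@near_eq_is_derive _ _ _ (fun t : R => t^-1 ^+ k * expR (- t^-1))).
    near=> s; rewrite /flat ifT//; near: s; exact: lt_nbhsr.
  have tn0 : t != 0 by rewrite gt_eqF.
  have dV : is_derive t (1 : R) (fun t : R => t^-1) (- t ^- 2).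
    by have := is_deriveV tn0 (is_derive_id t (1 : R)); rewrite [_ *: _]mulr1.
  have dE : is_derive t (1 : R) (fun t : R => expR (- t^-1)) (expR (- t^-1) * t ^- 2).
    apply: (@is_derive1_comp _ expR (fun t => - t^-1)).
    by rewrite -[t ^- 2]opprK; exact: is_deriveN.
  case: k => [|k].
    rewrite oppr0 mul0r addr0 mul1r.
    rewrite (_ : (fun s => _) = fun s : R => expR (- s^-1)); last first.
      by apply/funext => s; rewrite expr0 mul1r.
    by rewrite mulrC exprVn.
  have dX : is_derive t (1 : R) (fun t : R => t^-1 ^+ k.+1) (k.+1%:R * t^-1 ^+ k * (- t ^- 2)).
    rewrite (_ : (fun _ => _) = (fun t : R => t^-1) ^+ k.+1); last by rewrite exprfctE.
    exact: is_deriveX.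
  apply: (is_derive_eq (is_deriveM dX dE)).
  rewrite /GRing.scale /= -!exprVn !exprS.
  by ring.
(* At [0], the difference quotient of [flat k] with a step [h > 0] is [flat k.+1 h], which tends to
   [0] by [flat_le]; for [h < 0] it is [0]. *)
- rewrite /flat ltxx !mulr0 addr0.
  suff H : h^-1 *: (flat k (h *: 1 + 0) - flat k 0) @[h --> 0^'] --> (0 : R).
    by apply: DeriveDef; [apply/cvg_ex; exists 0|exact/cvg_lim].
  apply/cvgrPdist_le => eps eps0.
  near=> h.
  have h0 : h != 0 by near: h; exact: nbhs_dnbhs_neq.
  rewrite sub0r normrN /(flat k 0) ltxx subr0 addr0 [h *: 1]mulr1.
  rewrite (@le_trans _ _ (flat k.+1 h))//.
    rewrite /flat; case: ifPn => hp; last by rewrite scaler0 normr0.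
    by rewrite [_ *: _]mulrA -exprS ger0_norm// mulr_ge0 ?expR_ge0// exprn_ge0// invr_ge0 ltW.
  rewrite (le_trans (flat_le _ _))// -ler_pdivlMl; last by rewrite ltr0n fact_gt0.
  near: h; apply: dnbhs0_le.
  by rewrite mulr_gt0// invr_gt0 ltr0n fact_gt0.
Unshelve. all: by end_near. Qed.

Lemma smooth_flat n (h : 'rV[R]_n -> R) : smooth h -> smooth (fun x => flat 0 (h x)).
Proof.
move=> sh; apply: (@smooth_comp R n setT (fun g : R -> R => exists k, g = flat k)) => //; last by exists 0.
move=> _ [k ->]; exists 1, (- k%:R), (flat k.+2), (flat k.+1).
by split=> [||t _]; [exists k.+2|exists k.+1|exact: is_derive_flat].
Qed.

(** The argument of [flat 0] is [r^2] minus the squared Euclidean norm. It is negative outside the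
    max-norm box of radius [r], since one coordinate alone already exceeds [r] there. *)
Lemma exists_bump n (r : R) : 0 < r -> exists phi : 'rV[R]_n -> R,
  [/\ smooth phi, forall x, 0 <= phi x, forall x, r < `|x| -> phi x = 0 & 0 < phi 0].
Proof.
move=> r0; pose h (x : 'rV[R]_n) := r ^+ 2 - \sum_i (x ord0 i) * (x ord0 i).
exists (fun x => flat 0 (h x)); split.
- apply: smooth_flat.
  rewrite (_ : h = fun x : 'rV[R]_n => r ^+ 2 + (-1) * \sum_i (x ord0 i) * (x ord0 i)); last first.
    by apply/funext => x; rewrite /h mulN1r.
  apply: smoothD; first exact: smooth_cst.
  apply: smoothM; first exact: smooth_cst.
  by apply: smooth_sum => i; apply: smoothM; exact: smooth_coord.
- by move=> x; exact: flat_ge0.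
- move=> x rx; rewrite /flat ifF//; apply/negbTE; rewrite -leNgt subr_le0.
  have [i ri] : exists i, r < `|x ord0 i|.
    apply: contrapT => H; move: rx; rewrite ltNge; apply/negP/negPn.
    apply/rV_norm_leP => [|i]; first exact: ltW.
    by rewrite leNgt; apply/negP => ri; apply: H; exists i.
  rewrite (bigD1 i)//= -[leLHS]addr0 lerD//; last by apply: sumr_ge0 => j _; rewrite -expr2 sqr_ge0.
  rewrite -expr2 -[leRHS]real_normK ?num_real//.
  by rewrite ler_pXn2r ?nnegrE ?normr_ge0 ?(ltW r0) ?(ltW ri).
- rewrite /h big1 ?subr0; last by move=> i _; rewrite mxE mul0r.
  by rewrite /flat exprn_gt0// expr0 mul1r expR_gt0.
Qed.

End bump.

(** * Block coordinates and integration over slices *)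

Section block_coordinates.
Context {R : realType} {m k : nat}.
Implicit Types f : 'rV[R]_(m + k) -> R.

Lemma row_mx_shiftl h i (x : 'rV[R]_m) (y : 'rV[R]_k) :
  row_mx (h *: delta_mx ord0 i + x) y =
  h *: delta_mx ord0 (lshift k i) + row_mx x y.
Proof.
rewrite -{1}[y](add0r) -add_row_mx; congr (_ + _).
apply/rowP => j; rewrite !mxE eqxx /=; case: fintype.splitP => l jl.
  rewrite !mxE eqxx /=; congr (_ * (_ : bool)%:R); apply/eqP/eqP => [li|].
    by apply/val_inj; rewrite /= jl li.
  by move=> /(congr1 val) /= jE; apply/val_inj; rewrite /= -jl jE.
rewrite mxE (_ : j == _ = false) ?mulr0//; apply/negbTE/eqP => /(congr1 val) /=.
by rewrite jl => E; have := ltn_ord i; rewrite -E ltnNge leq_addr.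
Qed.

Lemma row_mx_shiftr h j (x : 'rV[R]_m) (y : 'rV[R]_k) :
  row_mx x (h *: delta_mx ord0 j + y) =
  h *: delta_mx ord0 (rshift m j) + row_mx x y.
Proof.
rewrite -{1}[x](add0r) -add_row_mx; congr (_ + _).
apply/rowP => i; rewrite !mxE eqxx /=; case: fintype.splitP => l jl.
  rewrite mxE (_ : i == _ = false) ?mulr0//; apply/negbTE/eqP => /(congr1 val) /=.
  by rewrite jl => E; have := ltn_ord l; rewrite E ltnNge leq_addr.
rewrite !mxE eqxx /=; congr (_ * (_ : bool)%:R); apply/eqP/eqP => [lj|].
  by apply/val_inj; rewrite /= jl lj.
by move=> /(congr1 val) /=; rewrite jl => /addnI E; apply/val_inj.
Qed.

Lemma is_derive_row_mxl f x y i d :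
  is_derive (row_mx x y) (delta_mx ord0 (lshift k i)) f d ->
  is_derive x (delta_mx ord0 i) (fun x => f (row_mx x y)) d.
Proof.
move=> H; apply: (iffLR (@is_derive_affine _ _ _ _ f (fun x => row_mx x y) _ _ _ _ _) H).
by move=> h; exact: row_mx_shiftl.
Qed.

Lemma is_derive_row_mxr f x y j d :
  is_derive (row_mx x y) (delta_mx ord0 (rshift m j)) f d ->
  is_derive y (delta_mx ord0 j) (fun y => f (row_mx x y)) d.
Proof.
move=> H; apply: (iffLR (@is_derive_affine _ _ _ _ f (fun y => row_mx x y) _ _ _ _ _) H).
by move=> h; exact: row_mx_shiftr.
Qed.

Lemma lsubmx_shift (h : R) (i : 'I_(m + k)) (z : 'rV[R]_(m + k)) :
  lsubmx (h *: delta_mx ord0 i + z) = h *: lsubmx (delta_mx ord0 i) + lsubmx z.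
Proof. by apply/rowP => j; rewrite !mxE. Qed.

Lemma rsubmx_shift (h : R) (i : 'I_(m + k)) (z : 'rV[R]_(m + k)) :
  rsubmx (h *: delta_mx ord0 i + z) = h *: rsubmx (delta_mx ord0 i) + rsubmx z.
Proof. by apply/rowP => j; rewrite !mxE. Qed.

Lemma is_derive_along0 n (f : 'rV[R]_n -> R) x : is_derive x 0 f 0.
Proof. by apply: DeriveDef; [exact: derivable0|exact: derive0]. Qed.

Lemma is_derive_lsubmx (f : 'rV[R]_m -> R) (z : 'rV[R]_(m + k)) (i : 'I_(m + k)) :
  smooth f ->
  is_derive z (delta_mx ord0 i) (fun z => f (lsubmx z))
    (if fintype.split i is inl j then partial j f (lsubmx z) else 0).
Proof.
move=> sf; apply/(@is_derive_affine _ _ _ _ f (@lsubmx R 1 m k)) => [h|].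
  exact: lsubmx_shift.
case: fintype.splitP => j ij.
  rewrite (_ : lsubmx (delta_mx ord0 i) = delta_mx ord0 j); first exact: smooth_is_derive.
  apply/rowP => l; rewrite !mxE eqxx /=; congr ((_ : bool)%:R).
  apply/eqP/eqP => [/(congr1 val) /=|->]; last by apply/val_inj; rewrite /= ij.
  by rewrite ij => E; apply/val_inj.
rewrite (_ : lsubmx (delta_mx ord0 i) = 0); first exact: is_derive_along0.
apply/rowP => l; rewrite !mxE eqxx /= (_ : _ == _ = false)//.
apply/negbTE/eqP => /(congr1 val) /=; rewrite ij => E.
by have := ltn_ord l; rewrite E ltnNge leq_addr.
Qed.

Lemma is_derive_rsubmx (f : 'rV[R]_k -> R) (z : 'rV[R]_(m + k)) (i : 'I_(m + k)) :
  smooth f ->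
  is_derive z (delta_mx ord0 i) (fun z => f (rsubmx z))
    (if fintype.split i is inr j then partial j f (rsubmx z) else 0).
Proof.
move=> sf; apply/(@is_derive_affine _ _ _ _ f (@rsubmx R 1 m k)) => [h|].
  exact: rsubmx_shift.
case: fintype.splitP => j ij.
  rewrite (_ : rsubmx (delta_mx ord0 i) = 0); first exact: is_derive_along0.
  apply/rowP => l; rewrite !mxE eqxx /= (_ : _ == _ = false)//.
  apply/negbTE/eqP => /(congr1 val) /=; rewrite ij => E.
  by have := ltn_ord j; rewrite -E ltnNge leq_addr.
rewrite (_ : rsubmx (delta_mx ord0 i) = delta_mx ord0 j); first exact: smooth_is_derive.
apply/rowP => l; rewrite !mxE eqxx /=; congr ((_ : bool)%:R).
apply/eqP/eqP => [/(congr1 val) /=|->]; last by apply/val_inj; rewrite /= ij.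
by rewrite ij => /addnI E; apply/val_inj.
Qed.

Lemma smooth_lsubmx (f : 'rV[R]_m -> R) :
  smooth f -> smooth (fun z : 'rV[R]_(m + k) => f (lsubmx z)).
Proof.
move=> sf; apply: (@smooth_coind _ _ (fun g => exists2 f, smooth f & g = fun z => f (lsubmx z))); last by exists f.
move=> _ [{sf}f sf ->]; split=> [z|i].
  apply: (@continuous_comp _ _ _ (@lsubmx R 1 m k) f); first exact: continuous_lsubmx.
  exact: smooth_continuous.
have D z := is_derive_lsubmx z i sf; split=> [z|]; first by case: (D z).
exists (if fintype.split i is inl j then partial j f else cst 0).
  by case: fintype.split => j; [exact: smooth_partial|exact: smooth_cst].
by apply/funext => z; case: (D z) => _; rewrite /partial => ->; case: fintype.split.
Qed.

Lemma smooth_rsubmx (f : 'rV[R]_k -> R) :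
  smooth f -> smooth (fun z : 'rV[R]_(m + k) => f (rsubmx z)).
Proof.
move=> sf; apply: (@smooth_coind _ _ (fun g => exists2 f, smooth f & g = fun z => f (rsubmx z))); last by exists f.
move=> _ [{sf}f sf ->]; split=> [z|i].
  apply: (@continuous_comp _ _ _ (@rsubmx R 1 m k) f); first exact: continuous_rsubmx.
  exact: smooth_continuous.
have D z := is_derive_rsubmx z i sf; split=> [z|]; first by case: (D z).
exists (if fintype.split i is inr j then partial j f else cst 0).
  by case: fintype.split => j; [exact: smooth_cst|exact: smooth_partial].
by apply/funext => z; case: (D z) => _; rewrite /partial => ->; case: fintype.split.
Qed.

Lemma continuous_slice f (y : 'rV[R]_k) :
  continuous f -> continuous (fun x : 'rV[R]_m => f (row_mx x y)).
Proof.
move=> cf x; apply: (@continuous_comp _ _ _ (fun x : 'rV[R]_m => row_mx x y) f); last exact: cf.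
apply: (@continuous_row_mx R 'rV[R]_m _ _ id (fun=> y)); first by move=> z; exact: cvg_id.
exact: (@cst_continuous 'rV[R]_m 'rV[R]_k y).
Qed.

(** Restricted to a box so that it is finite for integrands without compact support, such as the
    regularisation of [|v|^p]. *)
Definition slice_int (M : R) f (y : 'rV[R]_k) : R :=
  \int[lebesgue_rV R m]_(x in box m M) f (row_mx x y).

Lemma slice_integrable M f y : continuous f ->
  (lebesgue_rV R m).-integrable (box m M) (fun x => (f (row_mx x y))%:E).
Proof. by move=> cf; apply: continuous_integrable_box; exact: continuous_slice. Qed.

Lemma row_mx_near (x x' : 'rV[R]_m) (y y' : 'rV[R]_k) (d : R) :
  `|x - x'| < d -> `|y - y'| < d -> `|row_mx x y - row_mx x' y'| < d.
Proof.
move=> xd yd; have d0 : 0 < d by exact: le_lt_trans xd.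
apply/(rV_norm_ltP _ d0) => i; rewrite !mxE; case: fintype.split => j.
  by move: xd => /(rV_norm_ltP _ d0)/(_ j); rewrite !mxE.
by move: yd => /(rV_norm_ltP _ d0)/(_ j); rewrite !mxE.
Qed.

(** Compactness of the box turns the local continuity at each [(x, y)] into one neighbourhood of [y]
    valid for all [x]; both values of [f] are compared with the value at the centre of the local
    neighbourhood. *)
Lemma slice_uniform_continuous M f (y : 'rV[R]_k) (eps : R) :
  continuous f -> 0 < eps ->
  \forall y' \near y, forall x, box m M x ->
    `|f (row_mx x y) - f (row_mx x y')| <= eps.
Proof.
move=> cf eps0; have /compact_near_coveringP cK := compact_box m M.
apply: (cK _ (nbhs y) (fun y' x => `|f (row_mx x y) - f (row_mx x y')| <= eps)) => x _.
have e20 : 0 < eps / 2 by rewrite divr_gt0.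
have /cvgrPdist_lt/(_ _ e20)/nbhs_normP[d /= d0 fd] := cf (row_mx x y).
exists ([set x' | `|x - x'| < d], [set y' | `|y - y'| < d]) => /=.
  by split; apply/nbhs_ballP; exists d => //= z; rewrite mx_norm_ball.
move=> [x' y'] /= [xd yd].
have H1 := fd _ (row_mx_near xd yd).
have H2 : `|f (row_mx x y) - f (row_mx x' y)| < eps / 2.
  by apply: fd; apply: row_mx_near => //; rewrite subrr normr0.
rewrite (_ : _ - _ = (f (row_mx x y) - f (row_mx x' y')) - (f (row_mx x y) - f (row_mx x' y))).
  by rewrite (le_trans (ler_normB _ _))// (splitr eps) lerD// ltW.
by lra.
Qed.

Lemma continuous_slice_int M f : continuous f -> continuous (slice_int M f).
Proof.
move=> cf; suff H (y : 'rV[R]_k) : slice_int M f @ y --> slice_int M f y by exact: H.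
apply/(@cvgrPdist_le R R^o 'rV[R]_k (nbhs y) (nbhs_filter y)) => eps eps0.
pose V := fine (lebesgue_rV R m (box m M)).
have V0 : 0 <= V by exact: fine_ge0.
(* The volume [V] of the box may vanish, hence [V + 1]. *)
have e0 : 0 < eps / (V + 1) by rewrite divr_gt0// ltr_wpDl.
have H := slice_uniform_continuous M y cf e0.
apply: (@filterS _ (nbhs y) (nbhs_filter y) _ _ _ H) => y' {}H.
have i1 := slice_integrable M y cf; have i2 := slice_integrable M y' cf.
have mb := measurable_box m M.
rewrite /slice_int -RintegralB//.
have i3 : (lebesgue_rV R m).-integrable (box m M)
    (EFin \o (fun x => f (row_mx x y) - f (row_mx x y'))).
  by rewrite (_ : _ \o _ = fun x => ((f (row_mx x y))%:E - (f (row_mx x y'))%:E)%E)//; exact: integrableB.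
rewrite (le_trans (le_normr_Rintegral _ _))//.
apply: (@le_trans _ _ (\int[lebesgue_rV R m]_(x in box m M) (eps / (V + 1)))).
  apply: le_Rintegral => //.
    exact: integrable_norm.
  apply: measurable_bounded_integrable => //; first exact: box_fin.
  exact: bounded_cst.
rewrite Rintegral_cst// -/V mulrAC ler_pdivrMr ?ltr_wpDl//.
by rewrite ler_wpM2l ?lerDl// ltW.
Qed.

(** Differentiation under the integral along the line through [y]. The dominating function is a
    constant: the box has finite measure and the derivative is continuous. *)
Lemma is_derive_slice_int M f j (y : 'rV[R]_k) : smooth f ->
  is_derive y (delta_mx ord0 j) (slice_int M f)
    (slice_int M (partial (rshift m j) f) y).
Proof.
move=> sf; apply/is_derive_line.
pose F (t : R) (x : 'rV[R]_m) := f (row_mx x (t *: delta_mx ord0 j + y)).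
pose g := partial (rshift m j) f.
have dF t x : is_derive t (1 : R) (F ^~ x) (g (row_mx x (t *: delta_mx ord0 j + y))).
  have H : is_derive (row_mx x (t *: delta_mx ord0 j + y))
      (delta_mx ord0 (rshift m j)) f (g (row_mx x (t *: delta_mx ord0 j + y))).
    exact: smooth_is_derive.
  have := is_derive_row_mxr H.
  move=> {}H; apply: (iffLR (@is_derive_affine _ _ _ _ (fun y => f (row_mx x y))
    (fun t : R => t *: delta_mx ord0 j + y) _ _ _ _ _) H).
  by move=> h; rewrite [h *: 1]mulr1 scalerDl addrA.
(* This radius contains every [(x, y + t e_j)] with [x] in the box and [|t| < 1]. *)
have [B gB] := @continuous_bounded_box _ _ g (Num.max M (1 + `|y|))
  (smooth_continuous (smooth_partial _ sf)).
have I0 : `]-1, 1[%classic (0 : R) by rewrite /= in_itv/= ltrN10 ltr01.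
have intF (t : R) : `]-1, 1[%classic t ->
    (lebesgue_rV R m).-integrable (box m M) (EFin \o F t).
  by move=> _; apply: slice_integrable; exact: smooth_continuous.
have derF (t : R) x : `]-1, 1[%classic t -> box m M x -> derivable (F ^~ x) t 1.
  by move=> _ _; case: (dF t x).
have GE (t : R) x : partial1of2 F t x = g (row_mx x (t *: delta_mx ord0 j + y)).
  by rewrite partial1of2E; case: (dF t x).
have Gub (t : R) x : `]-1, 1[%classic t -> box m M x -> `|partial1of2 F t x| <= `|B|.
  rewrite /= in_itv/= => tI xM; rewrite GE (le_trans (gB _ _)) ?ler_norm//.
  have N0 : 0 <= Num.max M (1 + `|y|) by rewrite le_max addr_ge0// orbT.
  apply/rV_norm_leP => // i; rewrite mxE; case: fintype.split => l.
    by rewrite le_max (le_trans (coord_le_norm _ _)).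
  rewrite le_max; apply/orP; right; rewrite (le_trans (coord_le_norm _ _))//.
  rewrite (le_trans (ler_normD _ _))// lerD2r normrZ.
  rewrite -[leRHS]mulr1 ler_pM//; first by rewrite ltW// ltr_norml.
  by apply/rV_norm_leP => // a; rewrite !mxE eqxx /=; case: eqP; rewrite ?normr1 ?normr0.
have intB : (lebesgue_rV R m).-integrable (box m M) (EFin \o cst `|B|).
  apply: measurable_bounded_integrable; first exact: measurable_box.
  - exact: box_fin.
  - exact: measurable_cst.
  - exact: bounded_cst.
have B0 (x : 'rV[R]_m) : 0 <= cst `|B| x by [].
apply: DeriveDef.
  exact: (derivable_under_integral (measurable_box m M) I0 intF derF B0 intB Gub).
have := differentiation_under_integral (measurable_box m M) I0 intF derF B0 intB Gub.
rewrite derive1E => ->; apply: eq_Rintegral => x _.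
by rewrite GE scale0r add0r.
Qed.

Lemma smooth_slice_int M f : smooth f -> smooth (slice_int M f).
Proof.
move=> sf; apply: (@smooth_coind _ _ (fun g => exists2 f, smooth f & g = slice_int M f)); last by exists f.
move=> _ [{sf}f sf ->]; split=> [|j].
  exact: continuous_slice_int (smooth_continuous sf).
have D y := is_derive_slice_int M j y sf.
split=> [y|]; first by case: (D y).
exists (partial (rshift m j) f); first exact: smooth_partial.
by apply/funext => y; case: (D y).
Qed.

End block_coordinates.

(** * Finsler norms *)

(* Young's inequality for the exponents [p] and [p / (p - 1)] *)
Lemma powR_tangent (R : realType) (p x y : R) : 1 < p -> 0 <= x -> 0 <= y ->
  x `^ p + p * x `^ (p - 1) * (y - x) <= y `^ p.
Proof.
move=> p1 x0 y0; have p0 : 0 < p by exact: lt_trans p1.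
have q0 : 0 < p / (p - 1) by rewrite divr_gt0// subr_gt0.
have pB0 : p - 1 != 0 by rewrite subr_eq0 gt_eqF.
have pn0 : p != 0 by rewrite gt_eqF.
have := @conjugate_powR R y (x `^ (p - 1)) p (p / (p - 1)) y0 (powR_ge0 _ _) p0 q0.
have -> : p^-1 + (p / (p - 1))^-1 = 1 by field; rewrite pn0 pB0.
move=> /(_ erefl); rewrite -powRrM (_ : (p - 1) * (p / (p - 1)) = p); last by field.
rewrite -(ler_pM2l p0) => H.
have E : x * x `^ (p - 1) = x `^ p by exact: mulr_powRB1.
have : p * (y * x `^ (p - 1)) <= y `^ p + (p - 1) * x `^ p.
  apply: le_trans H _; rewrite le_eqVlt; apply/orP; left; apply/eqP.
  by field; rewrite pn0 pB0.
rewrite -E; set u := x `^ (p - 1); nra.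
Qed.

Section gauge.
Context {R : realType}.

(** A seminorm: what [H] has in common with its restrictions to the two blocks, so that one
    treatment of Rayleigh quotients covers both [lambda1] and [mu_oo]. *)
Definition gauge n (F : 'rV[R]_n -> R) : Prop :=
  [/\ forall x, 0 <= F x, forall x y, F (x + y) <= F x + F y
    & forall t x, F (t *: x) = `|t| * F x].

(** Subadditivity is convexity at the midpoint of [2 x] and [2 y], the factors being removed by
    homogeneity. *)
Lemma C1_norm_gauge n (H : 'rV[R]_n -> R) : C1_norm H -> gauge H.
Proof.
move=> [[H0 _] Hconv Hh _]; split=> // x y.
have h0 : 0 <= 2^-1 :> R by [].
have h1 : 2^-1 <= 1 :> R by rewrite invf_le1// ler1n.
have Hc : H (2^-1 *: (2 *: x) + (1 - 2^-1) *: (2 *: y)) <=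
    2^-1 * H (2 *: x) + (1 - 2^-1) * H (2 *: y).
  exact: (Hconv (Itv01 h0 h1) (2 *: x) (2 *: y) (mem_set I) (mem_set I)).
move: Hc; rewrite !Hh (_ : 1 - 2^-1 = 2^-1 :> R); last by field.
rewrite !scalerA mulVf// !scale1r ger0_norm//.
by rewrite !mulrA mulVf// !mul1r.
Qed.

Lemma gauge_row_mxl m k (H : 'rV[R]_(m + k) -> R) :
  gauge H -> gauge (fun z : 'rV[R]_m => H (row_mx z 0)).
Proof.
move=> [H0 HD HZ]; split=> [//|x y|t x].
  by have := HD (row_mx x 0) (row_mx y 0); rewrite add_row_mx addr0.
by rewrite -HZ scale_row_mx scaler0.
Qed.

Lemma gauge_row_mx0 m k (H : 'rV[R]_(m + k) -> R) :
  gauge H -> gauge (fun z : 'rV[R]_k => H (row_mx 0 z)).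
Proof.
move=> [H0 HD HZ]; split=> [//|x y|t x]; first by have := HD (row_mx 0 x) (row_mx 0 y); rewrite add_row_mx addr0.
by rewrite -HZ scale_row_mx scaler0.
Qed.

Variables (n : nat) (F : 'rV[R]_n -> R).
Hypothesis gF : gauge F.

Lemma gauge0 : F 0 = 0.
Proof. by case: gF => _ _ FZ; rewrite -(scale0r 0) FZ normr0 mul0r. Qed.

Lemma gaugeN x : F (- x) = F x.
Proof. by case: gF => _ _ FZ; rewrite -scaleN1r FZ normrN1 mul1r. Qed.

Lemma gauge_le_sum x : F x <= \sum_i `|x ord0 i| * F (delta_mx ord0 i).
Proof.
rewrite {1}[x]row_sum_delta; case: gF => F0 FD FZ.
elim/big_rec2 : _ => [|i y1 y2 _ H]; first by rewrite gauge0.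
by rewrite (le_trans (FD _ _))// lerD// FZ.
Qed.

Lemma gauge_le_norm : exists2 C, 0 < C & forall x, F x <= C * `|x|.
Proof.
case: gF => F0 FD FZ.
exists (1 + \sum_i F (delta_mx ord0 i)).
  by rewrite ltr_pwDl// sumr_ge0.
move=> x; rewrite (le_trans (gauge_le_sum x))//.
rewrite mulrDl mul1r ler_wpDl// mulr_suml; apply: ler_sum => i _.
by rewrite mulrC ler_wpM2l// coord_le_norm.
Qed.

Lemma gauge_continuous : continuous F.
Proof.
have [C C0 FC] := gauge_le_norm; case: gF => F0 FD FZ.
have lip x y : `|F x - F y| <= C * `|x - y|.
  have H (u v : 'rV_n) : F u - F v <= C * `|u - v|.
    by rewrite lerBlDr -{1}(subrK v u) (le_trans (FD _ _))// lerD2r.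
  by rewrite ler_norml H lerNl opprB distrC H.
suff H (x : 'rV[R]_n) : F @ x --> F x by exact: H.
apply/(@cvgrPdist_lt R R^o 'rV[R]_n (nbhs x) (nbhs_filter x)) => e e0.
apply/nbhs_ballP; exists (e / C); first by rewrite /= divr_gt0.
move=> y; rewrite mx_norm_ball /= => xy.
by rewrite (le_lt_trans (lip _ _))// mulrC -ltr_pdivlMr.
Qed.

Lemma gauge_measurable : measurable_fun setT F.
Proof. exact: continuous_measurable_rV gauge_continuous. Qed.

End gauge.

(** * Duality with the gradient of [H] and second differences of [H^p] *)

Section C1_norm.
Context {R : realType} {n : nat} (H : 'rV[R]_n -> R).
Hypothesis nH : C1_norm H.

Let gH := C1_norm_gauge nH.
Let H0 : forall x, 0 <= H x. Proof. by case: gH. Qed.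
Let HD : forall x y, H (x + y) <= H x + H y. Proof. by case: gH. Qed.
Let HZ : forall t x, H (t *: x) = `|t| * H x. Proof. by case: gH. Qed.

Lemma C1_norm_gt0 x : x != 0 -> 0 < H x.
Proof. by case: nH => -[_ +] _ _ _; exact. Qed.

Lemma C1_norm_diff x : x != 0 -> differentiable H x.
Proof. by case: nH => _ _ _ /(_ x) + x0 => /(_ x0)[]. Qed.

Lemma dotr_gradE z v : z != 0 -> dotr (grad H z) v = 'D_v H z.
Proof.
move=> z0; have dH := C1_norm_diff z0.
rewrite deriveE// {2}[v]row_sum_delta linear_sum /dotr; apply: eq_bigr => i _.
by rewrite linearZ /= mxE /partial deriveE// mulrC.
Qed.

(** Subadditivity bounds every difference quotient with positive step by [H v]. With
    [dotr_grad_self] it says that [grad H z] is a norming functional of [z], of dual norm at most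
    one. *)
Lemma dotr_grad_le z v : z != 0 -> dotr (grad H z) v <= H v.
Proof.
move=> z0; rewrite dotr_gradE//.
have dH : derivable H z v by apply: diff_derivable; exact: C1_norm_diff.
rewrite leNgt; apply/negP => vD.
have /cvgr_gt/(_ _ vD) : h^-1 *: ((H \o shift z) (h *: v) - H z) @[h --> 0^'] --> 'D_v H z.
  exact: dH.
move=> /nbhs_ballP[e /= e0 He].
have h0 : 0 < e / 2 by rewrite divr_gt0.
have := He (e / 2); rewrite /= -ball_normE /= sub0r normrN gtr0_norm//.
rewrite ltr_pdivrMr// ltr_pMr// ltr1n => /(_ isT); rewrite gt_eqF// => /(_ isT).
apply/negP; rewrite -leNgt [_ *: _]mulrC ler_pdivrMr// mulrC lerBlDr.
by rewrite (le_trans (HD _ _))// HZ (mulrC (H v)) ger0_norm// mulr_ge0 ?(ltW e0) ?invr_ge0.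
Qed.

(** Euler's identity: along the ray through [z], and for [t] near [0], [H] is the affine function
    [(t + 1) H z]. *)
Lemma dotr_grad_self z : z != 0 -> dotr (grad H z) z = H z.
Proof.
move=> z0; rewrite dotr_gradE//.
suff [_ ->//] : is_derive z z H (H z).
apply/is_derive_line.
apply: (@near_eq_is_derive _ _ _ (fun t : R => H z * (t + 1))).
  near=> t; rewrite -{3}[z]scale1r -scalerDl HZ mulrC ger0_norm//.
  rewrite -lerBlDr sub0r ltW//; near: t; apply: lt_nbhsr.
  by rewrite oppr_lt0.
by apply: is_derive_eq; rewrite addr0 [_ *: _]mulr1.
Unshelve. all: by end_near. Qed.

Lemma C1_norm_tangent z y : z != 0 -> H z - H y <= dotr (grad H z) (z - y).
Proof.
move=> z0; have := dotr_grad_le y z0; have := dotr_grad_self z0.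
rewrite /dotr => <-; rewrite lerBlDr -lerBlDl => yH; apply: le_trans yH.
rewrite -sumrB le_eqVlt; apply/orP; left; apply/eqP; apply: eq_bigr => i _.
by rewrite !mxE; ring.
Qed.

(** By homogeneity, [c] is the minimum of [H] on the compact unit sphere of the maximum norm. *)
Lemma C1_norm_lower : exists2 c, 0 < c & forall x, c * `|x| <= H x.
Proof.
pose S := [set x : 'rV[R]_n | `|x| = 1].
(* An empty sphere means that [0] is the only vector, and any [c] works. *)
have [S0|S0] := eqVneq S set0.
  exists 1 => // x; have [->|x0] := eqVneq x 0; first by rewrite normr0 mulr0.
  have : S (`|x|^-1 *: x) by rewrite /S /= normrZ normfV normr_id mulVf// normr_eq0.
  by rewrite S0.
have cS : compact S.
  apply: (subclosed_compact _ (compact_box n 1)); last by move=> x; rewrite /S /= => ->.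
  rewrite (_ : S = (fun x => `|x|) @^-1` [set y | y = 1])//.
  by apply: closed_comp => [x _|]; [exact: norm_continuous|exact: closed_eq].
have [|c /set_mem cS1 cH] := @EVT_min_rV R n H S _ cS (continuous_subspaceT (gauge_continuous gH)).
  exact/set0P.
exists (H c).
  apply: C1_norm_gt0; apply/eqP => c0; move: cS1; rewrite /S /= c0 normr0.
  by move/esym/eqP; rewrite oner_eq0.
move=> x; have [->|x0] := eqVneq x 0; first by rewrite normr0 mulr0.
have nx : `|x| != 0 by rewrite normr_eq0.
have := cH (`|x|^-1 *: x); rewrite HZ normfV normr_id mulrC ler_pdivlMr ?normr_gt0//; apply.
by apply/mem_set; rewrite /S /= normrZ normfV normr_id mulVf.
Qed.

(** Put [Phi = H^(p-1) grad H]. Convexity bounds each increment by the slope at the displaced point,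
    so the second difference is at most [p] times the pairing of [a] with
    [Phi (b + a) - Phi (b - a)]. Continuity of [Phi] off [0] and compactness of the sphere make this
    difference uniformly small. *)
Lemma C1_norm_sphere p eps : 1 < p -> 0 < eps -> exists2 eta, 0 < eta &
  forall a b, `|b| = 1 -> `|a| <= eta ->
  H (b + a) `^ p + H (b - a) `^ p - 2 * H b `^ p <= eps * `|a|.
Proof.
move=> p1 eps0.
pose Phi i (z : 'rV[R]_n) := H z `^ (p - 1) * grad H z ord0 i.
pose S := [set x : 'rV[R]_n | `|x| = 1].
have cS : compact S.
  apply: (subclosed_compact _ (compact_box n 1)); last by move=> x; rewrite /S /= => ->.
  rewrite (_ : S = (fun x => `|x|) @^-1` [set y | y = 1])//.
  by apply: closed_comp => [x _|]; [exact: norm_continuous|exact: closed_eq].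
(* Each of the [n] coordinates contributes at most [2 d |a|], and the sum is multiplied by [p];
   [n.+1] keeps the denominator nonzero in dimension [0]. *)
pose d := eps / (2 * p * n.+1%:R).
have p0 : 0 < p by exact: lt_trans p1.
have d0 : 0 < d by rewrite divr_gt0// !mulr_gt0.
pose P (eta : R) b := forall a, `|a| <= eta ->
  H (b + a) `^ p + H (b - a) `^ p - 2 * H b `^ p <= eps * `|a|.
suff : \forall eta \near 0^'+, S `<=` P eta.
  move=> SP; near (0:R)^'+ => eta; have SPe : S `<=` P eta by near: eta; exact: SP.
  exists eta; first by near: eta; exact: nbhs_right_gt.
  by move=> a b b1; exact: SPe.
have /compact_near_coveringP cK := cS; apply: (cK _ 0^'+ P) => b0 Sb0.
have b00 : b0 != 0 by rewrite -normr_eq0 Sb0 oner_eq0.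
have cPhi i : {for b0, continuous (Phi i)}.
  apply: (@continuousM _ _ (fun z => H z `^ (p - 1)) (fun z => grad H z ord0 i)).
    apply: (@continuous_comp _ _ _ H (fun t => t `^ (p - 1))).
      exact: (gauge_continuous gH).
    apply: differentiable_continuous; apply/derivable1_diffP.
    by case: (is_derive1_powR (p - 1) (C1_norm_gt0 b00)).
  apply: (@continuous_comp _ _ _ (grad H) (fun z : 'rV[R]_n => z ord0 i)).
    by case: nH => _ _ _ /(_ _ b00)[].
  exact: coord_continuous.
have : \forall z \near b0, forall i, `|Phi i b0 - Phi i z| < d.
  apply: (@filter_forall _ _ _ (nbhs b0) (nbhs_filter (b0 : 'rV[R]_n))) => i.
  by have /cvgrPdist_lt/(_ _ d0) := cPhi i.
move=> /nbhs_ballP[r /= r0 Hr].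
(* The bound by [1], the norm of [b0], keeps [b + s] away from the origin, where [H] need not be
   differentiable. *)
pose r' := Num.min r 1.
have r'0 : 0 < r' by rewrite lt_min r0 ltr01.
exists (ball b0 (r' / 2), [set eta | eta < r' / 2]) => /=.
  split; first by apply: nbhsx_ballx; rewrite divr_gt0.
  by apply: nbhs_right_lt; rewrite divr_gt0.
move=> [b eta] /= [bb0 eta_r] a aeta.
rewrite mx_norm_ball /= in bb0.
have Q (s : 'rV[R]_n) : `|s| <= eta -> b + s != 0 /\ forall i, `|Phi i b0 - Phi i (b + s)| < d.
  move=> seta; have H1 : `|b0 - (b + s)| < r'.
    rewrite opprD addrA (splitr r') (le_lt_trans (ler_normB _ _))// ltrD//.
    exact: le_lt_trans eta_r.
  split; last first.
    move=> i; apply: Hr; rewrite mx_norm_ball /=; apply: lt_le_trans H1 _.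
    by rewrite /r' ge_min lexx.
  apply/eqP => bs0; move: H1; rewrite bs0 subr0 Sb0 /r' lt_min ltxx andbF//.
(* Two tangent inequalities at [b + s], one for [t^p] and one for [H], compose because the factor
   [p H^(p-1)] is nonnegative. *)
have step (s : 'rV[R]_n) : `|s| <= eta ->
    H (b + s) `^ p - H b `^ p <= p * \sum_i s ord0 i * Phi i (b + s).
  move=> /Q[bs0 _].
  have T1 := powR_tangent p1 (H0 (b + s)) (H0 b).
  have T2 : H (b + s) - H b <= dotr (grad H (b + s)) s.
    by have := C1_norm_tangent b bs0; rewrite addrAC subrr add0r.
  have -> : \sum_i s ord0 i * Phi i (b + s) = H (b + s) `^ (p - 1) * dotr (grad H (b + s)) s.
    by rewrite mulr_sumr; apply: eq_bigr => i _; rewrite /Phi; ring.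
  apply: (@le_trans _ _ (p * H (b + s) `^ (p - 1) * (H (b + s) - H b))).
    by rewrite lerBlDl -lerBlDr; apply: le_trans T1; rewrite -(opprB (H b)) mulrN opprK.
  by rewrite -mulrA ler_pM2l// ler_wpM2l// powR_ge0.
have s1 := step a aeta.
have s2 : H (b - a) `^ p - H b `^ p <= p * \sum_i (- a) ord0 i * Phi i (b - a).
  by apply: step; rewrite normrN.
have [_ Qa] := Q a aeta.
have [_ Qma] : b - a != 0 /\ forall i, `|Phi i b0 - Phi i (b - a)| < d by apply: Q; rewrite normrN.
apply: (@le_trans _ _ (p * \sum_i a ord0 i * (Phi i (b + a) - Phi i (b - a)))).
  rewrite (_ : \sum_i _ = \sum_i a ord0 i * Phi i (b + a) + \sum_i (- a) ord0 i * Phi i (b - a)).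
    by rewrite mulrDr; lra.
  by rewrite -big_split /=; apply: eq_bigr => i _; rewrite mxE; ring.
apply: (@le_trans _ _ (p * \sum_(i < n) `|a| * (2 * d))).
  rewrite ler_pM2l//; apply: ler_sum => i _.
  rewrite (le_trans (ler_norm _))// normrM ler_pM// ?coord_le_norm//.
  have -> : Phi i (b + a) - Phi i (b - a) = (Phi i b0 - Phi i (b - a)) - (Phi i b0 - Phi i (b + a)).
    by ring.
  by rewrite (le_trans (ler_normB _ _))// mulr_natl mulr2n lerD// ltW.
rewrite sumr_const card_ord -[_ *+ n]mulr_natr.
have dE : (2 * p * n.+1%:R) * d = eps.
  rewrite /d mulrC divfK// mulf_neq0 ?mulf_neq0 ?pnatr_eq0// gt_eqF//.
rewrite -dE (_ : p * (`|a| * (2 * d) * n%:R) = (2 * p * n%:R * d) * `|a|); last by ring.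
by rewrite ler_wpM2r// ler_wpM2r ?(ltW d0)// ler_wpM2l ?mulr_ge0 ?(ltW p0)// ler_nat.
Unshelve. all: by end_near. Qed.

(* Homogeneity reduces [|a| <= eta |b|] to [|b| = 1]; otherwise [H b] is at most
   a multiple of [H a]. *)
Lemma second_difference p eps : 1 < p -> 0 < eps -> exists2 C, 0 <= C &
  forall a b, H (b + a) `^ p + H (b - a) `^ p <=
    2 * H b `^ p + eps * (H a * H b `^ (p - 1)) + C * H a `^ p.
Proof.
move=> p1 eps0; have p0 : 0 < p by exact: lt_trans p1.
have [c c0 cH] := C1_norm_lower.
have [C0 C00 CH] := gauge_le_norm gH.
(* The factor [c^p] pays for replacing [|a| |b|^(p-1)] by [H a * H b^(p-1)]. *)
pose eps' := eps * c `^ p.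
have eps'0 : 0 < eps' by rewrite mulr_gt0// powR_gt0.
have [eta eta0 Heta] := C1_norm_sphere p1 eps'0.
(* When [|a| > eta |b|], [H b] is at most [C0 / (eta c)] times [H a], so that [H (b + a)] and
   [H (b - a)] are at most [K * H a]. *)
pose K := 1 + C0 / (eta * c).
have K0 : 0 <= K by rewrite addr_ge0// divr_ge0 ?mulr_ge0// ltW.
exists (2 * K `^ p); first by rewrite mulr_ge0// powR_ge0.
move=> a b.
have [ab|ab] := leP `|a| (eta * `|b|); last first.
  have Hb : H b <= C0 / (eta * c) * H a.
    apply: (le_trans (CH b)); rewrite -mulrA ler_pM2l//.
    rewrite ler_pdivlMl ?mulr_gt0// mulrAC (le_trans _ (cH a))// mulrC ler_pM2l//.
    exact: ltW.
  have Hs (s : 'rV[R]_n) : H s = H a -> H (b + s) `^ p <= K `^ p * H a `^ p.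
    move=> sa; rewrite -powRM//; apply: ge0_ler_powR; rewrite ?nnegrE ?mulr_ge0//.
      exact: ltW.
    by rewrite (le_trans (HD _ _))// sa /K mulrDl mul1r addrC lerD2l.
  have := Hs a erefl; have := Hs (- a) (gaugeN gH a).
  have := powR_ge0 (H b) p; have := powR_ge0 (H a) p.
  have := mulr_ge0 (ltW eps0) (mulr_ge0 (H0 a) (powR_ge0 (H b) (p - 1))).
  lra.
have [b0|b0] := eqVneq b 0.
  have a0 : a = 0 by apply/eqP; rewrite -normr_le0 (le_trans ab)// b0 normr0 mulr0.
  by rewrite a0 b0 addr0 subr0 (gauge0 gH) powR0 ?gt_eqF// mul0r !mulr0 !addr0.
have nb : 0 < `|b| by rewrite normr_gt0.
have := Heta (`|b|^-1 *: a) (`|b|^-1 *: b).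
rewrite !normrZ normfV normr_id mulVf ?gt_eqF// => /(_ erefl).
rewrite mulrC ler_pdivrMr// => /(_ ab).
rewrite -scalerDr -scalerBr !HZ normfV normr_id !powRM ?invr_ge0//.
set t := `|b|^-1 `^ p.
have t0 : 0 < t by rewrite /t powR_gt0// invr_gt0.
have tE : t * `|b| `^ p = 1 by rewrite -powRM ?invr_ge0// mulVf ?gt_eqF// powR1.
move=> T.
have {T} : H (b + a) `^ p + H (b - a) `^ p - 2 * H b `^ p <=
    eps' * (`|a| / `|b|) * `|b| `^ p.
  rewrite -(ler_pM2l t0); apply: le_trans (le_trans T _).
    by rewrite le_eqVlt; apply/orP; left; apply/eqP; ring.
  rewrite (_ : t * (_ * _) = eps' * (`|a| / `|b|) * (t * `|b| `^ p)); last by ring.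
  by rewrite tE mulr1.
have -> : eps' * (`|a| / `|b|) * `|b| `^ p = eps' * (`|a| * `|b| `^ (p - 1)).
  rewrite -(mulr_powRB1 (normr_ge0 b) p0).
  by field; rewrite gt_eqF.
have Y : c `^ p * (`|a| * `|b| `^ (p - 1)) <= H a * H b `^ (p - 1).
  have na : 0 <= c * `|a| by rewrite mulr_ge0// ltW.
  have nb' : 0 <= c * `|b| by rewrite mulr_ge0// ltW.
  have -> : c `^ p * (`|a| * `|b| `^ (p - 1)) = (c * `|a|) * (c * `|b|) `^ (p - 1).
    rewrite powRM ?(ltW c0)// -(mulr_powRB1 (ltW c0) p0); ring.
  by rewrite ler_pM ?powR_ge0// ge0_ler_powR ?nnegrE ?subr_ge0 ?(ltW p1).
rewrite /eps' -mulrA => T.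
have := mulr_ge0 (mulr_ge0 (ler0n R 2) (powR_ge0 K p)) (powR_ge0 (H a) p).
have := ler_wpM2l (ltW eps0) Y.
lra.
Qed.

(** The mixed term is at most [H b^p + H a^p], by comparing [H a] with [H b]. With [a] and [b]
    separated, each integral over the cylinder factors into an energy and a mass. [C] is independent
    of [t], which will be [1 / l]. *)
Lemma second_difference_scale p eps : 1 < p -> 0 < eps -> exists2 C, 0 <= C &
  forall t a b, H (b + t *: a) `^ p + H (b - t *: a) `^ p <=
    (2 + eps * `|t|) * H b `^ p + (eps * `|t| + C * `|t| `^ p) * H a `^ p.
Proof.
move=> p1 eps0; have p0 : 0 < p by exact: lt_trans p1.
have [C C0 HC] := second_difference p1 eps0; exists C => // t a b.
apply: (le_trans (HC (t *: a) b)); rewrite HZ powRM//.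
have Y : H a * H b `^ (p - 1) <= H b `^ p + H a `^ p.
  have [ab|ba] := leP (H a) (H b).
    rewrite (@le_trans _ _ (H b * H b `^ (p - 1)))//.
      by rewrite ler_wpM2r ?powR_ge0.
    by rewrite mulr_powRB1// lerDl powR_ge0.
  rewrite (@le_trans _ _ (H a * H a `^ (p - 1)))//.
    by rewrite ler_wpM2l// ge0_ler_powR ?nnegrE ?subr_ge0 ?(ltW p1)// ltW.
  by rewrite mulr_powRB1// lerDr powR_ge0.
have et0 : 0 <= eps * `|t| by rewrite mulr_ge0// ltW.
have := ler_wpM2l et0 Y; set u := H b `^ p; set u' := H a `^ p.
set w := H b `^ (p - 1); set s := `|t| `^ p => Y'.
have -> : (2 + eps * `|t|) * u + (eps * `|t| + C * s) * u' =
  2 * u + eps * `|t| * (u + u') + C * (s * u') by ring.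
by rewrite lerD2r lerD2l; apply: le_trans Y'; rewrite !mulrA.
Qed.

End C1_norm.

(** * Norms in [L^p] of real functions and of gauges of vector fields *)

Section Lnorm_real.
Context d {T : measurableType d} {R : realType} (mu : {measure set T -> \bar R}).
Variable p : R.
Hypothesis p1 : 1 < p.
Implicit Types f g : T -> R.
Local Open Scope ereal_scope.

Local Notation N f := ('N[mu]_p%:E[EFin \o f]).

Let p0 : (0 < p)%R. Proof. exact: lt_trans p1. Qed.

Lemma LnormE f : N f = (\int[mu]_x (`|f x| `^ p)%:E) `^ p^-1.
Proof. by rewrite unlock. Qed.

Lemma Lnorm_powR f : N f `^ p = \int[mu]_x (`|f x| `^ p)%:E.
Proof.
by rewrite poweR_Lnorm ?gt_eqF.
Qed.

Lemma measurable_powR_norm f : measurable_fun setT f ->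
  measurable_fun setT (fun x => (`|f x| `^ p)%:E).
Proof.
move=> mf; apply/measurable_EFinP.
by apply: (measurableT_comp (measurable_powR p)); exact: measurableT_comp.
Qed.

Lemma le_Lnorm f g : measurable_fun setT f -> measurable_fun setT g ->
  (forall x, `|f x| <= `|g x|)%R -> N f <= N g.
Proof.
move=> mf mg fg; rewrite !LnormE; apply: gt0_ler_poweR.
- by rewrite invr_ge0 ltW.
- by rewrite in_itv/= leey andbT; apply: integral_ge0 => x _; rewrite lee_fin powR_ge0.
- by rewrite in_itv/= leey andbT; apply: integral_ge0 => x _; rewrite lee_fin powR_ge0.
apply: ge0_le_integral => //.
- exact: measurable_powR_norm.
- exact: measurable_powR_norm.
- by move=> x _; rewrite lee_fin ge0_ler_powR// ?nnegrE// ltW.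
Qed.

Lemma Lnorm_scale (c : R) f : (0 <= c)%R -> measurable_fun setT f ->
  N (fun x => c * f x)%R = c%:E * N f.
Proof.
move=> c0 mf; rewrite !LnormE.
under eq_integral do rewrite normrM (ger0_norm c0) powRM// EFinM.
rewrite ge0_integralZl ?lee_fin ?powR_ge0//; last exact: measurable_powR_norm.
rewrite poweRM ?lee_fin ?powR_ge0//; last first.
  by apply: integral_ge0 => x _; rewrite lee_fin powR_ge0.
by rewrite poweR_EFin -powRrM mulfV ?gt_eqF// powRr1.
Qed.

Lemma Lnorm_sum n (f : 'I_n -> T -> R) : (forall i, measurable_fun setT (f i)) ->
  N (fun x => \sum_i f i x)%R <= \sum_i N (f i).
Proof.
elim: n f => [|n IH] f mf.
  rewrite big_ord0 (_ : (fun x => _) = cst 0%R); last by apply/funext => x; rewrite big_ord0.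
  by rewrite (_ : EFin \o _ = cst 0)// Lnorm0// eqe gt_eqF.
rewrite big_ord_recr /=.
rewrite (_ : (fun x => _) = ((fun x => \sum_(i < n) f (widen_ord (leqnSn n) i) x) \+ f ord_max)%R); last first.
  by apply/funext => x; rewrite big_ord_recr.
apply: le_trans (minkowski_EFin mu _ _ (ltW p1)) _ => //.
  exact: measurable_sum.
by rewrite leeD2r//; apply: IH.
Qed.

End Lnorm_real.

Section gauge_Lnorm.
Context {R : realType} {n : nat} (F : 'rV[R]_n -> R) (p : R).
Hypotheses (gF : gauge F) (p1 : 1 < p).
Context d {T : measurableType d} (mu : {measure set T -> \bar R}).
Local Open Scope ereal_scope.

Local Notation N f := ('N[mu]_p%:E[EFin \o f]).

Lemma gauge_measurable_comp (z : T -> 'rV[R]_n) :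
  (forall i, measurable_fun setT (fun t => z t ord0 i)) ->
  measurable_fun setT (fun t => F (z t)).
Proof.
move=> mz; apply: (measurableT_comp (gauge_measurable gF)).
exact: measurable_fun_rV.
Qed.

Lemma gauge_Lnorm_le (z : T -> 'rV[R]_n) :
  (forall i, measurable_fun setT (fun t => z t ord0 i)) ->
  N (fun t => F (z t)) <=
  \sum_i (F (delta_mx ord0 i))%:E * N (fun t => z t ord0 i).
Proof.
move=> mz; have [F0 _ _] := gF.
have mi i : measurable_fun setT (fun t => F (delta_mx ord0 i) * `|z t ord0 i|)%R.
  by apply: measurable_funM => //; exact: measurableT_comp.
apply: le_trans (le_Lnorm mu p1 (gauge_measurable_comp mz) (measurable_sum _ mi) _) _.
  move=> t; rewrite !ger0_norm//; last first.
    by rewrite sumr_ge0// => i _; rewrite mulr_ge0.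
  rewrite (le_trans (gauge_le_sum gF _))//.
  by apply: ler_sum => i _; rewrite mulrC.
apply: le_trans (Lnorm_sum _ p1 mi) _.
apply: lee_sum => i _; rewrite (Lnorm_scale _ p1)//; last exact: measurableT_comp.
rewrite lee_pmul// ?lee_fin ?Lnorm_ge0//.
apply: (le_Lnorm mu p1) => //; first exact: measurableT_comp.
by move=> t; rewrite normr_id.
Qed.

(** Minkowski's inequality after [F y <= F z + F (y - z)]. It transfers convergence of the partial
    derivatives in [L^p] to the energy. *)
Lemma gauge_Lnorm_lip (y z : T -> 'rV[R]_n) :
  (forall i, measurable_fun setT (fun t => y t ord0 i)) ->
  (forall i, measurable_fun setT (fun t => z t ord0 i)) ->
  N (fun t => F (y t)) <= N (fun t => F (z t)) +
  \sum_i (F (delta_mx ord0 i))%:E * N (fun t => y t ord0 i - z t ord0 i)%R.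
Proof.
move=> my mz; have [F0 FD _] := gF.
have mB i : measurable_fun setT (fun t => (y t - z t)%R ord0 i).
  under eq_fun do rewrite !mxE.
  exact: measurable_funB.
have mFz := gauge_measurable_comp mz.
have mFB := gauge_measurable_comp mB.
apply: (@le_trans _ _ (N ((fun t => F (z t)) \+ (fun t => F (y t - z t)))%R)).
  apply: (le_Lnorm mu p1); first exact: gauge_measurable_comp.
    exact: measurable_funD.
  move=> t /=; rewrite !ger0_norm ?addr_ge0//.
  by rewrite -{1}(subrK (z t) (y t)) addrC FD.
apply: le_trans (minkowski_EFin mu mFz mFB (ltW p1)) _.
rewrite leeD2l// (le_trans (gauge_Lnorm_le mB))//.
apply: lee_sum => i _; rewrite le_eqVlt; apply/orP; left; apply/eqP; congr (_ * _).
by apply: eq_Lnorm => t; rewrite /= !mxE.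
Qed.

End gauge_Lnorm.

(** * Test functions and Rayleigh quotients *)

Section positivity.
Context {R : realType}.

Definition cube n (c : 'rV[R]_n) (d : R) : set 'rV[R]_n :=
  [set x | forall i, `|x ord0 i - c ord0 i| < d].

Lemma measurable_cube n c d : measurable (@cube n c d).
Proof.
rewrite (_ : cube c d = \bigcap_(i in [set: 'I_n])
    (fun x => x ord0 i) @^-1` (ball (c ord0 i) d)).
  apply: fin_bigcap_measurable => // i _.
  rewrite -[X in measurable X]setTI; apply: measurable_coord => //.
  exact: measurable_ball.
apply/seteqP; split=> x /=.
  by move=> Bx i _ /=; rewrite -ball_normE /= distrC; exact: Bx.
by move=> Bx i; have := Bx i I; rewrite /= -ball_normE /= distrC.
Qed.

Lemma cube_gt0 n c d : 0 < d -> (0 < lebesgue_rV R n (cube c d))%E.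
Proof.
move=> d0; elim: n c => [|n IH] c.
  by rewrite /= diracE mem_set ?lte01// => -[].
rewrite /= /lebesgue_rV_step /pushforward.
rewrite (_ : _ @^-1` _ = `](c ord0 ord0 - d), (c ord0 ord0 + d)[%classic `*`
    cube (\row_j c ord0 (lift ord0 j)) d).
  rewrite product_measure1E; [|exact: measurable_itv|exact: measurable_cube].
  rewrite mule_gt0//.
  suff : (0 < @lebesgue_measure R `](c ord0 ord0 - d)%R, (c ord0 ord0 + d)%R[)%E by [].
  rewrite lebesgue_measure_itv /= lte_fin ltrBlDr -addrA ltrDl addr_gt0//.
  by rewrite -EFinB lte_fin subr_gt0 ltrBlDr -addrA ltrDl addr_gt0.
apply/seteqP; split=> -[t x]; rewrite /cube /=.
  move=> tx; split=> [|i].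
    by have := tx ord0; rewrite mxE unlift_none /= in_itv/= ltr_distl.
  by have := tx (lift ord0 i); rewrite !mxE liftK.
move=> [tM xM] i; rewrite mxE.
case: unliftP => [j ->|->] /=; first by have := xM j; rewrite mxE.
by rewrite ltr_distl; rewrite in_itv/= in tM.
Qed.

(** By continuity [f] is nonzero on a cube around [x0], and cubes have positive measure. *)
Lemma continuous_not_ae0 n (f : 'rV[R]_n -> R) x0 : continuous f -> f x0 != 0 ->
  ~ {ae lebesgue_rV R n, forall x, f x = 0}.
Proof.
move=> cf f0 [A [mA A0 sA]].
have f0' : 0 < `|f x0| by rewrite normr_gt0.
have /cvgrPdist_lt/(_ _ f0')/nbhs_ballP[d /= d0 fd] := cf x0.
have : (lebesgue_rV R n (cube x0 d) <= lebesgue_rV R n A)%E.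
  apply: le_measure; rewrite ?inE//; first exact: measurable_cube.
  move=> x xc; apply: sA => /= fx0.
  have := fd x; rewrite mx_norm_ball /= fx0 subr0 ltxx => H; suff : false by [].
  by apply: H; apply/rV_norm_ltP => // i; rewrite !mxE distrC; exact: xc.
by apply/negP; rewrite A0 -ltNge; exact: cube_gt0.
Qed.

End positivity.

Section test_functions.
Context {R : realType} {n : nat}.
Implicit Types (U K : set 'rV[R]_n) (phi : 'rV[R]_n -> R).

Lemma mem_fsupport phi x : phi x != 0 -> fsupport phi x.
Proof. by move=> phix; apply: (@subset_closure _ [set x | phi x != 0]). Qed.

Lemma test_funI U K phi : smooth phi -> compact K -> K `<=` U ->
  (forall x, phi x != 0 -> K x) -> test_fun U phi.
Proof.
move=> sphi cK KU phiK.
have clK : fsupport phi `<=` K.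
  have : closed K by apply: compact_closed => //; exact: norm_hausdorff.
  by move/closure_id => ->; exact: closure_subset.
split=> //; last exact: subset_trans KU.
by apply: subclosed_compact clK => //; exact: closed_closure.
Qed.

Lemma test_fun_bounded U phi : test_fun U phi ->
  exists M, forall x, M < `|x| -> phi x = 0.
Proof.
move=> [_ /compact_bounded[M [_ HM]] _]; exists (M + 1) => x Mx.
apply: contrapT => /eqP phix.
have /(HM (M + 1)) : M < M + 1 by rewrite ltrDl.
by move=> /(_ x (mem_fsupport phix)) /=; rewrite leNgt Mx.
Qed.

Lemma test_fun_Cc U phi : test_fun U phi -> Cc phi.
Proof.
move=> tphi; split; last exact: test_fun_bounded tphi.
by apply: smooth_continuous; case: tphi.
Qed.

Lemma test_fun_partial_Cc U phi i : test_fun U phi -> Cc (partial i phi).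
Proof.
move=> tphi; apply: Cc_partial; first exact: test_fun_Cc tphi.
by apply: smooth_continuous; apply: smooth_partial; case: tphi.
Qed.

Lemma test_fun_out U phi x : test_fun U phi -> ~ U x -> phi x = 0.
Proof.
move=> [_ _ sU] Ux; apply: contrapT => /eqP phix; apply: Ux; apply: sU.
exact: mem_fsupport.
Qed.

Lemma test_fun_partial_out U phi i x : test_fun U phi -> ~ U x -> partial i phi x = 0.
Proof.
move=> [_ _ sU] Ux; rewrite /partial.
rewrite (@near_eq_derive _ _ _ phi (cst 0)) ?derive_cst//.
have : open (~` fsupport phi) by apply: closed_openC; exact: closed_closure.
move=> /(_ x) H.
have : nbhs x (~` fsupport phi).
  by apply: open_nbhs_nbhs; split; [apply: closed_openC; exact: closed_closure|move=> /sU].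
apply: filterS => y /= ny; apply: contrapT => /eqP phiy; apply: ny.
exact: mem_fsupport.
Qed.

Lemma test_fun_patch U phi : test_fun U phi -> phi \_ U = phi.
Proof.
move=> tphi; apply/funext => x; rewrite patchE; case: ifPn => //.
by rewrite notin_setE => Ux; rewrite (test_fun_out tphi).
Qed.

Lemma test_fun_partial_patch U phi i : test_fun U phi ->
  partial i phi \_ U = partial i phi.
Proof.
move=> tphi; apply/funext => x; rewrite patchE; case: ifPn => //.
by rewrite notin_setE => Ux; rewrite (test_fun_partial_out _ tphi).
Qed.

Local Notation mu := (lebesgue_rV R n).

Lemma Cc_powR_integrable (f : 'rV[R]_n -> R) p : 0 < p -> Cc f ->
  mu.-integrable setT (fun x => (`|f x| `^ p)%:E).
Proof.
move=> p0 Cf; have [B fB] := Cc_bounded Cf; case: Cf => cf [M fM].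
have mf : measurable_fun setT (fun x => `|f x| `^ p).
  apply: (measurableT_comp (measurable_powR p)).
  by apply: measurableT_comp => //; exact: continuous_measurable_rV.
rewrite (_ : (fun x => _) = (EFin \o (fun x => `|f x| `^ p)) \_ (box n M)).
  apply/(integrable_mkcond _ (measurable_box n M)).
  apply: measurable_bounded_integrable => //.
  - exact: measurable_box.
  - exact: box_fin.
  - exact: measurable_funTS.
  exists (B `^ p); split; first exact: num_real.
  move=> C BC x _ /=; rewrite ger0_norm ?powR_ge0//.
  rewrite (le_trans _ (ltW BC))// ge0_ler_powR ?nnegrE ?(ltW p0)//.
  exact: le_trans (fB x).
apply/funext => x; rewrite patchE; case: ifPn => //.
by rewrite notin_setE /= => /negP; rewrite -ltNge => /fM ->; rewrite normr0 powR0 ?gt_eqF.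
Qed.

Lemma Cc_Lfun (f : 'rV[R]_n -> R) p : 1 < p -> Cc f -> f \in Lfun mu p%:E.
Proof.
move=> p1 Cf; have p0 : 0 < p by exact: lt_trans p1.
rewrite inE; apply/andP; split; rewrite inE.
  by apply: continuous_measurable_rV; case: Cf.
rewrite /= /finite_norm LnormE; apply: poweR_lty.
have /integrableP[_] := Cc_powR_integrable p0 Cf; apply: le_lt_trans.
rewrite le_eqVlt; apply/orP; left; apply/eqP; apply: eq_integral => x _.
by rewrite gee0_abs ?lee_fin ?powR_ge0.
Qed.

Lemma CcM (f g : 'rV[R]_n -> R) : continuous f -> Cc g -> Cc (fun x => f x * g x).
Proof.
move=> cf Cg; apply: (sub_Cc _ Cg) => [x|x ->]; last by rewrite mulr0.
by apply: continuousM; [exact: cf|case: Cg => cg _; exact: cg].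
Qed.

(** The product inherits the compact support of [phi], so the integral of its derivative vanishes.
    This makes the classical gradient a weak one. *)
Lemma integral_by_parts U (i : 'I_n) phi (psi : 'rV[R]_n -> R) :
  test_fun U phi -> smooth psi ->
  \int[mu]_x (phi x * partial i psi x) = - \int[mu]_x (partial i phi x * psi x).
Proof.
move=> tphi spsi; have sphi : smooth phi by case: tphi.
have Cphi := test_fun_Cc tphi.
have cpsi := smooth_continuous spsi.
have C1 : Cc (fun x => phi x * partial i psi x).
  under eq_fun do rewrite mulrC.
  by apply: CcM => //; exact: smooth_continuous (smooth_partial _ spsi).
have C2 : Cc (fun x => partial i phi x * psi x).
  under eq_fun do rewrite mulrC.
  by apply: CcM => //; exact: test_fun_partial_Cc tphi.
have D x : is_derive x (delta_mx ord0 i) (fun x => phi x * psi x)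
    (phi x * partial i psi x + partial i phi x * psi x).
  have := is_deriveM (smooth_is_derive i x sphi) (smooth_is_derive i x spsi).
  by rewrite /GRing.scale /= [psi x * _]mulrC.
have E : partial i (fun x => phi x * psi x) =
    (fun x => phi x * partial i psi x + partial i phi x * psi x).
  by apply/funext => x; case: (D x).
have := @integral_partial_Cc R n i (fun x => phi x * psi x).
rewrite E => /(_ _ _ _)/(congr1 fine) /= H.
apply/eqP; rewrite -addr_eq0 -RintegralD//; last 2 first.
- exact: Cc_integrable.
- exact: Cc_integrable.
apply/eqP; apply: H.
- under eq_fun do rewrite mulrC.
  exact: CcM.
- by move=> x; case: (D x).
- have [c1 _] := C1; have [c2 _] := C2 => x.
  by apply: (@continuousD _ _ _ (fun x => phi x * partial i psi x)); [exact: c1|exact: c2].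
Qed.

End test_functions.

Lemma test_fun_sub (R : realType) n (U U' : set 'rV[R]_n) f :
  U `<=` U' -> test_fun U f -> test_fun U' f.
Proof. by move=> UU' [sf cf fU]; split=> // x /fU /UU'. Qed.

(** * Reduction of Rayleigh quotients to test functions *)

Section rayleigh_test_functions.
Context {R : realType} {n : nat}.
Variables (p : R) (F : 'rV[R]_n -> R).
Hypotheses (p1 : 1 < p) (gF : gauge F).
Implicit Types (U : set 'rV[R]_n) (phi : 'rV[R]_n -> R).

Local Notation mu := (lebesgue_rV R n).
Local Notation N f := ('N[mu]_p%:E[EFin \o f])%E.

Let p0 : 0 < p. Proof. exact: lt_trans p1. Qed.
Let F0 : forall x, 0 <= F x. Proof. by case: gF. Qed.

(** Integrals over the whole space: for a test function on [U] they agree with those over [U], so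
    functions on different domains can be compared directly. *)
Definition energy phi : R := \int[mu]_x (F (grad phi x) `^ p).
Definition mass phi : R := \int[mu]_x (`|phi x| `^ p).

Lemma Cc_gauge_grad U phi : test_fun U phi -> Cc (fun x => F (grad phi x)).
Proof.
move=> tphi; split.
  have cg : continuous (grad phi).
    apply: rV_continuousP => i; under eq_fun do rewrite mxE.
    by have [] := test_fun_partial_Cc i tphi.
  move=> x; apply: (@continuous_comp _ _ _ (grad phi) F); first exact: cg.
  exact: gauge_continuous.
have M_ i : exists M, forall x, M < `|x| -> partial i phi x = 0.
  by have [] := test_fun_partial_Cc i tphi.
have [M HM] := choice M_.
exists (\sum_i `|M i|) => x Mx.
rewrite (_ : grad phi x = 0) ?gauge0//.
apply/rowP => i; rewrite !mxE HM//; apply: le_lt_trans Mx.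
by rewrite (le_trans (ler_norm _))// (bigD1 i)//= lerDl sumr_ge0.
Qed.

Lemma energy_integrable U phi : test_fun U phi ->
  mu.-integrable setT (fun x => (F (grad phi x) `^ p)%:E).
Proof.
move=> tphi; have := Cc_powR_integrable p0 (Cc_gauge_grad tphi).
by under eq_fun do rewrite ger0_norm//.
Qed.

Lemma energy_EFin U phi : test_fun U phi ->
  (energy phi)%:E = (\int[mu]_x (F (grad phi x) `^ p)%:E)%E.
Proof.
move=> /energy_integrable/integrable_fin_num => /(_ measurableT) H.
by rewrite /energy /Rintegral fineK.
Qed.

Lemma mass_EFin U phi : test_fun U phi ->
  (mass phi)%:E = (\int[mu]_x (`|phi x| `^ p)%:E)%E.
Proof.
move=> /test_fun_Cc/(Cc_powR_integrable p0)/integrable_fin_num => /(_ measurableT) H.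
by rewrite /mass /Rintegral fineK.
Qed.

Lemma energy_ge0 phi : 0 <= energy phi.
Proof. by apply: Rintegral_ge0 => x _; exact: powR_ge0. Qed.

Lemma mass_ge0 phi : 0 <= mass phi.
Proof. by apply: Rintegral_ge0 => x _; exact: powR_ge0. Qed.

Lemma mass_gt0 U phi x : test_fun U phi -> phi x != 0 -> 0 < mass phi.
Proof.
move=> tphi phix; rewrite lt_neqAle mass_ge0 andbT eq_sym; apply/eqP => m0.
have cphi : continuous phi by case: (test_fun_Cc tphi).
apply: (continuous_not_ae0 cphi phix).
have mphi := continuous_measurable_rV cphi.
have : (\int[mu]_x `|(`|phi x| `^ p)%:E| = 0)%E.
  transitivity ((mass phi)%:E); last by rewrite m0.
  rewrite (mass_EFin tphi); apply: eq_integral => x' _.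
  by rewrite gee0_abs ?lee_fin ?powR_ge0.
move/(ae_eq_integral_abs mu measurableT (measurable_powR_norm p mphi)).
apply: filterS => y /= /(_ I) [] /eqP.
by rewrite powR_eq0 normr_eq0 => /andP[/eqP].
Qed.

(** The function itself is the constant approximating sequence, and its classical gradient is the
    weak one. *)
Lemma rayleigh_test U phi x : test_fun U phi -> phi x != 0 ->
  rayleigh p U F (energy phi / mass phi).
Proof.
move=> tphi phix; exists phi, (grad phi).
have Lz (f : 'rV[R]_n -> R) : Cc f -> f \_ U = f -> Lp p U f.
  by move=> Cf fU; rewrite /Lp fU; exact: Cc_Lfun.
have gi i : (fun x => grad phi x ord0 i) = partial i phi.
  by apply/funext => y; rewrite mxE.
have N0 (f : 'rV[R]_n -> R) : Lp_norm p U (fun x => f x - f x) = 0%E.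
  rewrite /Lp_norm (_ : EFin \o _ = cst 0%E) ?Lnorm0 ?eqe ?gt_eqF//.
  by apply/funext => y; rewrite /= patchE subrr; case: ifP.
split.
- split.
    split.
    + by apply: Lz; [exact: test_fun_Cc tphi|exact: test_fun_patch].
    + move=> i; rewrite gi; apply: Lz; first exact: test_fun_partial_Cc tphi.
      exact: test_fun_partial_patch.
    + move=> i psi tpsi.
      rewrite Rintegral_mkcond [in RHS]Rintegral_mkcond.
      transitivity (\int[mu]_x (phi x * partial i psi x)).
        apply: eq_Rintegral => y _; rewrite patchE; case: ifPn => //.
        by rewrite notin_setE => Uy; rewrite (test_fun_out tphi)// mul0r.
      rewrite (integral_by_parts i tphi); last by case: tpsi.
      congr (- _); apply: eq_Rintegral => y _; rewrite patchE mxE; case: ifPn => //.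
      by rewrite notin_setE => Uy; rewrite (test_fun_out tpsi)// mulr0.
  exists (fun=> phi); split=> [//| |i].
    by rewrite N0; exact: cvg_cst.
  rewrite (_ : (fun x => _) = (fun x => partial i phi x - partial i phi x)).
    by rewrite N0; exact: cvg_cst.
  by apply/funext => y; rewrite mxE.
- have cphi : continuous phi by case: (test_fun_Cc tphi).
  move=> ae0; apply: (continuous_not_ae0 cphi phix).
  apply: filterS ae0 => y Hy; have [/Hy//|Uy] := pselect (U y).
  exact: test_fun_out tphi Uy.
- congr (_ / _); rewrite [RHS]Rintegral_mkcond; apply: eq_Rintegral => y _.
    rewrite patchE; case: ifPn => //; rewrite notin_setE => Uy.
    rewrite (_ : grad phi y = 0) ?gauge0// ?powR0 ?gt_eqF//.
    by apply/rowP => i; rewrite !mxE (test_fun_partial_out _ tphi).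
  rewrite patchE; case: ifPn => //; rewrite notin_setE => Uy.
  by rewrite (test_fun_out tphi)// normr0 powR0 ?gt_eqF.
Qed.

Lemma rayleigh_ge0 U r : rayleigh p U F r -> 0 <= r.
Proof.
by move=> [v [g [_ _ ->]]]; rewrite divr_ge0// Rintegral_ge0// => x _; exact: powR_ge0.
Qed.

Lemma eigen1_le U phi x : test_fun U phi -> phi x != 0 ->
  eigen1 p U F <= energy phi / mass phi.
Proof.
move=> tphi phix; apply: ge_inf; last exact: rayleigh_test phix.
by exists 0 => r; exact: rayleigh_ge0.
Qed.

(** With [a] and [b] the [L^p] norms of [F g] and [v], and [K^p = r + eps], the strict inequality
    [a < K b] leaves room for a small error in both norms, which the approximating sequence of [v]
    provides. *)
Lemma rayleigh_approx U r eps : rayleigh p U F r -> 0 < eps ->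
  exists phi, [/\ test_fun U phi, exists x, phi x != 0 &
    energy phi <= (r + eps) * mass phi].
Proof.
move=> [v [g [[[Lv Lg _] [phi [tphi cv cg]]] vn0 rE]]] eps0.
pose V := v \_ U.
pose G x := if x \in U then g x else 0.
have GE i : (fun x => g x ord0 i) \_ U = (fun x => G x ord0 i).
  by apply/funext => x; rewrite patchE /G; case: ifP => // _; rewrite mxE.
have mV : measurable_fun setT V by exact: set_mem (sub_Lfun_mfun Lv).
have mG i : measurable_fun setT (fun x => G x ord0 i).
  by have := set_mem (sub_Lfun_mfun (Lg i)); rewrite GE.
have NV : (N V < +oo)%E by exact: set_mem (sub_Lfun_finLfun Lv).
have NG i : (N (fun x => G x ord0 i) < +oo)%E.
  by have := set_mem (sub_Lfun_finLfun (Lg i)); rewrite GE.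
pose FG x := F (G x).
have mFG : measurable_fun setT FG by exact: gauge_measurable_comp.
have NFG : (N FG < +oo)%E.
  apply: le_lt_trans (gauge_Lnorm_le gF p1 mu mG) _.
  by apply: lte_sum_pinfty => i _; rewrite lte_mul_pinfty ?lee_fin.
pose a := fine (N FG); pose b := fine (N V).
have aE : N FG = a%:E by rewrite fineK// ge0_fin_numE ?Lnorm_ge0.
have bE : N V = b%:E by rewrite fineK// ge0_fin_numE ?Lnorm_ge0.
have a0 : 0 <= a by rewrite fine_ge0 ?Lnorm_ge0.
have b0 : 0 < b.
  rewrite lt_neqAle fine_ge0 ?Lnorm_ge0// andbT eq_sym; apply/eqP => b0.
  apply: vn0.
  have mEV : measurable_fun setT (EFin \o V) by exact/measurable_EFinP.
  have : N V = 0%E by rewrite bE b0.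
  move=> /(Lnorm_eq0_eq0 mEV); rewrite lte_fin => /(_ p0).
  apply: filterS => x /(_ I) /= [] + Ux; rewrite /V patchE mem_set//.
have rE' : r = a `^ p / b `^ p.
  rewrite rE; congr (_ / _); rewrite Rintegral_mkcond /Rintegral -fine_poweR Lnorm_powR//.
    congr fine; apply: eq_integral => x _; rewrite patchE /FG /G; case: ifPn => _.
      by rewrite ger0_norm.
    by rewrite gauge0// normr0 powR0 ?gt_eqF.
  congr fine; apply: eq_integral => x _; rewrite patchE /V patchE; case: ifPn => _ //.
  by rewrite normr0 powR0 ?gt_eqF.
have r0 : 0 <= r by rewrite rE' divr_ge0 ?powR_ge0.
pose K := (r + eps) `^ p^-1.
have K0 : 0 < K by rewrite powR_gt0// ltr_wpDl.
have KE : K `^ p = r + eps.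
  by rewrite -powRrM mulVf ?gt_eqF// powRr1// addr_ge0// ltW.
have aKb : a < K * b.
  rewrite ltNge; apply/negP => Kba.
  have : (K * b) `^ p <= a `^ p.
    by rewrite ge0_ler_powR ?nnegrE ?mulr_ge0 ?(ltW p0) ?(ltW K0) ?(ltW b0).
  rewrite powRM ?(ltW K0) ?(ltW b0)// KE leNgt => /negP; apply.
  by rewrite -ltr_pdivrMr ?powR_gt0// -rE' ltrDl.
pose c := 1 + \sum_i F (delta_mx ord0 i).
have c0 : 0 < c by rewrite ltr_pwDl// sumr_ge0.
(* The solution of [a + c d = K (b - d)]: an error of at most [d] in the norm of [v], and of at most
   [c d] in that of the gradient, preserves the inequality. As the left side is positive, so is
   [b - d], and the approximant is not zero. *)
pose d := (K * b - a) / (K + c).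

have d0 : 0 < d by apply: divr_gt0; [rewrite subr_gt0|exact: addr_gt0].
have dE : K * (b - d) = a + c * d.
  have : d * (K + c) = K * b - a by rewrite /d divfK// gt_eqF// addr_gt0.
  by move=> H; lra.
have small (u : nat -> \bar R) : u @ \oo --> 0%E -> \forall k \near \oo, (u k < d%:E)%E.
  move=> /(_ [set x | (x < d%:E)%E]); apply.
  by apply: open_nbhs_nbhs; split; [exact: open_ereal_lt_ereal|rewrite /= lte_fin].
have : \forall k \near \oo, (Lp_norm p U (fun x => phi k x - v x)%R < d%:E)%E /\
    forall i, (Lp_norm p U (fun x => partial i (phi k) x - g x ord0 i)%R < d%:E)%E.
  near=> k; split; first by near: k; exact: small.
  by near: k; apply: filter_forall => i; exact: small.
move=> [k _ /(_ k (leqnn k))] [vk gk].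
have tk := tphi k.
exists (phi k).
have cphi : continuous (phi k) by case: (test_fun_Cc tk).
have mphi := continuous_measurable_rV cphi.
have EV : (fun x => phi k x - v x) \_ U = (fun x => phi k x - V x).
  apply/funext => x; rewrite /V !patchE; case: ifPn => //.
  by rewrite notin_setE => Ux; rewrite (test_fun_out tk)// subr0.
have EG i : (fun x => partial i (phi k) x - g x ord0 i) \_ U =
    (fun x => grad (phi k) x ord0 i - G x ord0 i).
  apply/funext => x; rewrite patchE /G mxE; case: ifPn => //.
  by rewrite notin_setE => Ux; rewrite (test_fun_partial_out _ tk)// mxE subr0.
have mgrad i : measurable_fun setT (fun x => grad (phi k) x ord0 i).
  under eq_fun do rewrite mxE.
  by apply: continuous_measurable_rV; have [] := test_fun_partial_Cc i tk.
pose al := fine (N (fun x => F (grad (phi k) x))).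
pose be := fine (N (phi k)).
have alE : N (fun x => F (grad (phi k) x)) = al%:E.
  rewrite fineK// ge0_fin_numE ?Lnorm_ge0//.
  exact: set_mem (sub_Lfun_finLfun (Cc_Lfun p1 (Cc_gauge_grad tk))).
have beE : N (phi k) = be%:E.
  rewrite fineK// ge0_fin_numE ?Lnorm_ge0//.
  exact: set_mem (sub_Lfun_finLfun (Cc_Lfun p1 (test_fun_Cc tk))).
have al0 : 0 <= al by rewrite fine_ge0 ?Lnorm_ge0.
have be0 : 0 <= be by rewrite fine_ge0 ?Lnorm_ge0.
have b_be : b <= be + d.
  rewrite -lee_fin EFinD -bE -beE.
  apply: (@le_trans _ _ (N (phi k) + N (fun x => V x - phi k x)%R)%E).
    have mB : measurable_fun setT (fun x => V x - phi k x) by exact: measurable_funB.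
    apply: le_trans (minkowski_EFin mu mphi mB (ltW p1)).
    rewrite le_eqVlt; apply/orP; left; apply/eqP; apply: eq_Lnorm => x.
    by rewrite /= addrC subrK.
  rewrite leeD2l// ltW//; move: vk; rewrite /Lp_norm EV; apply: le_lt_trans.
  rewrite le_eqVlt; apply/orP; left; apply/eqP; rewrite !LnormE; congr (_ `^ _)%E.
  by apply: eq_integral => x _; rewrite distrC.
have al_a : al <= a + c * d.
  rewrite -lee_fin EFinD -alE -aE.
  apply: (le_trans (gauge_Lnorm_lip gF p1 mu mgrad mG)).
  rewrite leeD2l// /c mulrDl mul1r mulr_suml EFinD.
  rewrite -[leLHS]add0e leeD ?lee_fin ?(ltW d0)// -sumEFin.
  apply: lee_sum => i _; rewrite EFinM lee_pmul ?lee_fin ?Lnorm_ge0//.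
  by rewrite ltW//; move: (gk i); rewrite /Lp_norm EG.
have bd0 : 0 < b - d.
  by rewrite -(pmulr_rgt0 _ K0) dE ltr_wpDl// mulr_gt0.
have al_be : al <= K * be.
  by rewrite (le_trans al_a)// -dE ler_pM2l// lerBlDr.
have massE : mass (phi k) = be `^ p.
  by apply/EFin_inj; rewrite (mass_EFin tk) -poweR_EFin -beE Lnorm_powR.
have energyE : energy (phi k) = al `^ p.
  apply/EFin_inj; rewrite (energy_EFin tk) -poweR_EFin -alE Lnorm_powR//.
  by apply: eq_integral => x _; rewrite ger0_norm.
split=> //.
- apply: contrapT => /forallNP H.
  have : be `^ p = 0.
    rewrite -massE /mass /Rintegral integral0_eq// => x _.
    by have /negP/negPn/eqP -> := H x; rewrite normr0 powR0 ?gt_eqF.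
  move/eqP; rewrite powR_eq0 => /andP[/eqP be00 _].
  by move: b_be bd0; rewrite be00; lra.
- by rewrite energyE massE -KE -powRM ?(ltW K0)// ge0_ler_powR ?nnegrE ?mulr_ge0 ?(ltW p0) ?(ltW K0).
Unshelve. all: by end_near. Qed.

End rayleigh_test_functions.

(** * Lower bound *)

Section marginal.
Context {R : realType} {m k : nat}.
Variables (p : R) (H : 'rV[R]_(m + k) -> R) (w2 : set 'rV[R]_k).
Variables (v : 'rV[R]_(m + k) -> R) (M s : R).
Hypotheses (p1 : 1 < p) (nH : C1_norm H) (M0 : 0 < M) (s0 : 0 < s).
Hypothesis tv : test_fun [set z | w2 (rsubmx z)] v.
Hypothesis vM : forall z, M < `|z| -> v z = 0.

Local Notation mu1 := (lebesgue_rV R m).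
Local Notation mu2 := (lebesgue_rV R k).
Local Notation K := (box m M).

Let p0 : 0 < p. Proof. exact: lt_trans p1. Qed.
Let pn0 : p != 0. Proof. by rewrite gt_eqF. Qed.
Let gH := C1_norm_gauge nH.
Let H0 : forall x, 0 <= H x. Proof. by case: gH. Qed.
Let HZ : forall t x, H (t *: x) = `|t| * H x. Proof. by case: gH. Qed.
Let sv : smooth v. Proof. by case: tv. Qed.

(** [th], [P] and [A] are the smooth substitutes for [v^2], [|v|^p] and [|v|^(p-2) v], so that the
    gradient of [P] is [p A] times that of [v]. *)
Let th z := v z * v z + s * s.
Let P z := th z `^ (p / 2).
Let A z := th z `^ (p / 2 - 1) * v z.
Let V := fine (mu1 K).
Let J := slice_int M P.

Lemma box_slice_out (x : 'rV[R]_m) (y : 'rV[R]_k) : M < `|x| -> v (row_mx x y) = 0.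
Proof.
move=> Mx; apply: vM; apply: (lt_le_trans Mx).
apply/rV_norm_leP => // i; have := coord_le_norm (row_mx x y) (lshift k i).
by rewrite row_mxEl.
Qed.

Lemma box_slice_out2 (x : 'rV[R]_m) (y : 'rV[R]_k) : M < `|y| -> v (row_mx x y) = 0.
Proof.
move=> My; apply: vM; apply: (lt_le_trans My).
apply/rV_norm_leP => // i; have := coord_le_norm (row_mx x y) (rshift m i).
by rewrite row_mxEr.
Qed.

Let th_gt0 z : 0 < th z.
Proof. by rewrite /th ltr_wpDl ?mulr_gt0// -expr2 sqr_ge0. Qed.

Let smooth_th : smooth th.
Proof. by apply: smoothD; [exact: smoothM|exact: smooth_cst]. Qed.

Let smooth_P : smooth P.
Proof. exact: smooth_powR. Qed.

Let partial_P i z : partial i P z = p * (A z * partial i v z).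
Proof.
rewrite /P partial_powR//.
have D : is_derive z (delta_mx ord0 i) th (v z * partial i v z + v z * partial i v z).
  have dv := smooth_is_derive i z sv.
  by have := is_deriveD (is_deriveM dv dv) (is_derive_cst (s * s) z (delta_mx ord0 i)); rewrite addr0.
have [_ E] := D; rewrite /partial E /A -/(partial i v z).
by field.
Qed.

Let V_gt0 : 0 < V.
Proof.
rewrite fine_gt0// box_fin andbT.
apply: lt_le_trans (cube_gt0 0 M0) _.
apply: le_measure; rewrite ?inE; [exact: measurable_cube|exact: measurable_box|].
by move=> x xc; apply/rV_norm_leP => [|i]; [exact: ltW|have := xc i; rewrite mxE subr0; exact: ltW].
Qed.

Let sV : 0 < s `^ p * V. Proof. by rewrite mulr_gt0// powR_gt0. Qed.

Let P_ge z : s `^ p <= P z.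
Proof.
rewrite /P (_ : s `^ p = (s * s) `^ (p / 2)); last first.
  by rewrite -expr2 -powR_mulrn ?(ltW s0)// -powRrM; congr (_ `^ _); field.
by rewrite ge0_ler_powR ?nnegrE ?divr_ge0 ?(ltW p0) ?mulr_ge0 ?(ltW s0) ?(ltW (th_gt0 _))// lerDr -expr2 sqr_ge0.
Qed.

Let P_v0 z : v z = 0 -> P z = s `^ p.
Proof.
move=> vz; rewrite /P /th vz mul0r add0r -expr2 -powR_mulrn ?(ltW s0)// -powRrM.
by congr (_ `^ _); field.
Qed.

Let P_ge_v z : `|v z| `^ p <= P z.
Proof.
rewrite /P (_ : `|v z| `^ p = (v z * v z) `^ (p / 2)); last first.
  by rewrite -expr2 -real_normK ?num_real// -powR_mulrn// -powRrM; congr (_ `^ _); field.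
by rewrite ge0_ler_powR ?nnegrE ?divr_ge0 ?(ltW p0) -?expr2 ?sqr_ge0 ?(ltW (th_gt0 _))// /th -expr2 lerDl mulr_ge0 ?(ltW s0).
Qed.

Let cst_integrable (c : R) : mu1.-integrable K (EFin \o cst c).
Proof.
apply: measurable_bounded_integrable; first exact: measurable_box.
- exact: box_fin.
- exact: measurable_cst.
- exact: bounded_cst.
Qed.

Let P_integrable y : mu1.-integrable K (EFin \o (fun x => P (row_mx x y))).
Proof. by apply: slice_integrable; exact: smooth_continuous. Qed.

Let J_ge y : s `^ p * V <= J y.
Proof.
rewrite -(Rintegral_cst mu1 (measurable_box m M)).
exact: (le_Rintegral (measurable_box m M) (cst_integrable _) (P_integrable y)) => x _.
Qed.

Let J_gt0 y : 0 < J y. Proof. exact: lt_le_trans (J_ge y). Qed.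

Let J_v0 y : (forall x, v (row_mx x y) = 0) -> J y = s `^ p * V.
Proof.
move=> vy; rewrite -(Rintegral_cst mu1 (measurable_box m M)).
by apply: eq_Rintegral => x _; exact: P_v0.
Qed.

(* For [s = 0] this would be the [L^p] norm of the slice of [v] at [y]; the
   subtracted constant makes it vanish wherever the slice does. *)
Definition marginal (y : 'rV[R]_k) : R := J y `^ p^-1 - (s `^ p * V) `^ p^-1.

Let smooth_J : smooth J. Proof. exact: smooth_slice_int. Qed.

Lemma marginal_ge0 y : 0 <= marginal y.
Proof.
by rewrite subr_ge0 ge0_ler_powR ?nnegrE ?invr_ge0 ?(ltW p0) ?(ltW (J_gt0 _)) ?(ltW sV).
Qed.

(** The support lies in the projection of the support of [v], a compact subset of [w2]: off it the
    slice of [v] is zero and the subtracted constant cancels the root. The root is smooth because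
    [J] stays above a positive constant. *)
Lemma test_fun_marginal : test_fun w2 marginal.
Proof.
apply: (@test_funI _ _ w2 (@rsubmx R 1 m k @` fsupport v)).
- apply: smoothD; last exact: smooth_cst.
  exact: smooth_powR.
- apply: continuous_compact; last by case: tv.
  by apply: continuous_subspaceT; exact: continuous_rsubmx.
- by move=> _ [z zv <-]; case: tv => _ _; apply.
- move=> y /eqP wy; apply: contrapT => Hy; apply: wy.
  have vy x : v (row_mx x y) = 0.
    apply: contrapT => /eqP vxy; apply: Hy; exists (row_mx x y); last exact: row_mxKr.
    exact: mem_fsupport.
  by rewrite /marginal J_v0// subrr.
Qed.

(* [p * Z i] is the slice integral of [partial i P]; for [i < m] it is the
   integral of a derivative, whence [Z_lshift]. *)
Let Z i y := slice_int M (fun z => A z * partial i v z) y.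

Let cA : continuous A.
Proof.
move=> z; apply: (@continuousM _ _ (fun z => th z `^ (p / 2 - 1)) v).
  by apply: smooth_continuous; exact: smooth_powR.
exact: smooth_continuous.
Qed.

Let cAv i : continuous (fun z => A z * partial i v z).
Proof.
have cp := smooth_continuous (smooth_partial i sv).
by move=> z; apply: (@continuousM _ _ A (partial i v)); [exact: cA|exact: cp].
Qed.

Let slice_partial_P i y : slice_int M (partial i P) y = p * Z i y.
Proof.
rewrite /slice_int; under eq_Rintegral do rewrite partial_P.
by rewrite RintegralZl//; [exact: measurable_box|exact: slice_integrable (@cAv i)].
Qed.

Let partial_marginal j y : partial j marginal y = J y `^ (p^-1 - 1) * Z (rshift m j) y.
Proof.
have D1 : is_derive y (delta_mx ord0 j) (fun y => J y `^ p^-1)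
    (p^-1 * J y `^ (p^-1 - 1) * partial j J y).
  exact: (is_derive_comp1 (smooth_is_derive j y smooth_J) (is_derive1_powR p^-1 (J_gt0 y))).
have D2 : is_derive y (delta_mx ord0 j) marginal (p^-1 * J y `^ (p^-1 - 1) * partial j J y).
  by have := is_deriveD D1 (is_derive_cst (- (s `^ p * V) `^ p^-1) y (delta_mx ord0 j)); rewrite addr0.
have [_ E] := is_derive_slice_int M j y smooth_P.
have [_ E2] := D2.
by rewrite {1}/partial E2 /partial -/J E slice_partial_P; field.
Qed.

Let Z_lshift i y : Z (lshift k i) y = 0.
Proof.
apply: (mulfI pn0); rewrite mulr0 -slice_partial_P /slice_int Rintegral_mkcond.
(* Outside the box [P] equals [s^p]; subtracting it gives compact support without changing the
   derivatives. *)
pose f (x : 'rV[R]_m) := P (row_mx x y) - s `^ p.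
have cf : continuous f.
  move=> x; apply: (@continuousB _ _ _ (fun x : 'rV[R]_m => P (row_mx x y)) (cst (s `^ p))).
    by apply: continuous_slice; exact: smooth_continuous.
  exact: cst_continuous.
have Cf : Cc f.
  by split=> //; exists M => x Mx; rewrite /f P_v0 ?subrr// box_slice_out.
have D x : is_derive x (delta_mx ord0 i) f (partial (lshift k i) P (row_mx x y)).
  have D1 : is_derive x (delta_mx ord0 i) (fun x => P (row_mx x y)) (partial (lshift k i) P (row_mx x y)).
    by apply: is_derive_row_mxl; exact: smooth_is_derive.
  by have := is_deriveD D1 (is_derive_cst (- s `^ p) x (delta_mx ord0 i)); rewrite addr0.
have E : partial i f = fun x => partial (lshift k i) P (row_mx x y).
  by apply/funext => x; case: (D x).
have cpf : continuous (partial i f).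
  have cp := smooth_continuous (smooth_partial (lshift k i) smooth_P).
  by rewrite E; exact: continuous_slice.
have df x : derivable f x (delta_mx ord0 i) by case: (D x).
have := integral_partial_Cc Cf df cpf => /(congr1 fine) /= <-.
rewrite /Rintegral; congr fine; apply: eq_integral => x _; rewrite E patchE; case: ifPn => //.
rewrite notin_setE /= => /negP; rewrite -ltNge => Mx.
by rewrite partial_P /A box_slice_out// mulr0 mul0r mulr0.
Qed.

Let h z := H (grad v z).

Let Ch : Cc h. Proof. exact: Cc_gauge_grad tv. Qed.

Let ch : continuous h. Proof. by case: Ch. Qed.

Let A_le z : `|A z| <= th z `^ ((p - 1) / 2).
Proof.
rewrite /A normrM ger0_norm ?powR_ge0//.
have va : `|v z| <= th z `^ 2^-1.
  rewrite (_ : `|v z| = (v z * v z) `^ 2^-1); last first.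
    by rewrite -expr2 -real_normK ?num_real// -powR_mulrn// -powRrM mulfV// powRr1.
  rewrite ge0_ler_powR ?nnegrE ?invr_ge0 ?(ltW (th_gt0 _))// -?expr2 ?sqr_ge0//.
  by rewrite /th -expr2 lerDl mulr_ge0 ?(ltW s0).
apply: (le_trans (ler_wpM2l (powR_ge0 _ _) va)).
rewrite -powRD; last by apply/implyP => _; rewrite gt_eqF.
by rewrite le_eqVlt; apply/orP; left; apply/eqP; congr (_ `^ _); field.
Qed.

Let g z := th z `^ ((p - 1) / 2) * h z.

Let cg : continuous g.
Proof.
move=> z; apply: (@continuousM _ _ (fun z => th z `^ ((p - 1) / 2)) h); last exact: ch.
by apply: smooth_continuous; exact: smooth_powR.
Qed.

Let S1 := slice_int M g.

Let S1_ge0 y : 0 <= S1 y.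
Proof. by apply: Rintegral_ge0 => x _; apply: mulr_ge0; [exact: powR_ge0|exact: H0]. Qed.

(** Jensen's inequality for the norm [H]: the functional [grad H] at the averaged vector attains [H]
    there, and under the integral sign it is at most [H]. *)
Let H_Z_le y : H (\row_i Z i y) <= S1 y.
Proof.
have [->|Zn0] := eqVneq (\row_i Z i y) 0; first by rewrite gauge0.
rewrite -(dotr_grad_self nH Zn0); set G := grad H _.
have intA i : mu1.-integrable K (EFin \o (fun x => A (row_mx x y) * partial i v (row_mx x y))).
  exact: slice_integrable (@cAv i).
have intGA i : mu1.-integrable K
    (EFin \o (fun x => G ord0 i * (A (row_mx x y) * partial i v (row_mx x y)))).
  rewrite (_ : EFin \o _ = (fun x => (G ord0 i)%:E *
    (A (row_mx x y) * partial i v (row_mx x y))%:E)%E)//.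
  by apply: integrableZl; [exact: measurable_box|exact: intA].
have [intS SE] := Rintegral_sum (index_enum 'I_(m + k)) (measurable_box m M) intGA.
rewrite (_ : dotr G _ = \int[mu1]_(x in K) \sum_i (G ord0 i * (A (row_mx x y) * partial i v (row_mx x y)))); last first.
  rewrite SE; apply: eq_bigr => i _; rewrite mxE RintegralZl//.
  exact: measurable_box.
apply: le_Rintegral => //; first exact: measurable_box.
  exact: slice_integrable.
move=> x _; rewrite (_ : \sum_i _ = dotr G (A (row_mx x y) *: grad v (row_mx x y))); last first.
  by apply: eq_bigr => i _; rewrite !mxE.
apply: (le_trans (dotr_grad_le nH _ Zn0)); rewrite HZ.
by rewrite ler_wpM2r.
Qed.

(** The first block of [Z] vanishes, so the gradient of [marginal], completed by zeros, is a
    multiple of the whole vector [Z]. *)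
Let H_grad_marginal y :
  H (row_mx 0 (grad marginal y)) <= J y `^ (p^-1 - 1) * S1 y.
Proof.
rewrite (_ : row_mx 0 _ = J y `^ (p^-1 - 1) *: (\row_i Z i y)).
  by rewrite HZ ger0_norm ?powR_ge0// ler_wpM2l ?powR_ge0.
apply/rowP => i; rewrite !mxE; case: (fintype.splitP i) => j ij.
  by rewrite mxE (_ : i = lshift k j) ?Z_lshift ?mulr0//; exact/val_inj.
by rewrite mxE partial_marginal (_ : i = rshift m j)//; exact/val_inj.
Qed.

Let hp_integrable y : mu1.-integrable setT (fun x => (h (row_mx x y) `^ p)%:E).
Proof.
have Chy : Cc (fun x => h (row_mx x y)).
  split; first exact: continuous_slice.
  have [_ [M' hM']] := Ch; exists M' => x Mx; apply: hM'; apply: (lt_le_trans Mx).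
  apply/rV_norm_leP => // i; have := coord_le_norm (row_mx x y) (lshift k i).
  by rewrite row_mxEl.
have := Cc_powR_integrable p0 Chy.
by under eq_fun do rewrite (ger0_norm (H0 _)).
Qed.

(* Jensen's inequality for [t `^ p] and the weight [P], via [powR_tangent]. *)
Let energy_slice y :
  H (row_mx 0 (grad marginal y)) `^ p <= \int[mu1]_x (h (row_mx x y) `^ p).
Proof.
(* The average of [h / sqrt th] for the weight [P], since [P = th^(p/2)] and the integrand of [S1]
   is [th^((p-1)/2) h]. *)
pose X := S1 y / J y.
have X0 : 0 <= X by rewrite divr_ge0// ltW.
have ihK : mu1.-integrable K (EFin \o (fun x => h (row_mx x y) `^ p)).
  exact: (integrableS measurableT (measurable_box m M) (@subsetT _ _) (hp_integrable y)).
have step1 : H (row_mx 0 (grad marginal y)) `^ p <= J y * X `^ p.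
  apply: (@le_trans _ _ ((J y `^ (p^-1 - 1) * S1 y) `^ p)).
    by rewrite ge0_ler_powR ?nnegrE ?(ltW p0) ?mulr_ge0 ?powR_ge0.
  rewrite (_ : J y `^ (p^-1 - 1) * S1 y = J y `^ p^-1 * X).
    rewrite powRM ?powR_ge0// -powRrM mulVf// powRr1// ltW//.
  rewrite powRB; last by apply/implyP => _; rewrite gt_eqF.
  by rewrite powRr1 ?(ltW (J_gt0 _))// /X mulrAC mulrA.
apply: (le_trans step1).
apply: (@le_trans _ _ (\int[mu1]_(x in K) (h (row_mx x y) `^ p))); last first.
  rewrite /Rintegral fine_le//.
  - exact: (integrable_fin_num (measurable_box m M) ihK).
  - exact: (integrable_fin_num measurableT (hp_integrable y)).
  apply: ge0_subset_integral => //; first exact: measurable_box.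
    by have /integrableP[] := hp_integrable y.
  by move=> x _; rewrite lee_fin powR_ge0.
have iP := P_integrable y.
have ig : mu1.-integrable K (EFin \o (fun x => g (row_mx x y))).
  exact: slice_integrable.
(* The tangent to [t^p] at [X sqrt th], evaluated at [h], equals [c1 P + c2 g]; by the choice of [X]
   its slice integral is [J * X^p]. *)
pose c1 := X `^ p - p * X `^ (p - 1) * X.
pose c2 := p * X `^ (p - 1).
have i1 : mu1.-integrable K (EFin \o (fun x => c1 * P (row_mx x y))).
  rewrite (_ : EFin \o _ = (fun x => c1%:E * (P (row_mx x y))%:E)%E)//.
  by apply: integrableZl; [exact: measurable_box|exact: iP].
have i2 : mu1.-integrable K (EFin \o (fun x => c2 * g (row_mx x y))).
  rewrite (_ : EFin \o _ = (fun x => c2%:E * (g (row_mx x y))%:E)%E)//.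
  by apply: integrableZl; [exact: measurable_box|exact: ig].
have -> : J y * X `^ p = \int[mu1]_(x in K) (c1 * P (row_mx x y) + c2 * g (row_mx x y)).
  rewrite RintegralD//; last exact: measurable_box.
  rewrite !RintegralZl//; [|exact: measurable_box|exact: measurable_box].
  rewrite -/(slice_int M P y) -/(slice_int M g y) -/J -/S1.
  have -> : S1 y = X * J y by rewrite /X divfK// gt_eqF.
  by rewrite /c1 /c2; ring.
apply: le_Rintegral => //; first exact: measurable_box.
  rewrite (_ : EFin \o _ = (fun x => (c1 * P (row_mx x y))%:E + (c2 * g (row_mx x y))%:E)%E)//.
  by apply: integrableD; [exact: measurable_box|exact: i1|exact: i2].
move=> x _; set z := row_mx x y; set a := th z `^ 2^-1.
have a0 : 0 <= a by exact: powR_ge0.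
have aP : P z = a `^ p by rewrite /P /a -powRrM mulrC.
have ag : g z = a `^ (p - 1) * h z by rewrite /g /a -powRrM (mulrC 2^-1).
apply: le_trans (powR_tangent p1 (mulr_ge0 a0 X0) (H0 (grad v z))).
rewrite -/(h z) aP ag /c1 /c2 !(@powRM _ a X _ a0 X0).
rewrite -(mulr_powRB1 a0 p0) -(mulr_powRB1 X0 p0).
by rewrite le_eqVlt; apply/orP; left; apply/eqP; ring.
Qed.

Lemma energy_marginal :
  energy p (fun z : 'rV[R]_k => H (row_mx 0 z)) marginal <= energy p H v.
Proof.
have gH' := gauge_row_mx0 gH.
rewrite -lee_fin (energy_EFin p1 gH' test_fun_marginal) (energy_EFin p1 gH tv).
have mh : measurable_fun setT (fun z => (h z `^ p)%:E).
  by have /integrableP[] := energy_integrable p1 gH tv.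
have mhr : measurable_fun setT (fun z : 'rV[R]_m * 'rV[R]_k => (h (row_mx z.1 z.2) `^ p)%:E).
  exact: (measurableT_comp mh (@measurable_row_mx R m k)).
rewrite [leRHS]ge0_integral_row_mx_swap//; last by move=> z; rewrite lee_fin powR_ge0.
apply: ge0_le_integral => //.
- by move=> y _; rewrite lee_fin powR_ge0.
- by have /integrableP[] := energy_integrable p1 gH' test_fun_marginal.
- apply: (@measurable_fun_fubini_tonelli_G _ _ _ _ R mu1 _ mhr) => z.
  by rewrite lee_fin powR_ge0.
- move=> y _; apply: (@le_trans _ _ (\int[mu1]_x (h (row_mx x y) `^ p))%:E).
    by rewrite lee_fin; exact: energy_slice.
  by rewrite /Rintegral fineK//; exact: (integrable_fin_num measurableT (hp_integrable y)).
Qed.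

Section mass.
Variable B : R.
Hypothesis vB : forall z, `|v z| <= B.

Let B0 : 0 <= B. Proof. by apply: le_trans (vB 0). Qed.

Let V2 := fine (mu2 (box k M)).

Let Np y := \int[mu1]_x (`|v (row_mx x y)| `^ p).

Let Cv_slice y : Cc (fun x => v (row_mx x y)).
Proof.
split; last by exists M => x; exact: box_slice_out.
by apply: continuous_slice; exact: smooth_continuous.
Qed.

Let vp_integrable y : mu1.-integrable setT (fun x => (`|v (row_mx x y)| `^ p)%:E).
Proof. exact: Cc_powR_integrable. Qed.

Let vp_integrableK y : mu1.-integrable K (fun x => (`|v (row_mx x y)| `^ p)%:E).
Proof.
exact: (integrableS measurableT (measurable_box m M) (@subsetT _ _) (vp_integrable y)).
Qed.

Let NpE y : Np y = \int[mu1]_(x in K) (`|v (row_mx x y)| `^ p).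
Proof.
rewrite [RHS]Rintegral_mkcond; apply: eq_Rintegral => x _.
rewrite patchE; case: ifPn => //; rewrite notin_setE /= => /negP; rewrite -ltNge => Mx.
by rewrite box_slice_out// normr0 powR0.
Qed.

Let Np_ge0 y : 0 <= Np y.
Proof. by apply: Rintegral_ge0 => x _; exact: powR_ge0. Qed.

Let Np_le_J y : Np y <= J y.
Proof.
by rewrite NpE; apply: le_Rintegral (measurable_box m M) (vp_integrableK y) (P_integrable y) _.
Qed.

Let Np_le_B y : Np y <= B `^ p * V.
Proof.
rewrite NpE -(Rintegral_cst mu1 (measurable_box m M)).
apply: le_Rintegral (measurable_box m M) (vp_integrableK y) (cst_integrable _) _ => x _.
by rewrite ge0_ler_powR ?nnegrE ?(ltW p0).
Qed.

(** Bounds [p n^(p-1) V^(1/p)] for the [L^p] norm [n] of any slice of [v]. It depends neither on the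
    slice nor on [s]. *)
Let Q := p * (B `^ p * V) `^ (p^-1 * (p - 1)) * V `^ p^-1.

Let Q0 : 0 <= Q.
Proof. by rewrite !mulr_ge0 ?powR_ge0 ?(ltW p0). Qed.

(** Subtracting the constant lowers the norm [n] of the slice by at most [s V^(1/p)], and the
    tangent inequality at [n] turns this into a loss of [p]-th powers. *)
Let Np_le_marginal y : Np y <= marginal y `^ p + s * Q.
Proof.
set n := Np y `^ p^-1.
have n0 : 0 <= n by exact: powR_ge0.
have nE : n `^ p = Np y by rewrite -powRrM mulVf// powRr1.
have cE : (s `^ p * V) `^ p^-1 = s * V `^ p^-1.
  by rewrite powRM ?powR_ge0 ?(ltW V_gt0)// -powRrM mulfV// powRr1// ltW.
have nB : n `^ (p - 1) <= (B `^ p * V) `^ (p^-1 * (p - 1)).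
  rewrite /n -powRrM ge0_ler_powR ?nnegrE ?mulr_ge0 ?invr_ge0 ?subr_ge0 ?powR_ge0 ?(ltW p0) ?(ltW p1) ?(ltW V_gt0)//.
have nw : n - s * V `^ p^-1 <= marginal y.
  rewrite /marginal cE; apply: lerB; last exact: lexx.
  apply: ge0_ler_powR.
  - by rewrite invr_ge0 ltW.
  - by rewrite nnegrE; exact: Np_ge0.
  - by rewrite nnegrE; exact: ltW (J_gt0 y).
  - exact: Np_le_J.
have := powR_tangent p1 n0 (marginal_ge0 y); rewrite nE => T.
have sV1 : 0 <= s * V `^ p^-1 by rewrite mulr_ge0 ?powR_ge0// ltW.
have h1 : p * n `^ (p - 1) * (n - marginal y) <= p * n `^ (p - 1) * (s * V `^ p^-1).
  apply: ler_wpM2l; first by rewrite mulr_ge0 ?powR_ge0 ?(ltW p0).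
  by rewrite lerBlDr addrC -lerBlDr.
have h2 : p * n `^ (p - 1) * (s * V `^ p^-1) <= s * Q.
  rewrite [leRHS](_ : _ = p * (B `^ p * V) `^ (p^-1 * (p - 1)) * (s * V `^ p^-1)); last by rewrite /Q; ring.
  by rewrite ler_wpM2r// ler_wpM2l// ltW.
have h3 : Np y <= marginal y `^ p + p * n `^ (p - 1) * (n - marginal y).
  by rewrite -lerBlDr -mulrN opprB.
by apply: (le_trans h3); rewrite lerD2l; exact: le_trans h2.
Qed.

Lemma mass_marginal : mass p v <= mass p marginal + s * Q * V2.
Proof.
rewrite -lee_fin EFinD (mass_EFin p1 tv) (mass_EFin p1 test_fun_marginal).
have mv : measurable_fun setT (fun z => (`|v z| `^ p)%:E).
  by have /integrableP[] := Cc_powR_integrable p0 (test_fun_Cc tv).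
have mw : measurable_fun setT (fun z => (`|marginal z| `^ p)%:E).
  by have /integrableP[] := Cc_powR_integrable p0 (test_fun_Cc test_fun_marginal).
have mvr : measurable_fun setT (fun z : 'rV[R]_m * 'rV[R]_k => (`|v (row_mx z.1 z.2)| `^ p)%:E).
  exact: (measurableT_comp mv (@measurable_row_mx R m k)).
rewrite [leLHS]ge0_integral_row_mx_swap//.
(* Slices beyond the box vanish, so the constant loss is integrated over a set of finite measure
   only. *)
rewrite (_ : (fun y => (\int[mu1]_x (`|v (row_mx x y)| `^ p)%:E)%E) = (EFin \o Np) \_ (box k M)); last first.
  apply/funext => y; rewrite patchE; case: ifPn => [_|].
    by rewrite /= /Np /Rintegral fineK//; exact: (integrable_fin_num measurableT (vp_integrable y)).
  rewrite notin_setE /= => /negP; rewrite -ltNge => My.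
  by apply: integral0_eq => x _; rewrite box_slice_out2// normr0 powR0.
rewrite -integral_mkcond.
have mbk := measurable_box k M.
have mNp : measurable_fun (box k M) (EFin \o Np).
  apply: measurable_funTS.
  rewrite (_ : EFin \o Np = fubini_G mu1 (fun z => (`|v (row_mx z.1 z.2)| `^ p)%:E)); last first.
    apply/funext => y; rewrite /fubini_G /= /Np /Rintegral fineK//.
    exact: (integrable_fin_num measurableT (vp_integrable y)).
  apply: (@measurable_fun_fubini_tonelli_G _ _ _ _ R mu1 _ mvr) => z.
  by rewrite lee_fin powR_ge0.
have mwk : measurable_fun (box k M) (fun z => (`|marginal z| `^ p)%:E).
  exact: measurable_funTS.
apply: (@le_trans _ _ (\int[mu2]_(y in box k M) ((`|marginal y| `^ p)%:E + (s * Q)%:E))%E).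
  apply: ge0_le_integral => //.
  - by move=> y _; rewrite lee_fin.
  - by apply: emeasurable_funD => //; exact: measurable_cst.
  - by move=> y _; rewrite -EFinD lee_fin ger0_norm ?marginal_ge0.
rewrite ge0_integralD//; last by move=> y _; rewrite lee_fin mulr_ge0// ltW.
rewrite integral_cst// leeD//.
  apply: ge0_subset_integral => //.
rewrite [leRHS]EFinM /V2 fineK//.
by rewrite ge0_fin_numE// box_fin.
Qed.

End mass.

End marginal.

Lemma eigen1_ge0 (R : realType) n (p : R) (U : set 'rV[R]_n) F : 0 <= eigen1 p U F.
Proof.
rewrite /eigen1; have [->|/set0P U0] := eqVneq (rayleigh p U F) set0; first by rewrite inf0.
by apply: lb_le_inf => // r; exact: rayleigh_ge0.
Qed.

Section strip.
Context {R : realType} {m k : nat}.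
Variables (p : R) (H : 'rV[R]_(m + k) -> R) (w2 : set 'rV[R]_k).
Hypotheses (p1 : 1 < p) (nH : C1_norm H).

Let gH := C1_norm_gauge nH.
Let gH2 := gauge_row_mx0 gH.

(** [D] is the product of [Q] and the volume of the box in the second block. It is fixed before [s],
    so the loss of mass can be made as small as desired. *)
Lemma mass_le_marginal v : test_fun [set z | w2 (rsubmx z)] v ->
  exists2 D, 0 <= D & forall s, 0 < s -> exists u,
  [/\ test_fun w2 u, energy p (fun z => H (row_mx 0 z)) u <= energy p H v &
      mass p v <= mass p u + s * D].
Proof.
move=> tv; have Cv := test_fun_Cc tv; have [B vB] := Cc_bounded Cv.
have [_ [M0 vM0]] := Cv.
pose M := `|M0| + 1.
have M_gt0 : 0 < M by rewrite /M ltr_wpDl.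
have vM z : M < `|z| -> v z = 0.
  move=> Mz; apply: vM0; apply: le_lt_trans Mz.
  by rewrite (le_trans (ler_norm _))// lerDl.
exists (p * (B `^ p * fine (lebesgue_rV R m (box m M))) `^ (p^-1 * (p - 1)) *
  fine (lebesgue_rV R m (box m M)) `^ p^-1 * fine (lebesgue_rV R k (box k M))).
  by rewrite !mulr_ge0 ?powR_ge0 ?fine_ge0// ltW// (lt_trans _ p1).
move=> s s0; exists (marginal p v M s); split.
- exact: (test_fun_marginal p1 M_gt0 s0 tv).
- exact: (energy_marginal p1 nH M_gt0 s0 tv vM).
- by have := mass_marginal p1 M_gt0 s0 tv vM vB; rewrite -(mulrA s).
Qed.

Lemma mu_oo_mass_le v : test_fun [set z | w2 (rsubmx z)] v ->
  mu_oo p H w2 * mass p v <= energy p H v.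
Proof.
move=> tv; have [D D0 vD] := mass_le_marginal tv.
set lam := mu_oo p H w2.
have lam0 : 0 <= lam by exact: eigen1_ge0.
apply/ler_addgt0Pr => e e0.
have c0 : 0 < 1 + lam * D by rewrite ltr_pwDl// mulr_ge0.
(* This [s] makes [lam * s * D] at most [e]; the [1] avoids a zero denominator. *)
have [u [tu Eu Mu]] := vD (e / (1 + lam * D)) (divr_gt0 e0 c0).
apply: (le_trans (ler_wpM2l lam0 Mu)); rewrite mulrDr; apply: lerD.
  have [[y uy]|nu] := pselect (exists y, u y != 0).
    apply: le_trans Eu; rewrite -ler_pdivlMr; last exact: (mass_gt0 p1 tu uy).
    exact: (eigen1_le p1 gH2 tu uy).
  rewrite (_ : mass p u = 0) ?mulr0 ?energy_ge0//.
  rewrite /mass; under eq_Rintegral => y _.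
    rewrite (_ : u y = 0); last by apply/eqP/negPn/negP => uy; apply: nu; exists y.
    rewrite normr0 powR0 ?gt_eqF ?(lt_trans _ p1)//.
    over.
  by rewrite Rintegral_cst// mul0r.
rewrite mulrCA -mulrA; apply: ler_piMr; first exact: ltW.
by rewrite mulrC ler_pdivrMr// mul1r lerDr.
Qed.

(** For [s] small the lost mass is less than that of [v], so the marginal cannot vanish identically.
    This settles the case of an empty set of quotients for [w2]. *)
Lemma rayleigh_strip (v : 'rV[R]_(m + k) -> R) x : test_fun [set z | w2 (rsubmx z)] v -> v x != 0 ->
  rayleigh p w2 (fun z => H (row_mx 0 z)) !=set0.
Proof.
move=> tv vx; have [D D0 vD] := mass_le_marginal tv.
have v0 : 0 < mass p v by exact: (mass_gt0 p1 tv vx).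
have c0 : 0 < 1 + D by rewrite ltr_pwDl.
have [u [tu _ Mu]] := vD (mass p v / (1 + D)) (divr_gt0 v0 c0).
have [[y uy]|nu] := pselect (exists y, u y != 0).
  by eexists; exact: (rayleigh_test p1 gH2 tu uy).
have m0 : mass p u = 0.
  rewrite /mass; under eq_Rintegral => y _.
    rewrite (_ : u y = 0); last by apply/eqP/negPn/negP => uy; apply: nu; exists y.
    rewrite normr0 powR0 ?gt_eqF ?(lt_trans _ p1)//.
    over.
  by rewrite Rintegral_cst// mul0r.
exfalso; move: Mu; rewrite m0 add0r leNgt => /negP; apply.
by rewrite mulrAC ltr_pdivrMr// ltr_pM2l// ltrDr.
Qed.

End strip.

(** * Upper bound *)

Lemma addr_le_of_EFin (R : realDomainType) (c a b r : R) (X Y : \bar R) :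
  0 <= c -> (0 <= X)%E -> (0 <= Y)%E -> a%:E = (c%:E * X)%E -> b%:E = (c%:E * Y)%E ->
  (X + Y <= r%:E)%E -> a + b <= c * r.
Proof.
move=> c0 X0 Y0 aE bE XYr; rewrite -lee_fin EFinD aE bE -ge0_muleDr//.
by rewrite EFinM; apply: lee_wpmul2l.
Qed.

Section tensor.
Context {R : realType} {m k : nat}.
Variables (p : R) (H : 'rV[R]_(m + k) -> R) (w1 : set 'rV[R]_m) (w2 : set 'rV[R]_k).
Variables (phi : 'rV[R]_m -> R) (w : 'rV[R]_k -> R) (r : R).
Hypotheses (p1 : 1 < p) (nH : C1_norm H).
Hypotheses (sphi : smooth phi) (phi_r : forall x, r < `|x| -> phi x = 0).
Hypothesis r_w1 : box m r `<=` w1.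
Hypothesis tw : test_fun w2 w.

Local Notation mu1 := (lebesgue_rV R m).
Local Notation mu2 := (lebesgue_rV R k).
Local Notation mu := (lebesgue_rV R (m + k)).

Let p0 : 0 < p. Proof. exact: lt_trans p1. Qed.
Let gH := C1_norm_gauge nH.
Let H0 : forall x, 0 <= H x. Proof. by case: gH. Qed.
Let HZ : forall t x, H (t *: x) = `|t| * H x. Proof. by case: gH. Qed.
Let sw : smooth w. Proof. by case: tw. Qed.

Let H1 (z : 'rV[R]_m) := H (row_mx z 0).
Let H2 (z : 'rV[R]_k) := H (row_mx 0 z).

Definition tensor (t : R) (z : 'rV[R]_(m + k)) : R := phi (t *: lsubmx z) * w (rsubmx z).

Lemma smooth_tensor t : smooth (tensor t).
Proof.
apply: smoothM; last exact: smooth_rsubmx.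
by apply: (@smooth_lsubmx _ _ _ (fun x => phi (t *: x))); exact: smooth_scale.
Qed.

Lemma test_fun_phi : test_fun w1 phi.
Proof.
apply: (@test_funI _ _ w1 (box m r)) => //; first exact: compact_box.
by move=> x /eqP phix /=; rewrite leNgt; apply/negP => /phi_r.
Qed.

(** Only [|t|] is prescribed, so the functions for [1 / l] and [- 1 / l] are both admissible on the
    same cylinder. *)
Lemma test_fun_tensor l t : 0 < l -> `|t| = l^-1 ->
  test_fun (cylinder w1 w2 l) (tensor t).
Proof.
move=> l0 tl.
have tn0 : 0 < `|t| by rewrite tl invr_gt0.
pose K := [set z : 'rV[R]_(m + k) | `|lsubmx z| <= r * l /\ fsupport w (rsubmx z)].
apply: (@test_funI _ _ _ K).
- exact: smooth_tensor.
- apply: bounded_closed_compact.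
    have [_ cw _] := tw; have [M [_ HM]] := compact_bounded cw.
    exists (Num.max (r * l) (M + 1)); split; first exact: num_real.
    move=> B; rewrite gt_max => /andP[rB MB] z [zl zr].
    have B0 : 0 <= B by apply: le_trans (ltW rB); exact: le_trans zl.
    have zrB : `|rsubmx z| <= B.
      have MM1 : M < M + 1 by rewrite ltrDl.
      by apply: le_trans (ltW MB); exact: (HM _ MM1).
    apply/(rV_norm_leP z B0) => i; rewrite -[z]hsubmxK mxE; case: fintype.split => j.
      by apply: le_trans (coord_le_norm _ _) _; apply: (le_trans zl); exact: ltW.
    exact: le_trans (coord_le_norm _ _) zrB.
  rewrite (_ : K = (fun z => `|lsubmx z|) @^-1` [set y | y <= r * l] `&` (@rsubmx R 1 m k) @^-1` fsupport w)//.
  apply: closedI.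
    apply: closed_comp => [z _|]; last exact: closed_le.
    apply: (@continuous_comp _ _ _ (@lsubmx R 1 m k) (fun x => `|x|)).
      exact: continuous_lsubmx.
    exact: norm_continuous.
  apply: closed_comp => [z _|]; last exact: closed_closure.
  exact: continuous_rsubmx.
- move=> z [zl zr]; split; last by case: tw => _ _; exact.
  exists (l^-1 *: lsubmx z); last by rewrite scalerA mulfV ?gt_eqF// scale1r.
  apply: r_w1; rewrite /= normrZ ger0_norm ?invr_ge0 ?(ltW l0)//.
  by rewrite mulrC ler_pdivrMr.
- move=> z; rewrite /tensor mulf_eq0 negb_or => /andP[/eqP z1 z2]; split; last exact: mem_fsupport.
  rewrite leNgt; apply/negP => rl; apply: z1; apply: phi_r.
  by rewrite normrZ tl mulrC ltr_pdivlMr.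
Qed.

(** [a] and [b] are the two blocks of the gradient of [phi] times [w], in rescaled variables:
    differentiating the cut-off brings out one factor [t], so that the gradient of [tensor t] is
    [b + t a]. *)
Let a (z : 'rV[R]_(m + k)) : 'rV[R]_(m + k) :=
  row_mx (w (rsubmx z) *: grad phi (lsubmx z)) 0.
Let b (z : 'rV[R]_(m + k)) : 'rV[R]_(m + k) :=
  row_mx 0 (phi (lsubmx z) *: grad w (rsubmx z)).

Lemma grad_tensor t z : grad (tensor t) z =
  b (row_mx (t *: lsubmx z) (rsubmx z)) + t *: a (row_mx (t *: lsubmx z) (rsubmx z)).
Proof.
rewrite /a /b row_mxKl row_mxKr scale_row_mx scaler0 add_row_mx add0r addr0.
have sphit : smooth (fun x => phi (t *: x)) by exact: smooth_scale.
have D i := is_deriveM (is_derive_lsubmx z i sphit) (is_derive_rsubmx z i sw).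
apply/rowP => i; rewrite !mxE; have [_ E] := D i; rewrite {1}/partial E.
case: fintype.split => j; rewrite /GRing.scale /= !mxE ?mulr0 ?addr0 ?add0r.
  rewrite mulrCA; congr (_ * _).
  have [_ <-] : is_derive (lsubmx z) (delta_mx ord0 j) (fun x => phi (t *: x)) (t * partial j phi (t *: lsubmx z)).
    apply: (iffLR (@is_derive_affine _ _ _ _ phi (fun x => t *: x) _ _ (t *: delta_mx ord0 j) _ _)).
      by move=> h; rewrite scalerDr !scalerA mulrC.
    by apply: is_derive_scale; exact: smooth_is_derive.
  by [].
by [].
Qed.

Let G t z := H (b z + t *: a z) `^ p.

Let cphil : continuous (fun z : 'rV[R]_(m + k) => phi (lsubmx z)).
Proof. by apply: smooth_continuous; exact: smooth_lsubmx. Qed.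

Let cwr : continuous (fun z : 'rV[R]_(m + k) => w (rsubmx z)).
Proof. by apply: smooth_continuous; exact: smooth_rsubmx. Qed.

Let ma i : measurable_fun setT (fun z => a z ord0 i).
Proof.
rewrite /a; under eq_fun do rewrite mxE.
case: (fintype.split i) => j; last by under eq_fun do rewrite mxE; exact: measurable_cst.
under eq_fun do rewrite !mxE.
apply: continuous_measurable_rV => z.
apply: (@continuousM _ _ (fun z : 'rV[R]_(m + k) => w (rsubmx z)) (fun z => partial j phi (lsubmx z))).
  exact: cwr.
exact: (smooth_continuous (@smooth_lsubmx R m k _ (smooth_partial j sphi))).
Qed.

Let mb i : measurable_fun setT (fun z => b z ord0 i).
Proof.
rewrite /b; under eq_fun do rewrite mxE.
case: (fintype.split i) => j; first by under eq_fun do rewrite mxE; exact: measurable_cst.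
under eq_fun do rewrite !mxE.
apply: continuous_measurable_rV => z.
apply: (@continuousM _ _ (fun z : 'rV[R]_(m + k) => phi (lsubmx z)) (fun z => partial j w (rsubmx z))).
  exact: cphil.
exact: (smooth_continuous (@smooth_rsubmx R m k _ (smooth_partial j sw))).
Qed.

Let mpow (c : 'rV[R]_(m + k) -> 'rV[R]_(m + k)) :
  (forall i, measurable_fun setT (fun z => c z ord0 i)) ->
  measurable_fun setT (fun z => (H (c z) `^ p)%:E).
Proof.
move=> mc; apply/measurable_EFinP; apply: (measurableT_comp (measurable_powR p)).
exact: (gauge_measurable_comp gH mc).
Qed.

Let mG t : measurable_fun setT (fun z => (G t z)%:E).
Proof.
apply: mpow => i; under eq_fun do rewrite mxE [X in _ + X]mxE.
by apply: measurable_funD; [exact: mb|apply: measurable_funM; [exact: measurable_cst|exact: ma]].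
Qed.

Local Open Scope ereal_scope.

(** The Jacobian involves only [|t|]. After this substitution the energies for [t] and [- t] are
    integrals of [H (b + t a)^p] and [H (b - t a)^p] at the same points, where the second difference
    can be applied. *)
Lemma integral_row_mx_scale (f : 'rV[R]_(m + k) -> \bar R) t : (t != 0)%R ->
  measurable_fun setT f -> (forall z, 0 <= f z) ->
  \int[mu]_z f (row_mx (t *: lsubmx z) (rsubmx z))%R =
  (`|t|^-1 ^+ m)%:E * \int[mu]_z f z.
Proof.
move=> t0 mf f0.
have mrow : measurable_fun setT (fun z : 'rV[R]_(m + k) => row_mx (t *: lsubmx z) (rsubmx z))%R.
  apply: measurable_fun_rV => i; under eq_fun do rewrite mxE.
  case: (fintype.split i) => j; under eq_fun do rewrite !mxE.
    by apply: measurable_funM => //; exact: measurable_coord.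
  exact: measurable_coord.
rewrite ge0_integral_row_mx_swap//; last exact: measurableT_comp mf mrow.
rewrite [in RHS]ge0_integral_row_mx_swap//.
have mfr : measurable_fun setT (fun z : 'rV[R]_m * 'rV[R]_k => f (row_mx z.1 z.2)).
  exact: measurableT_comp mf (@measurable_row_mx R m k).
rewrite -ge0_integralZl//; last 2 first.
- by apply: (@measurable_fun_fubini_tonelli_G _ _ _ _ R mu1 _ mfr) => z; exact: f0.
- by move=> y _; apply: integral_ge0 => x _; exact: f0.
apply: eq_integral => y _.
have mfy : measurable_fun setT (fun x => f (row_mx x y)).
  exact: measurableT_comp mfr (measurable_pair2 _).
have := ge0_integral_scale t0 mfy (fun x => f0 _) => <-.
by apply: eq_integral => x _; rewrite row_mxKl row_mxKr.
Qed.

Lemma integral_tensor (f : 'rV[R]_m -> R) (g : 'rV[R]_k -> R) :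
  (forall x, (0 <= f x)%R) -> (forall y, (0 <= g y)%R) ->
  mu1.-integrable setT (EFin \o f) -> mu2.-integrable setT (EFin \o g) ->
  \int[mu]_z (f (lsubmx z) * g (rsubmx z))%:E =
  (\int[mu1]_x f x * \int[mu2]_y g y)%R%:E.
Proof.
move=> f0 g0 intf intg.
have /integrableP[mf _] := intf; have /integrableP[mg _] := intg.
have If : (\int[mu1]_x f x)%R%:E = \int[mu1]_x (f x)%:E.
  by rewrite /Rintegral fineK//; exact: (integrable_fin_num measurableT intf).
have Ig : (\int[mu2]_x g x)%R%:E = \int[mu2]_x (g x)%:E.
  by rewrite /Rintegral fineK//; exact: (integrable_fin_num measurableT intg).
have mfl : measurable_fun setT (fun z : 'rV[R]_(m + k) => f (lsubmx z)).
  apply: (measurableT_comp (iffLR (measurable_EFinP _ _) mf)).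
  apply: measurable_fun_rV => i; under eq_fun do rewrite mxE; exact: measurable_coord.
have mgr : measurable_fun setT (fun z : 'rV[R]_(m + k) => g (rsubmx z)).
  apply: (measurableT_comp (iffLR (measurable_EFinP _ _) mg)).
  apply: measurable_fun_rV => i; under eq_fun do rewrite mxE; exact: measurable_coord.
rewrite ge0_integral_row_mx_swap; last 2 first.
- by apply/measurable_EFinP; exact: measurable_funM.
- by move=> z; rewrite lee_fin mulr_ge0.
transitivity (\int[mu2]_y ((\int[mu1]_x f x)%R%:E * (g y)%:E)).
  apply: eq_integral => y _.
  rewrite If -ge0_integralZr//; last by rewrite lee_fin.
    by apply: eq_integral => x _; rewrite row_mxKl row_mxKr EFinM.
  by move=> x _; rewrite lee_fin.
rewrite ge0_integralZl//; last 2 first.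
- by move=> y _; rewrite lee_fin.
- by rewrite lee_fin Rintegral_ge0.
by rewrite -Ig EFinM.
Qed.

Local Close Scope ereal_scope.

Let gH1 : gauge H1. Proof. exact: gauge_row_mxl. Qed.
Let gH2 : gauge H2. Proof. exact: gauge_row_mx0. Qed.

Let G_ge0 t z : (0 <= (G t z)%:E)%E. Proof. by rewrite lee_fin powR_ge0. Qed.

Let test_tensor t : t != 0 -> test_fun (cylinder w1 w2 `|t|^-1) (tensor t).
Proof. by move=> t0; apply: test_fun_tensor; rewrite ?invrK// invr_gt0 normr_gt0. Qed.

Let energy_tensor t : t != 0 ->
  (energy p H (tensor t))%:E =
  ((`|t|^-1 ^+ m)%:E * \int[mu]_z (G t z)%:E)%E.
Proof.
move=> t0; rewrite (energy_EFin p1 gH (test_tensor t0)).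
have := integral_row_mx_scale t0 (mG t) (G_ge0 t) => <-.
by apply: eq_integral => z _; rewrite grad_tensor.
Qed.

Let Cphi : Cc phi. Proof. exact: test_fun_Cc test_fun_phi. Qed.
Let Cw : Cc w. Proof. exact: test_fun_Cc tw. Qed.

Lemma mass_tensor t : t != 0 ->
  mass p (tensor t) = `|t|^-1 ^+ m * (mass p phi * mass p w).
Proof.
move=> t0; apply/EFin_inj; rewrite (mass_EFin p1 (test_tensor t0)) EFinM.
pose f x := `|phi x| `^ p; pose g y := `|w y| `^ p.
have intf : mu1.-integrable setT (EFin \o f) by exact: Cc_powR_integrable.
have intg : mu2.-integrable setT (EFin \o g) by exact: Cc_powR_integrable.
have f0 x : 0 <= f x by exact: powR_ge0.
have g0 y : 0 <= g y by exact: powR_ge0.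
rewrite -(integral_tensor f0 g0 intf intg) -integral_row_mx_scale//.
  by apply: eq_integral => z _; rewrite row_mxKl row_mxKr /f /g /tensor normrM powRM.
- apply/measurable_EFinP; apply: measurable_funM.
    apply: (measurableT_comp (measurable_powR p)); apply: measurableT_comp => //.
    exact: continuous_measurable_rV cphil.
  apply: (measurableT_comp (measurable_powR p)); apply: measurableT_comp => //.
  exact: continuous_measurable_rV cwr.
- by move=> z; rewrite lee_fin mulr_ge0.
Qed.

Let H_b z : H (b z) `^ p = `|phi (lsubmx z)| `^ p * H2 (grad w (rsubmx z)) `^ p.
Proof.
by rewrite /b -[X in row_mx X](scaler0 _ (phi (lsubmx z))) -scale_row_mx HZ powRM.
Qed.

Let H_a z : H (a z) `^ p = H1 (grad phi (lsubmx z)) `^ p * `|w (rsubmx z)| `^ p.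
Proof.
by rewrite /a -[X in row_mx _ X](scaler0 _ (w (rsubmx z))) -scale_row_mx HZ powRM// mulrC.
Qed.

Let int_b : (\int[mu]_z (H (b z) `^ p)%:E)%E = (mass p phi * energy p H2 w)%:E.
Proof.
under eq_integral do rewrite H_b.
apply: (integral_tensor (f := fun x => `|phi x| `^ p) (g := fun y => H2 (grad w y) `^ p)).
- by move=> x; exact: powR_ge0.
- by move=> y; exact: powR_ge0.
- exact: Cc_powR_integrable.
- exact: (energy_integrable p1 gH2 tw).
Qed.

Let int_a : (\int[mu]_z (H (a z) `^ p)%:E)%E = (energy p H1 phi * mass p w)%:E.
Proof.
under eq_integral do rewrite H_a.
apply: (integral_tensor (f := fun x => H1 (grad phi x) `^ p) (g := fun y => `|w y| `^ p)).
- by move=> x; exact: powR_ge0.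
- by move=> y; exact: powR_ge0.
- exact: (energy_integrable p1 gH1 test_fun_phi).
- exact: Cc_powR_integrable.
Qed.

Variables (eps C : R).
Hypotheses (eps0 : 0 < eps) (C0 : 0 <= C).
Hypothesis HC : forall t a b, H (b + t *: a) `^ p + H (b - t *: a) `^ p <=
    (2 + eps * `|t|) * H b `^ p + (eps * `|t| + C * `|t| `^ p) * H a `^ p.

Let int_G t : (\int[mu]_z (G t z)%:E + \int[mu]_z (G (- t)%R z)%:E <=
  ((2 + eps * `|t|) * (mass p phi * energy p H2 w) +
   (eps * `|t| + C * `|t| `^ p) * (energy p H1 phi * mass p w))%:E)%E.
Proof.
have c1 : 0 <= 2 + eps * `|t| by rewrite addr_ge0// mulr_ge0// ltW.
have c2 : 0 <= eps * `|t| + C * `|t| `^ p.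
  by rewrite addr_ge0 ?mulr_ge0 ?powR_ge0// ltW.
rewrite -ge0_integralD//.
rewrite EFinD [X in (_ <= X + _)%E]EFinM [X in (_ <= _ + X)%E]EFinM -int_b -int_a.
have mHb := mpow mb; have mHa := mpow ma.
have b0 z : (0 <= (H (b z) `^ p)%:E)%E by rewrite lee_fin powR_ge0.
have a0 z : (0 <= (H (a z) `^ p)%:E)%E by rewrite lee_fin powR_ge0.
rewrite -!ge0_integralZl//.
rewrite -ge0_integralD//; last 4 first.
- by move=> z _; rewrite mule_ge0.
- exact: measurable_funeM.
- by move=> z _; rewrite mule_ge0.
- exact: measurable_funeM.
apply: ge0_le_integral => //.
- by move=> z _; apply: adde_ge0; exact: G_ge0.
- by apply: emeasurable_funD; exact: mG.
- by apply: emeasurable_funD; exact: measurable_funeM.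
move=> z _; rewrite -!EFinM -!EFinD lee_fin /G scaleNr; exact: HC.
Qed.

(** Both signs of [t] give competitors of the same mass, and adding their two inequalities produces
    the factor [2]. The Jacobian [c] is common to energies and masses and cancels. *)
Lemma eigen1_cylinder_le l x0 y0 : 0 < l -> phi x0 != 0 -> w y0 != 0 ->
  2 * eigen1 p (cylinder w1 w2 l) H <=
  (2 + eps / l) * (energy p H2 w / mass p w) +
  (eps / l + C * (l^-1) `^ p) * (energy p H1 phi / mass p phi).
Proof.
move=> l0 phix wy.
have mphi0 : 0 < mass p phi by exact: (mass_gt0 p1 test_fun_phi phix).
have mw0 : 0 < mass p w by exact: (mass_gt0 p1 tw wy).
pose t := l^-1.
have t0 : 0 < t by rewrite invr_gt0.
have tn : `|t| = t by rewrite gtr0_norm.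
have tn0 : t != 0 by rewrite gt_eqF.
have tN0 : - t != 0 by rewrite oppr_eq0.
set c := t^-1 ^+ m.
have c0 : 0 < c by rewrite exprn_gt0// invr_gt0.
set lam := eigen1 _ _ _.
have lamE s : `|s| = t -> lam * (c * (mass p phi * mass p w)) <= energy p H (tensor s).
  move=> st; have sn0 : s != 0 by rewrite -normr_eq0 st.
  have ts : test_fun (cylinder w1 w2 l) (tensor s) by apply: test_fun_tensor.
  have mE : c * (mass p phi * mass p w) = mass p (tensor s) by rewrite mass_tensor// st.
  have m0 : 0 < mass p (tensor s) by rewrite -mE !mulr_gt0.
  have sx : tensor s (row_mx (s^-1 *: x0) y0) != 0.
    by rewrite /tensor row_mxKl row_mxKr scalerA mulfV// scale1r mulf_neq0.
  by rewrite mE -ler_pdivlMr//; exact: (eigen1_le p1 gH ts sx).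
have lam1 := lamE t tn; have lam2 : lam * (c * (mass p phi * mass p w)) <= energy p H (tensor (- t)).
  by apply: lamE; rewrite normrN.
have S : 2 * (lam * (c * (mass p phi * mass p w))) <=
   c * ((2 + eps * t) * (mass p phi * energy p H2 w) +
   (eps * t + C * t `^ p) * (energy p H1 phi * mass p w)).
  rewrite mulr_natl mulr2n; apply: (le_trans (lerD lam1 lam2)).
  have E1 := energy_tensor tn0; have E2 := energy_tensor tN0.
  have I := int_G t.
  rewrite normrN !tn -!/c in E1 E2 I.
  by apply: (addr_le_of_EFin (ltW c0) _ _ E1 E2 I); apply: integral_ge0 => z _; exact: G_ge0.
have mm0 : 0 < mass p phi * mass p w by rewrite mulr_gt0.
move: S; rewrite (_ : 2 * (lam * (c * (mass p phi * mass p w))) =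
  c * (2 * lam * (mass p phi * mass p w))); last by ring.
rewrite ler_pM2l// -ler_pdivlMr// => /le_trans; apply.
rewrite le_eqVlt; apply/orP; left; apply/eqP; rewrite -/t.
by field; rewrite !gt_eqF.
Qed.

End tensor.

(** Since [p > 1], [K l^(-p)] is at most [1 / l] as soon as [K <= l^(p-1)], whence the threshold. *)
Lemma powR_inv_le_inv (R : realType) (p K l : R) : 1 < p -> 0 <= K -> 1 <= l ->
  K `^ (p - 1)^-1 <= l -> K * l^-1 `^ p <= l^-1.
Proof.
move=> p1 K0 l1 Kl.
have l0 : 0 < l by exact: lt_le_trans l1.
have q0 : 0 < p - 1 by rewrite subr_gt0.
have Kq : K <= l `^ (p - 1).
  rewrite -[leLHS](@powRr1 R) // -[X in _ `^ X](@mulVf R (p - 1)) ?gt_eqF// powRrM.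
  by rewrite ge0_ler_powR ?nnegrE ?powR_ge0// ltW.
rewrite (_ : p = (p - 1) + 1); last by rewrite subrK.
rewrite powRD; last by apply/implyP => _; rewrite gt_eqF ?invr_gt0.
rewrite powRr1 ?invr_ge0 ?(ltW l0)// mulrA; apply: ler_piMl; first by rewrite invr_ge0 ltW.
apply: (le_trans (ler_wpM2r (powR_ge0 _ _) Kq)).
by rewrite -powRM ?invr_ge0 ?(ltW l0)// mulfV ?gt_eqF// powR1.
Qed.

(** * The two bounds on the cylinder *)

Section bounds.
Context {R : realType} {m k : nat}.
Variables (p : R) (H : 'rV[R]_(m + k) -> R) (w1 : set 'rV[R]_m) (w2 : set 'rV[R]_k).
Hypotheses (p1 : 1 < p) (nH : C1_norm H) (w1_nbhs : nbhs (0 : 'rV[R]_m) w1).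

Let gH := C1_norm_gauge nH.
Let gH2 := gauge_row_mx0 gH.

Let cylinder_strip l : cylinder w1 w2 l `<=` [set z | w2 (rsubmx z)].
Proof. by move=> z []. Qed.

Lemma exists_bump_in : exists r (phi : 'rV[R]_m -> R),
  [/\ box m r `<=` w1, smooth phi, forall x, r < `|x| -> phi x = 0 & 0 < phi 0].
Proof.
have /nbhs_ballP[r r0 rw1] := w1_nbhs.
have [phi [sphi _ phir phi0]] := @exists_bump R m (r / 2) (divr_gt0 r0 (ltr0Sn R 1)).
exists (r / 2), phi; split=> // x xr; apply: rw1.
rewrite -ball_normE /= sub0r normrN; apply: le_lt_trans xr _.
by rewrite ltr_pdivrMr// ltr_pMr// ltr1n.
Qed.

(** A tensor product of a bump and a nonzero test function on [w2] is a competitor. By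
    contraposition an empty set of quotients on the cylinder forces one on [w2], and both infima are
    then [0]. *)
Lemma rayleigh_cylinder l : 0 < l -> rayleigh p w2 (fun z => H (row_mx 0 z)) !=set0 ->
  rayleigh p (cylinder w1 w2 l) H !=set0.
Proof.
move=> l0 [q wq]; have [r [phi [rw1 sphi phir phi0]]] := exists_bump_in.
have [w [tw [y wy] _]] := rayleigh_approx p1 gH2 wq ltr01.
have lV : `|l^-1| = l^-1 by rewrite ger0_norm// invr_ge0 ltW.
eexists; apply: (@rayleigh_test _ _ _ _ p1 gH _ _ (row_mx 0 y)
  (test_fun_tensor sphi phir rw1 tw l0 lV)).
by rewrite /tensor row_mxKl row_mxKr scaler0 mulf_neq0// gt_eqF.
Qed.

Lemma mu_oo_le_lambda1 l : 0 < l -> mu_oo p H w2 <= lambda1 p H w1 w2 l.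
Proof.
move=> l0; rewrite /lambda1 /eigen1.
have [E|/set0P cyl0] := eqVneq (rayleigh p (cylinder w1 w2 l) H) set0.
  rewrite E inf0 /mu_oo /eigen1; have [->|/set0P w20] := eqVneq (rayleigh p w2 (fun z => H (row_mx 0 z))) set0.
    by rewrite inf0.
  by have := rayleigh_cylinder l0 w20; rewrite E => -[].
apply: lb_le_inf => // q cq; apply/ler_addgt0Pr => e e0.
have [v [tv [x vx] Ev]] := rayleigh_approx p1 gH cq e0.
rewrite -(ler_pM2r (mass_gt0 p1 tv vx)); apply: le_trans Ev.
by apply: mu_oo_mass_le => //; exact: test_fun_sub tv.
Qed.

(** Twice the eigenvalue has to stay below [2 mu_oo + 2 / l]. The near-minimizer on [w2] costs
    [1 / (2 l)], the terms in [eps] another [1 / (2 l)], and the term in [C] costs [1 / l]. *)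
Lemma near_lambda1_le :
  \forall l \near +oo, lambda1 p H w1 w2 l <= mu_oo p H w2 + l^-1.
Proof.
have [r [phi [rw1 sphi phir phi0]]] := exists_bump_in.
have phi0' : phi 0 != 0 by rewrite gt_eqF.
pose D := energy p (fun z => H (row_mx z 0)) phi / mass p phi.
have D0 : 0 <= D by rewrite divr_ge0 ?energy_ge0 ?mass_ge0.
have mu0 : 0 <= mu_oo p H w2 by exact: eigen1_ge0.
(* Bounds the near-minimal quotient on [w2] plus the quotient [D] of [phi], so [eps = 1 / (2 N)]
   limits the terms in [eps] to [1 / (2 l)]. *)
pose N := mu_oo p H w2 + 1 + D.
have N0 : 0 < N by rewrite /N ltr_wpDr// ltr_wpDl.
have eps0 : 0 < (2 * N)^-1 by rewrite invr_gt0 mulr_gt0.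
have [C C0 HC] := second_difference_scale nH p1 eps0.
near=> l.
have l1 : 1 <= l by near: l; apply: nbhs_pinfty_ge; exact: num_real.
have lC : (C * D) `^ (p - 1)^-1 <= l by near: l; apply: nbhs_pinfty_ge; exact: num_real.
have l0 : 0 < l by exact: lt_le_trans l1.
have lV : 0 < l^-1 by rewrite invr_gt0.
have CDl := powR_inv_le_inv p1 (mulr_ge0 C0 D0) l1 lC.
(* Without quotients on [w2] there are none on the cylinder, by [rayleigh_strip], and [lambda1] is
   [0] by the convention on [inf]. *)
have [w20|/set0P w20] := eqVneq (rayleigh p w2 (fun z => H (row_mx 0 z))) set0.
  rewrite (_ : lambda1 p H w1 w2 l = 0) ?addr_ge0 ?(ltW lV)// /lambda1 /eigen1.
  have [->|/set0P[q cq]] := eqVneq (rayleigh p (cylinder w1 w2 l) H) set0.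
    exact: inf0.
  have [v [tv [x vx] _]] := rayleigh_approx p1 gH cq ltr01.
  have := rayleigh_strip p1 nH (test_fun_sub (@cylinder_strip l) tv) vx.
  by rewrite w20 => -[].
(* Used twice, for a quotient close to the infimum and for a test function close to that quotient:
   [1 / (4 l)] in all, doubled in the final sum. The test function [w] thus depends on [l], while
   [C] does not. *)
have d0 : 0 < l^-1 / 8 by rewrite divr_gt0.
have /(inf_adherent d0)[q wq qlt] : has_inf (rayleigh p w2 (fun z => H (row_mx 0 z))).
  by split => //; exists 0 => q; exact: rayleigh_ge0.
have [w [tw [y wy] Ew]] := rayleigh_approx p1 gH2 wq d0.
have mw0 := mass_gt0 p1 tw wy.
have := eigen1_cylinder_le p1 nH sphi phir rw1 tw eps0 C0 HC l0 phi0' wy.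
rewrite -/D -/(lambda1 p H w1 w2 l).
move: Ew; rewrite -ler_pdivrMr//; set Q := _ / mass p w => Ew.
rewrite -/(eigen1 _ _ _) -/(mu_oo p H w2) in qlt.
have QN : Q + D <= N.
  rewrite lerD2r; apply: (le_trans Ew).
  have lV1 : l^-1 <= 1 by rewrite invf_le1.
  move: qlt lV1; move: (mu_oo p H w2) (l^-1) => u t; lra.
have S : (2 * N)^-1 / l * (Q + D) <= l^-1 / 2.
  have aN : 0 <= (2 * N)^-1 / l by rewrite mulr_ge0 ?ltW.
  apply: (le_trans (ler_wpM2l aN QN)); rewrite le_eqVlt; apply/orP; left; apply/eqP.
  by field; rewrite !gt_eqF.
move: Ew qlt CDl S; move: (mu_oo p H w2) (lambda1 p H w1 w2 l) ((2 * N)^-1 / l).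
move: (l^-1 `^ p) (l^-1) => x t u L a; clearbody Q D; lra.
Unshelve. all: by end_near.
Qed.

End bounds.

Theorem theorem1p6 (R : realType) :
  exists C : R -> R -> R,
  forall (m k : nat) (w1 : set 'rV[R]_m) (w2 : set 'rV[R]_k)
    (H : 'rV[R]_(m + k) -> R) (p : R),
  (0 < m)%N -> (0 < k)%N ->
  open w1 -> bounded_set w1 -> convex_set w1 -> w1 0 ->
  open w2 -> bounded_set w2 ->
  C1_norm H -> 1 < p -> flux_bounds p H ->
  \forall l \near +oo,
    mu_oo p H w2 <= lambda1 p H w1 w2 l
      <= mu_oo p H w2 + C p (mu_oo p H w2) / l.
Proof.
(* The constant can be [1] because the linear terms in [1 / l] carry a factor as small as desired;
   how small is paid for by the threshold on [l]. *)
exists (fun _ _ => 1) => m k w1 w2 H p _ _ ow1 _ _ w10 _ _ nH p1 _.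
have w1n : nbhs (0 : 'rV[R]_m) w1 by exact: open_nbhs_nbhs.
near=> l; apply/andP; split.
  by apply: mu_oo_le_lambda1 => //; near: l; apply: nbhs_pinfty_gt; exact: num_real.
by rewrite mul1r; near: l; exact: near_lambda1_le.
Unshelve. all: by end_near.
Qed.
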